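(* Let $p,n,N,M\in\mathbb{N}$, let $\Omega\subseteq\mathbb{R}^n$ be an open set, let $$F:\ \Omega\times\Big(\mathbb{R}^N\times\mathbb{R}^{Nn}\times\cdots\times\mathbb{R}^{Nn^p}_s\Big)\to\mathbb{R}^M$$ be a Carathéodory map and let $u:\Omega\to\mathbb{R}^N$ be a $\mathcal{D}$-solution to the $p$th order PDE system $F(x,u(x),D^{[p]}u(x))=0$, $x\in\Omega$. Then there exists a multi-indexed sequence of maps $(u^{\underline{m}})_{\underline{m}\in\mathbb{N}^{p\times p}}\subseteq C^\infty_0(\Omega,\mathbb{R}^N)$ such that, for any diffuse $p$th order jet $\mathcal{D}^{[p]}u$ of $u$ generated along subsequences of an infinitesimal multi-indexed sequence $(h_{\underline{m}})_{\underline{m}\in\mathbb{N}^{p\times p}}$, there exist a single-indexed subsequence $(u^\nu)_{\nu\in\mathbb{N}}\subseteq(u^{\underline{m}})_{\underline{m}\in\mathbb{N}^{p\times p}}$ and measurable maps $f^\nu:\Omega\to\mathbb{R}^M$ for which the following holds. Setting: (i) $u^\nu\to u$ a.e. on $\Omega$ as $\nu\to\infty$; (ii) $\delta_{D^{[p]}u^\nu}\overset{*}{\rightharpoonup}\mathcal{D}^{[p]}u$ in $\mathscr{Y}\big(\Omega,\overline{\mathbb{R}}^{Nn}\times\cdots\times\overline{\mathbb{R}}^{Nn^p}_s\big)$ as $\nu\to\infty$; (iii) for each $\nu\in\mathbb{N}$, $u^\nu$ is a smooth strong solution to $F\big(x,u^\nu(x),D^{[p]}u^\nu(x)\big)=f^\nu(x)$,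 $x\in\Omega$; (iv) for any $\Phi\in C^0_c\big(\mathbb{R}^{Nn}\times\cdots\times\mathbb{R}^{Nn^p}_s\big)$, $\ \Phi\big(D^{[p]}u^\nu\big)f^\nu\to0$ a.e. on $\Omega$ as $\nu\to\infty$. In this setting, the mode of convergence (iv) is (up to the passage to a subsequence) equivalent to either of the following modes of convergence as $\nu\to\infty$: (a) for any $R>0$, $\ \chi_{\mathbb{B}_R(0)}\big(D^{[p]}u^\nu\big)f^\nu\to0$ a.e. on $\Omega$; (b) for any $\varepsilon>0$ and any $A\subseteq\Omega$ with $|A|<\infty$, $$\Big|A\cap\big\{|f^\nu|>\varepsilon\big\}\cap\big\{|D^{[p]}u^\nu|<1/\varepsilon\big\}\Big|\to0 .$$ In addition, $$f^\nu\to0\quad\text{a.e. on }\Omega\setminus E\ \text{ as }\nu\to\infty,\qquad\text{where}\quad E:=\bigcup_{q=1}^p\Big\{x\in\Omega:\ \big[\mathcal{D}^qu(x)\big]\big(\{\infty\}\big)>0\Big\}.$$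
   Context: Spaces. ''Measurable'' means Lebesgue measurable and $|A|$ is the Lebesgue measure of a (measurable) set $A$. $\mathbb{R}^{Nn^q}_s$ is the space of real tensors $\mathbf{X}=(\mathbf{X}_{\alpha i_1\dots i_q})$, $\alpha\in\{1,\dots,N\}$, $i_1,\dots,i_q\in\{1,\dots,n\}$, symmetric in $i_1,\dots,i_q$, with the Euclidean norm; $\mathbb{R}^{Nn^1}_s=\mathbb{R}^{Nn}$. For smooth $v:\Omega\to\mathbb{R}^N$, $D^{[p]}v:=(Dv,D^2v,\dots,D^pv)$. $\mathbb{B}_R(0)$ is the Euclidean ball of radius $R$ centred at $0$ in $\mathbb{R}^{Nn}\times\cdots\times\mathbb{R}^{Nn^p}_s$, and $\chi$ denotes a characteristic function. $\overline{\mathbb{R}}^{Nn^q}_s=\mathbb{R}^{Nn^q}_s\cup\{\infty\}$ is the Alexandroff one-point compactification, metrised as a sphere of equal dimension via stereographic projection. $C^\infty_0(\Omega,\mathbb{R}^N)$ denotes the smooth maps $\Omega\to\mathbb{R}^N$ which vanish on $\partial\Omega$ (i.e. $v(x)\to0$ as $x\to y$, for every $y\in\partial\Omega$); $C^0_c$ denotes continuous real functions with compact support. A map $F$ is Carathéodory if $x\mapsto F(x,\xi)$ is measurable for every $\xi$, and $\xi\mapsto F(x,\xi)$ is continuous for a.e. $x$. Young measures. For measurable $G\subseteq\mathbb{R}^n$ and compact metrisable $\mathbb{K}$, $\mathscr{Y}(G,\mathbb{K})$ is the set of maps $\vartheta:G\to\mathscr{P}(\mathbb{K})$ into the Borel probability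 measures such that $x\mapsto\int_{\mathbb{K}}\Psi\,d[\vartheta(x)]$ is measurable for each $\Psi\in C^0(\mathbb{K})$ (identified if equal a.e.). $\vartheta^m\overset{*}{\rightharpoonup}\vartheta$ in $\mathscr{Y}(G,\mathbb{K})$ means $\int_G\int_{\mathbb{K}}\Phi(x,X)\,d[\vartheta^m(x)](X)dx\to\int_G\int_{\mathbb{K}}\Phi(x,X)\,d[\vartheta(x)](X)dx$ for all $\Phi\in L^1(G,C^0(\mathbb{K}))$. A measurable $v:G\to\mathbb{K}$ gives the Young measure $\delta_v$, $\delta_v(x):=\delta_{v(x)}$. Difference quotients. Fix once and for all an orthonormal frame $\{E^1,\dots,E^N\}$ of $\mathbb{R}^N$ and, for each $\alpha=1,\dots,N$, an orthonormal frame $\{E^{(\alpha)1},\dots,E^{(\alpha)n}\}$ of $\mathbb{R}^n$; put $E^{\alpha i_1\dots i_q}:=E^\alpha\otimes(E^{(\alpha)i_1}\vee\dots\vee E^{(\alpha)i_q})\in\mathbb{R}^{Nn^q}_s$, where $\vee$ is the symmetrised tensor product (average of the tensor products over all permutations of the factors). Measurable maps $u:\Omega\to\mathbb{R}^N$ are extended by zero to $\mathbb{R}^n$. For a unit vector $a$ and $h\ne0$, $D^{1,h}_au(x):=\frac{u(x+ha)-u(x)}{h}$, and $D^{q,h_q\dots h_1}_{a_q\dots a_1}u:=D^{1,h_q}_{a_q}(\cdots(D^{1,h_1}_{a_1}u))$. Indices $\underline{m}\in\mathbb{N}^{p\times p}$ are lower triangular matrices with entries $m_a^b$, $1\le b\le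 a\le p$, and rows $\underline{m}_q=(m_q^1,\dots,m_q^q)$. An infinitesimal multi-indexed sequence $(h_{\underline{m}})$ assigns to each entry $m_a^b$ a number $h_{m_a^b}\in\mathbb{R}\setminus\{0\}$ (the $(a,b)$ entry of $h_{\underline m}$, depending only on $m_a^b$) with $h_{m_a^b}\to0$ as $m_a^b\to\infty$. Set $$D^{q,h_{\underline{m}_q}}u:=\sum_{\alpha,i_1,\dots,i_q}\Big[D^{q,h_{m_q^q}\dots h_{m_q^1}}_{E^{(\alpha)i_q}\dots E^{(\alpha)i_1}}(E^\alpha\cdot u)\Big]E^{\alpha i_1\dots i_q},\qquad D^{[p],h_{\underline{m}}}u:=\big(D^{1,h_{\underline{m}_1}}u,\dots,D^{p,h_{\underline{m}_p}}u\big).$$ Multi-indexed convergence. $\lim_{\underline{m}\to\infty}:=\lim_{m_p^p\to\infty}\cdots\lim_{m_2^2\to\infty}\lim_{m_2^1\to\infty}\lim_{m_1^1\to\infty}$ (successive limits, $m_1^1$ first). A single-indexed subsequence of $(u^{\underline{m}})$ is a sequence $u^\nu=u^{\underline{m}_\nu}$ where each entry of $\underline{m}_\nu$ is a strictly increasing function of $\nu$. Diffuse jets. A diffuse $p$th order jet $\mathcal{D}^{[p]}u$ of a measurable $u:\Omega\to\mathbb{R}^N$ is any weak* limit $\delta_{D^{[p],h_{\underline{m}}}u}\overset{*}{\rightharpoonup}\mathcal{D}^{[p]}u$ in $\mathscr{Y}\big(\Omega,\overline{\mathbb{R}}^{Nn}\times\cdots\times\overline{\mathbb{R}}^{Nn^p}_s\big)$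 arising as $\underline{m}\to\infty$ (in the successive sense) along subsequences (in each index) of an infinitesimal multi-indexed sequence $(h_{\underline{m}})$. A diffuse jet is always a fibre product Young measure $\mathcal{D}^{[p]}u=\mathcal{D}u\times\cdots\times\mathcal{D}^pu$; $\mathcal{D}^qu(x)$ is its component (marginal) on $\overline{\mathbb{R}}^{Nn^q}_s$. $\mathcal{D}$-solutions. For a probability measure $\vartheta$ on $\overline{\mathbb{R}}^{Nn}\times\cdots\times\overline{\mathbb{R}}^{Nn^p}_s$, $\mathrm{supp}_*(\vartheta):=\mathrm{supp}(\vartheta)\cap(\mathbb{R}^{Nn}\times\cdots\times\mathbb{R}^{Nn^p}_s)$. A measurable $u:\Omega\to\mathbb{R}^N$ is a $\mathcal{D}$-solution of $F(x,u,D^{[p]}u)=0$ on $\Omega$ if for every diffuse $p$th order jet $\mathcal{D}^{[p]}u$ of $u$, arising from any infinitesimal multi-indexed sequence, $\sup_{\underline{\mathbf{X}}\in\mathrm{supp}_*(\mathcal{D}^{[p]}u(x))}|F(x,u(x),\underline{\mathbf{X}})|=0$ for a.e. $x\in\Omega$ (the supremum over the empty set being $0$). ''Up to the passage to a subsequence'' in the equivalence means: whenever one of the modes of convergence holds for the sequence, each of the others holds along some subsequence. *)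

(* Defs.v *)
From HB Require Import structures.
From mathcomp Require Import all_boot all_order all_algebra perm.
From mathcomp Require Import all_classical all_reals all_analysis.

Set Implicit Arguments.
Unset Strict Implicit.
Unset Printing Implicit Defensive.

Import Order.TTheory GRing.Theory Num.Theory.
Import numFieldNormedType.Exports.

Local Open Scope classical_set_scope.
Local Open Scope ring_scope.

Definition box (R : realType) (n : nat) (a b : 'rV[R]_n) : set 'rV[R]_n :=
  [set x | forall i, a 0 i < x 0 i <= b 0 i].

Definition box_vol (R : realType) (n : nat) (a b : 'rV[R]_n) : R :=
  \prod_(i < n) Num.max 0 (b 0 i - a 0 i).

Definition lebesgue_outer (R : realType) (n : nat) (A : set 'rV[R]_n) : \bar R :=
  ereal_inf [set \esum_(c in C) (box_vol c.1 c.2)%:E |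
    C in [set C : set ('rV[R]_n * 'rV[R]_n) |
      countable C /\ A `<=` \bigcup_(c in C) box c.1 c.2]].

Section lebesgue_outer_measure.
Local Open Scope ereal_scope.
Context (R : realType) (n : nat).
Let V := 'rV[R]_n.
Let vol (c : V * V) : \bar R := (box_vol c.1 c.2)%:E.

Let vol_ge0 c : 0 <= vol c.
Proof. by rewrite lee_fin; apply: prodr_ge0 => i _; rewrite le_max lexx. Qed.

Let outer_ge0 (A : set V) : 0 <= lebesgue_outer A.
Proof. by apply: le_ereal_inf_tmp => _ [C _ <-]; apply: esum_ge0 => c _; exact: vol_ge0. Qed.

Let outer0 : lebesgue_outer (set0 : set V) = 0.
Proof.
apply/eqP; rewrite eq_le outer_ge0 andbT.
by apply: ereal_inf_lbound; exists set0; [split|rewrite esum_set0].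
Qed.

Let outer_le : {homo @lebesgue_outer R n : A B / A `<=` B >-> A <= B}.
Proof.
move=> A B AB; apply: ereal_inf_le_tmp => _ [C [cC BC] <-].
by exists C => //; split => //; exact: subset_trans BC.
Qed.

Let outer_subadd : sigma_subadditive (@lebesgue_outer R n).
Proof.
move=> A; have [[i ioo]|] := pselect (exists i, lebesgue_outer (A i) = +oo).
  rewrite (eseries_pinfty _ _ ioo) ?leey// => k _.
  by rewrite -ltNye (lt_le_trans _ (outer_ge0 _)).
rewrite -forallNE => Aoo.
suff add2e (e : {posnum R}) : lebesgue_outer (\bigcup_k A k) <=
    \sum_(i <oo) lebesgue_outer (A i) + e%:num%:E.
  by apply/lee_addgt0Pr => _/posnumP[].
rewrite (le_trans _ (epsilon_trick _ _ _))//.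
pose P k (C : set (V * V)) := (countable C /\
  A k `<=` \bigcup_(c in C) box c.1 c.2) /\
  \esum_(c in C) vol c <= lebesgue_outer (A k) + (e%:num / (2 ^ k.+1)%:R)%:E.
have [C PC] : {C : (set (V * V))^nat & forall k, P k (C k)}.
  apply: (@choice _ _ P) => k.
  have fink : lebesgue_outer (A k) \is a fin_num.
    by rewrite ge0_fin_numE// ltey; apply/eqP; exact: Aoo.
  have ek : (0 < e%:num / (2 ^ k.+1)%:R)%R by [].
  have [_ [D [cD AD] <-] Dlt] := lb_ereal_inf_adherent ek fink.
  by exists D; split => //; exact/ltW.
apply: (@le_trans _ _ (\esum_(c in \bigcup_k C k) vol c)).
  apply: ereal_inf_lbound; exists (\bigcup_k C k) => //; split.
    by apply: bigcup_countable => // k _; exact: (PC k).1.1.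
  move=> x [k _ /(PC k).1.2 [c Cc xc]]; exists c => //; by exists k.
rewrite seqDU_bigcup_eq (@esum_bigcupT _ _ _ _ _ (@trivIset_seqDU _ C) vol_ge0).
rewrite -nneseries_esumT; last first.
  by move=> k; apply: esum_ge0 => c _; exact: vol_ge0.
apply: lee_nneseries => [k _ _|k _].
  by apply: esum_ge0 => c _; exact: vol_ge0.
apply: le_trans (PC k).2; apply: ge_ereal_sup => _ [X [finX XD] <-].
by apply: esum_ge; exists X => //; split => //; exact: subset_trans (@subset_seqDU _ _ _).
Qed.

HB.instance Definition _ := isOuterMeasure.Build R V (@lebesgue_outer R n)
  outer0 outer_ge0 outer_le outer_subadd.

End lebesgue_outer_measure.

(* Caratheodory measurable for the outer measure, i.e. Lebesgue measurable (not
   just Borel). *)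
Definition leb_type (R : realType) (n : nat) : Type :=
  caratheodory_type (@lebesgue_outer R n).

HB.instance Definition _ (R : realType) (n : nat) := Measurable.on (leb_type R n).

Definition lebesgue (R : realType) (n : nat) :
    {measure set (leb_type R n) -> \bar R} :=
  let mu : {outer_measure set 'rV[R]_n -> \bar R} := @lebesgue_outer R n in
  (mu : set (caratheodory_type mu) -> \bar R).

Definition borel (T : ptopologicalType) : Type := g_sigma_algebraType (@open T).

HB.instance Definition _ (T : ptopologicalType) := Measurable.on (borel T).

Definition measurable_map (R : realType) (n : nat) (T : ptopologicalType)
    (D : set 'rV[R]_n) (f : 'rV[R]_n -> T) : Prop :=
  measurable_fun (D : set (leb_type R n)) (f : leb_type R n -> borel T).

Definition dot (R : realType) (n : nat) (v w : 'rV[R]_n) : R :=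
  \sum_(i < n) v 0 i * w 0 i.

Definition enorm (R : realType) (n : nat) (v : 'rV[R]_n) : R :=
  Num.sqrt (dot v v).

Definition orthonormal_frame (R : realType) (n : nat) (e : 'I_n -> 'rV[R]_n) :
  Prop := forall i j, dot (e i) (e j) = (i == j)%:R.

Definition tensor (R : realType) (N n q : nat) : Type :=
  prod_topology (fun _ : 'I_N * q.-tuple 'I_n => (R : Type)).

Definition permute (n q : nat) (s : 'S_q) (i : q.-tuple 'I_n) : q.-tuple 'I_n :=
  [tuple tnth i (s k) | k < q].

Definition symmetric_tensor (R : realType) (N n q : nat) : set (tensor R N n q) :=
  [set X | forall a s i, X (a, permute s i) = X (a, i)].

Definition symt (R : realType) (N n q : nat) : Type := @symmetric_tensor R N n q.

Definition sym_average (R : realType) (N n q : nat) (X : tensor R N n q) :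
    tensor R N n q :=
  fun ai => (q`!%:R)^-1 * \sum_(s : 'S_q) X (ai.1, permute s ai.2).

Lemma sym_average_symmetric (R : realType) (N n q : nat) (X : tensor R N n q) :
  sym_average X \in @symmetric_tensor R N n q.
Proof.
apply/mem_set => a t i; rewrite /sym_average /=; congr (_ * _).
rewrite [RHS](reindex_inj (mulIg t)) /=; apply: eq_bigr => s _; congr (X (_, _)).
by apply: eq_from_tnth => k; rewrite !tnth_mktuple permM.
Qed.

(* Symmetrisation in the indices i_1, ..., i_q: the identity on tensors that are
   already symmetric. *)
Definition sym (R : realType) (N n q : nat) (X : tensor R N n q) : symt R N n q :=
  exist _ (sym_average X) (sym_average_symmetric X).

(* The factor of order q of a jet has index q.-1 : 'I_p. *)
Definition jet (R : realType) (N n p : nat) : Type :=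
  prod_topology (fun q : 'I_p => symt R N n q.+1).

Definition jet_bar (R : realType) (N n p : nat) : Type :=
  prod_topology (fun q : 'I_p => one_point_compactification (symt R N n q.+1)).

HB.instance Definition _ (R : realType) (N n p : nat) :=
  Topological.on (jet_bar R N n p).
HB.instance Definition _ (R : realType) (N n p : nat) :=
  isPointed.Build (jet_bar R N n p) (fun=> None).

Definition jet_incl (R : realType) (N n p : nat) (X : jet R N n p) :
  jet_bar R N n p := fun q => Some (X q).

Definition jet_norm (R : realType) (N n p : nat) (X : jet R N n p) : R :=
  Num.sqrt (\sum_(q < p) \sum_(ai : 'I_N * q.+1.-tuple 'I_n) (\val (X q) ai) ^+ 2).

Definition jet_ball (R : realType) (N n p : nat) (r : R) : set (jet R N n p) :=
  [set X | jet_norm X < r].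

Definition partial (R : realType) (n : nat) (s : seq 'I_n) (f : 'rV[R]_n -> R) :
    'rV[R]_n -> R :=
  foldr (fun i g x => 'D_(delta_mx 0 i) g x) f s.

Definition smooth_on (R : realType) (n N : nat) (Omega : set 'rV[R]_n)
    (v : 'rV[R]_n -> 'rV[R]_N) : Prop :=
  forall (a : 'I_N) (s : seq 'I_n) x, Omega x ->
    let g := partial s (fun y => v y 0 a) in
    {for x, continuous g} /\ forall i, derivable g x (delta_mx 0 i).

Definition smooth_vanishing (R : realType) (n N : nat) (Omega : set 'rV[R]_n)
    (v : 'rV[R]_n -> 'rV[R]_N) : Prop :=
  smooth_on Omega v /\
  forall y, (closure Omega `\` interior Omega) y ->
    v x @[x --> within Omega (nbhs y)] --> (0 : 'rV[R]_N).

(* By Schwarz' theorem the symmetrisation does nothing when v is smooth; it only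
   serves to land in the space of symmetric tensors. *)
Definition jet_of (R : realType) (n N p : nat) (v : 'rV[R]_n -> 'rV[R]_N)
    (x : 'rV[R]_n) : jet R N n p :=
  fun q => sym (fun ai => partial ai.2 (fun y => v y 0 ai.1) x).

Arguments jet_of {R n N} p v x.

Definition diffquot (R : realType) (n : nat) (h : R) (a : 'rV[R]_n)
    (w : 'rV[R]_n -> R) : 'rV[R]_n -> R :=
  fun x => (w (x + h *: a) - w x) / h.

(* The head of the list is the difference quotient taken first. *)
Definition iter_diffquot (R : realType) (n : nat) (s : seq (R * 'rV[R]_n))
    (w : 'rV[R]_n -> R) : 'rV[R]_n -> R :=
  foldl (fun g ha => diffquot ha.1 ha.2 g) w s.

Definition frame_tensor (R : realType) (N n q : nat) (E : 'I_N -> 'rV[R]_N)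
    (Ef : 'I_N -> 'I_n -> 'rV[R]_n) (a : 'I_N) (i : q.-tuple 'I_n) :
    symt R N n q :=
  sym (fun bj => E a 0 bj.1 * \prod_(k < q) Ef a (tnth i k) 0 (tnth bj.2 k)).

(* Positions (a, b) with b <= a of a lower triangular p x p matrix (0-based). *)
Definition tri (p : nat) : finType := {a : 'I_p & 'I_a.+1}.

Definition tri_pos (p : nat) (a : 'I_p) (b : 'I_a.+1) : tri p :=
  Tagged (fun a : 'I_p => 'I_a.+1) b.

(* (1,1), (2,1), (2,2), (3,1), ..., (p,p) in 1-based notation *)
Definition tri_order (p : nat) : seq (tri p) :=
  [seq @tri_pos p a b | a <- enum 'I_p, b <- enum 'I_a.+1].

Definition infinitesimal (R : realType) (p : nat) (h : tri p -> nat -> R) : Prop :=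
  forall c, (forall k, h c k != 0) /\ h c k @[k --> \oo] --> (0 : R).

Definition zero_ext (R : realType) (n N : nat) (Omega : set 'rV[R]_n)
    (u : 'rV[R]_n -> 'rV[R]_N) : 'rV[R]_n -> 'rV[R]_N :=
  fun x => if x \in Omega then u x else 0.

Definition diffquot_jet (R : realType) (n N p : nat) (E : 'I_N -> 'rV[R]_N)
    (Ef : 'I_N -> 'I_n -> 'rV[R]_n) (Omega : set 'rV[R]_n)
    (u : 'rV[R]_n -> 'rV[R]_N) (hm : tri p -> R) (x : 'rV[R]_n) : jet R N n p :=
  fun q => sym (fun bj => \sum_(a < N) \sum_(i : q.+1.-tuple 'I_n)
    iter_diffquot [seq (hm (@tri_pos p q b), Ef a (tnth i b)) | b <- enum 'I_q.+1]
      (fun y => dot (E a) (zero_ext Omega u y)) x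
    * \val (frame_tensor E Ef a i) bj).

(* Maps are total on R^n; only their values on the set G (or Omega) matter. *)
Definition young_map (R : realType) (n : nat) (K : ptopologicalType) : Type :=
  'rV[R]_n -> probability (borel K) R.

Definition young (R : realType) (n : nat) (K : ptopologicalType)
    (G : set 'rV[R]_n) (theta : young_map R n K) : Prop :=
  forall Psi : K -> R, continuous Psi ->
    measurable_fun (G : set (leb_type R n))
      (fun x : leb_type R n => \int[theta x]_z Psi z).

Definition supnorm (R : realType) (K : Type) (Psi : K -> R) : \bar R :=
  ereal_sup [set `|Psi z|%:E | z in [set: K]].

Definition simple_map (R : realType) (n : nat) (K : ptopologicalType)
    (G : set 'rV[R]_n) (s : 'rV[R]_n -> K -> R) : Prop :=
  [/\ forall x, G x -> continuous (s x), finite_set (s @` G) &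
      forall Psi, measurable (G `&` s @^-1` [set Psi] : set (leb_type R n))].

(* Bochner integrable maps from G to C^0(K) with the supremum norm. *)
Definition L1C0 (R : realType) (n : nat) (K : ptopologicalType)
    (G : set 'rV[R]_n) (Phi : 'rV[R]_n -> K -> R) : Prop :=
  [/\ forall x, G x -> continuous (Phi x),
      exists s : nat -> 'rV[R]_n -> K -> R, (forall k, simple_map G (s k)) /\
        {ae lebesgue R n, forall x, G x ->
          supnorm (fun z => Phi x z - s k x z) @[k --> \oo] --> 0%E} &
      (\int[lebesgue R n]_(x in G) supnorm (Phi x) < +oo)%E].

Definition young_pairing (R : realType) (n : nat) (K : ptopologicalType)
    (G : set 'rV[R]_n) (theta : young_map R n K) (Phi : 'rV[R]_n -> K -> R) : R :=
  \int[lebesgue R n]_(x in G) (\int[theta x]_z Phi x z).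

Definition young_cvg (R : realType) (n : nat) (K : ptopologicalType)
    (G : set 'rV[R]_n) (theta_ : nat -> young_map R n K)
    (theta : young_map R n K) : Prop :=
  [/\ forall k, young G (theta_ k), young G theta &
      forall Phi, L1C0 G Phi ->
        young_pairing G (theta_ k) Phi @[k --> \oo] --> young_pairing G theta Phi].

Definition young_dirac (R : realType) (n : nat) (K : ptopologicalType)
    (v : 'rV[R]_n -> K) : young_map R n K :=
  fun x => dirac (v x : borel K).

Definition supp (R : realType) (K : ptopologicalType)
    (theta : probability (borel K) R) : set K :=
  [set z | forall U : set K, open_nbhs z U -> (0 < theta U)%E].

Definition supp_star (R : realType) (N n p : nat)
    (theta : probability (borel (jet_bar R N n p)) R) : set (jet R N n p) :=
  [set X | supp theta (jet_incl X)].

Definition increasing_index (k : nat -> nat) : Prop :=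
  {homo k : i j / (i < j)%N}.

(* Successive limit of f along the coordinates listed in l, the head of l being
   the innermost limit. *)
Fixpoint successive_lim (I : eqType) (Y : Type) (cv : (nat -> Y) -> Y -> Prop)
    (l : seq I) (f : (I -> nat) -> Y) (L : Y) : Prop :=
  if l is c :: l' then
    exists g : (I -> nat) -> Y,
      (forall m, cv (fun k => f [eta m with c |-> k]) (g m)) /\
      successive_lim cv l' g L
  else forall m, f m = L.

Definition diffuse_jet (R : realType) (n N p : nat) (E : 'I_N -> 'rV[R]_N)
    (Ef : 'I_N -> 'I_n -> 'rV[R]_n) (Omega : set 'rV[R]_n)
    (u : 'rV[R]_n -> 'rV[R]_N) (h : tri p -> nat -> R)
    (J : young_map R n (jet_bar R N n p)) : Prop :=
  exists2 k : tri p -> nat -> nat, (forall c, increasing_index (k c)) &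
    successive_lim (@young_cvg R n (jet_bar R N n p) Omega) (tri_order p)
      (fun m => young_dirac (fun x =>
         jet_incl (diffquot_jet E Ef Omega u (fun c => h c (k c (m c))) x)))
      J.

Definition caratheodory_map (R : realType) (n M : nat) (T : topologicalType)
    (Omega : set 'rV[R]_n) (F : 'rV[R]_n -> T -> 'rV[R]_M) : Prop :=
  (forall xi, measurable_map Omega (F ^~ xi)) /\
  {ae lebesgue R n, forall x, Omega x -> continuous (F x)}.

Definition D_solution (R : realType) (n N M p : nat) (E : 'I_N -> 'rV[R]_N)
    (Ef : 'I_N -> 'I_n -> 'rV[R]_n) (Omega : set 'rV[R]_n)
    (F : 'rV[R]_n -> 'rV[R]_N * jet R N n p -> 'rV[R]_M)
    (u : 'rV[R]_n -> 'rV[R]_N) : Prop :=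
  measurable_map Omega u /\
  forall (h : tri p -> nat -> R) (J : young_map R n (jet_bar R N n p)),
    infinitesimal h -> diffuse_jet E Ef Omega u h J ->
    {ae lebesgue R n, forall x, Omega x ->
      ereal_sup (0%E |` [set (enorm (F x (u x, X)))%:E | X in supp_star (J x)])
        = 0%E}.

Definition cvg_ae_on (R : realType) (n : nat) (T : topologicalType)
    (Omega : set 'rV[R]_n) (g : nat -> 'rV[R]_n -> T) (g0 : 'rV[R]_n -> T) : Prop :=
  {ae lebesgue R n, forall x, Omega x -> g k x @[k --> \oo] --> g0 x}.

Definition mode_test (R : realType) (n N M p : nat) (Omega : set 'rV[R]_n)
    (v : nat -> 'rV[R]_n -> 'rV[R]_N) (f : nat -> 'rV[R]_n -> 'rV[R]_M) : Prop :=
  forall Phi : jet R N n p -> R,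
    continuous Phi -> compact (closure [set X | Phi X != 0]) ->
    cvg_ae_on Omega (fun k x => Phi (jet_of p (v k) x) *: f k x) (fun=> 0).

Definition mode_ball (R : realType) (n N M p : nat) (Omega : set 'rV[R]_n)
    (v : nat -> 'rV[R]_n -> 'rV[R]_N) (f : nat -> 'rV[R]_n -> 'rV[R]_M) : Prop :=
  forall r : R, 0 < r ->
    cvg_ae_on Omega
      (fun k x => \1_(@jet_ball R N n p r) (jet_of p (v k) x) *: f k x) (fun=> 0).

Definition mode_measure (R : realType) (n N M p : nat) (Omega : set 'rV[R]_n)
    (v : nat -> 'rV[R]_n -> 'rV[R]_N) (f : nat -> 'rV[R]_n -> 'rV[R]_M) : Prop :=
  forall (eps : R) (A : set (leb_type R n)), 0 < eps ->
    measurable A -> A `<=` Omega -> (lebesgue R n A < +oo)%E ->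
    lebesgue R n (A `&` [set x | eps < enorm (f k x)]
                    `&` [set x | jet_norm (jet_of p (v k) x) < eps^-1])
      @[k --> \oo] --> 0%E.

Definition implies_along_subseq (X Y : Type)
    (P Q : (nat -> X) -> (nat -> Y) -> Prop) (v : nat -> X) (f : nat -> Y) : Prop :=
  P v f -> exists2 k : nat -> nat, increasing_index k & Q (v \o k) (f \o k).

Definition equiv_along_subseq (X Y : Type)
    (P Q : (nat -> X) -> (nat -> Y) -> Prop) (v : nat -> X) (f : nat -> Y) : Prop :=
  implies_along_subseq P Q v f /\ implies_along_subseq Q P v f.

Definition infinity_set (R : realType) (n N p : nat) (Omega : set 'rV[R]_n)
    (J : young_map R n (jet_bar R N n p)) : set 'rV[R]_n :=
  \bigcup_(q in [set: 'I_p]) [set x | Omega x /\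
    (0 < pushforward (J x)
       (fun z : borel (jet_bar R N n p) =>
          z q : borel (one_point_compactification (symt R N n q.+1)))
       [set None])%E].

Definition single_subsequence (p : nat) (idx : nat -> tri p -> nat) : Prop :=
  forall c, increasing_index (fun k => idx k c).

Definition approximates (R : realType) (n N M p : nat) (Omega : set 'rV[R]_n)
    (F : 'rV[R]_n -> 'rV[R]_N * jet R N n p -> 'rV[R]_M)
    (u : 'rV[R]_n -> 'rV[R]_N) (J : young_map R n (jet_bar R N n p))
    (v : nat -> 'rV[R]_n -> 'rV[R]_N) (f : nat -> 'rV[R]_n -> 'rV[R]_M) : Prop :=
  [/\ forall k, measurable_map Omega (f k),
      cvg_ae_on Omega v u,
      young_cvg Omega
        (fun k => young_dirac (fun x => jet_incl (jet_of p (v k) x))) J &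
      forall k x, Omega x -> F x (v k x, jet_of p (v k) x) = f k x].

(* Main.v *)
Require Import Defs.
From HB Require Import structures.
From mathcomp Require Import all_boot all_order all_algebra perm finmap.
From mathcomp Require Import all_classical all_reals all_analysis.
From mathcomp Require Import measurable_realfun.
From mathcomp Require Import zify ring lra.

(** The jets of smooth functions are flexible: up to almost everywhere limits,
    the values of a smooth function and of its derivatives of each order can be
    prescribed independently of each other. The theorem follows from this fact
    and from the definition of the diffuse jet as a limit of jets of difference
    quotients.

    Flexibility is proved for an explicit countable family. A cell sum is a
    finite sum of rational multiples of monomials, each based at the corner of
    a cell of a mesh of width 1/(m+1) and multiplied by a smooth bump built from
    exp(-d/t). As d tends to 0 the bump tends to 1 inside the cell, with all its
    derivatives; as the mesh is refined, every derivative of the monomial except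
    one tends to 0 at the points of the cell. Hence the field equal to one basis
    vector on an open set is a limit of jets of cell sums (approximable_open).
    Outer regularity passes to measurable sets, simple functions pass to
    measurable fields (decode_ae_cvg). Cell sums vanish outside Omega and are
    smooth on the whole space.

    Let J be a diffuse jet of u. The Dirac measures of the difference quotients
    are limits of the Dirac measures of jets of cell sums whose values tend to u
    at the same time. The property of being met, for finitely many tests and for
    the distance to u, by arbitrarily late members of the family is closed under
    weak limits (reachable_closed), so it passes through the successive limits
    to J. Countably many tests determine convergence of Young measures
    (young_determined), and a diagonal choice gives a sequence v_k of cell sums
    with v_k -> u almost everywhere and with jets generating J
    (diffuse_jet_sequence).

    Let f_k = F(x, v_k, D v_k). Cut off by a compactly supported function of the
    jet, the truncated size of F(x, u, .) is a test function; it vanishes on the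
    support of J, because u is a D-solution, so its mean along the jets of v_k
    tends to 0. Uniform continuity on compact sets allows u to be replaced by
    v_k (residual_cutoff_cvg0). Where J does not charge infinity the cut-off can
    be removed by tightness (residual_tight_cvg0). A subsequence then gives
    almost everywhere convergence.

    Convergence against compactly supported functions of the jet and convergence
    on balls of jets are equivalent because bounded sets of jets are relatively
    compact. They imply local convergence in measure by dominated convergence,
    and the converse holds along a subsequence by summability. *)

Set Implicit Arguments.
Unset Strict Implicit.
Unset Printing Implicit Defensive.

Import Order.TTheory GRing.Theory Num.Theory.
Import numFieldNormedType.Exports.

Local Open Scope classical_set_scope.
Local Open Scope ring_scope.

(** * Lebesgue measure of boxes, half-spaces and open sets *)

(** A cover may list the same box several times once its members are cut: the map
    need not be injective, and one preimage is chosen for each point of the image. *)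
Lemma le_esum_image (R : realType) (T T' : choiceType) (C : set T) (f : T -> T')
    (a : T' -> \bar R) (b : T -> \bar R) :
  (forall x, C x -> (0 <= b x)%E) -> (forall x, C x -> (a (f x) <= b x)%E) ->
  (\esum_(y in f @` C) a y <= \esum_(x in C) b x)%E.
Proof.
move=> b0 ab.
have [->|/set0P[x0 _]] := eqVneq C set0; first by rewrite image_set0 !esum_set0.
pose g y := xget x0 [set x | C x /\ f x = y].
have gP y : (f @` C) y -> C (g y) /\ f (g y) = y.
  move=> [x Cx fxy]; rewrite /g; case: xgetP => [z _ []//|/(_ x)].
  by move=> /= /not_andP[].
have gI : set_inj (f @` C) g.
  move=> y z /set_mem/gP[_ e1] /set_mem/gP[_ e2] e.
  by rewrite -e1 -e2 e.
have -> : (\esum_(y in f @` C) a y = \esum_(x in g @` (f @` C)) a (f x))%E.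
  rewrite (esum_image _ _ _ gI); apply: eq_esum => y /gP[_ ->] //.
rewrite esum_mkcond [leRHS]esum_mkcond; apply: le_esum => x _.
case: ifPn => [/set_mem[y /gP[Cy _] <-]|_].
  by rewrite mem_set//; exact: ab.
by case: ifPn => // /set_mem /b0.
Qed.

Section lebesgue_basics.
Context (R : realType) (n : nat).
Local Notation V := 'rV[R]_n.
Local Notation T := (leb_type R n).
Local Notation lambda := (lebesgue R n).
Implicit Types (a b x : V).

Lemma box_vol_ge0 a b : 0 <= box_vol a b.
Proof. by apply: prodr_ge0 => i _; rewrite le_max lexx. Qed.

Lemma lebesgue_box_le a b : (lambda (box a b) <= (box_vol a b)%:E)%E.
Proof.
rewrite /lebesgue/=; apply: ereal_inf_lbound; exists [set (a, b)].
  split; first exact: countable1.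
  by move=> x abx; exists (a, b).
by rewrite esum_set1// lee_fin box_vol_ge0.
Qed.

Definition set_coord (x : V) (i : 'I_n) (t : R) : V :=
  \row_j if j == i then t else x 0 j.

(** Either half may be degenerate, and the truncation of side lengths at 0 in the
    volume makes the identity hold in all cases. *)
Lemma box_vol_split a b i (c : R) :
  box_vol a (set_coord b i (Num.min (b 0 i) c)) +
  box_vol (set_coord a i (Num.max (a 0 i) c)) b = box_vol a b.
Proof.
rewrite /box_vol (bigD1 i)//= [X in _ + X = _](bigD1 i)//= [RHS](bigD1 i)//=.
rewrite !mxE !eqxx.
under eq_bigr => j ji do rewrite mxE (negbTE ji).
under [in X in _ + X = _]eq_bigr => j ji do rewrite mxE (negbTE ji).
rewrite -mulrDl; congr (_ * _).
rewrite /Num.max /Num.min.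
by repeat case: ifPn; rewrite -?leNgt => *; lra.
Qed.

(** The hyperplane cuts each box of a cover into two boxes of the same total
    volume, so the criterion of Caratheodory holds cover by cover. The
    measurability of every other set is derived from this one. *)
Lemma measurable_halfspace i (c : R) :
  measurable ([set x | x 0 i <= c] : set T).
Proof.
apply: le_caratheodory_measurable => X.
apply: le_ereal_inf_tmp => _ [C [cC XC] <-].
pose f1 (d : V * V) := (d.1, set_coord d.2 i (Num.min (d.2 0 i) c)).
pose f2 (d : V * V) := (set_coord d.1 i (Num.max (d.1 0 i) c), d.2).
have v0 (d : V * V) : (0%E <= (box_vol d.1 d.2)%:E)%E by rewrite lee_fin box_vol_ge0.
apply: (@le_trans _ _ (\esum_(d in C) (box_vol (f1 d).1 (f1 d).2)%:E
                     + \esum_(d in C) (box_vol (f2 d).1 (f2 d).2)%:E)%E); last first.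
  rewrite -esumD//; apply: le_esum => d _.
  by rewrite -EFinD box_vol_split.
apply: leeD.
  apply: (@le_trans _ _ (\esum_(d in f1 @` C) (box_vol d.1 d.2)%:E)%E); last first.
    exact: le_esum_image.
  apply: ereal_inf_lbound; exists (f1 @` C) => //; split.
    exact: card_le_trans (card_image_le _ _) cC.
  move=> x [/XC[d Cd dx] xc]; exists (f1 d); first by exists d.
  move=> j /=; rewrite mxE; have /andP[-> /= xb] := dx j.
  by case: eqP => // ->; rewrite le_min xc andbT; have /andP[] := dx i.
apply: (@le_trans _ _ (\esum_(d in f2 @` C) (box_vol d.1 d.2)%:E)%E); last first.
  exact: le_esum_image.
apply: ereal_inf_lbound; exists (f2 @` C) => //; split.
  exact: card_le_trans (card_image_le _ _) cC.
move=> x [/XC[d Cd dx] /negP xc]; exists (f2 d); first by exists d.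
move=> j /=; rewrite mxE; have /andP[xa ->] := dx j; rewrite andbT.
case: eqP => // ->; rewrite gt_max (ltNge c) xc andbT.
by have /andP[] := dx i.
Qed.

Lemma measurable_coord i : measurable_fun setT (fun x : T => (x : V) 0 i).
Proof.
apply: (measurability (@RGenCInfty.G R)).
  exact: RGenCInfty.measurableE.
move=> _ [_ [c ->] <-]; rewrite setTI.
have -> : (fun x : T => (x : V) 0 i) @^-1` `[c, +oo[%classic =
   \bigcap_(k in [set: nat]) ~` [set x : T | (x : V) 0 i <= c - k.+1%:R^-1].
  apply/seteqP; split => x /=.
    rewrite in_itv/= andbT => cx k _ /=; apply/negP; rewrite -ltNge.
    by rewrite (lt_le_trans _ cx)// ltrBlDr ltrDl invr_gt0.
  move=> H; rewrite in_itv/= andbT; apply/ler_addgt0Pl => e e0.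
  have [k ke] : exists k, k.+1%:R^-1 < e.
    exists (Num.truncn e^-1); rewrite invf_plt ?posrE//.
    exact: truncnS_gt.
  have /negP := H k I; rewrite -ltNge => /ltW; rewrite lerBlDr => /le_trans; apply.
  by rewrite addrC lerD2r ltW.
apply: bigcap_measurable => [|k _]; first by exists 0%N.
exact/measurableC/measurable_halfspace.
Qed.

Definition obox a b : set V := [set x | forall i, a 0 i < x 0 i < b 0 i].

Lemma measurable_obox a b : measurable (obox a b : set T).
Proof.
have -> : (obox a b : set T) = \bigcap_(i in [set: 'I_n])
    (fun x : T => (x : V) 0 i) @^-1` `]a 0 i, b 0 i[%classic.
  apply/seteqP; split => [x H i _ /=|x H i]; first by rewrite in_itv/=; exact: H.
  by have := H i I; rewrite /= in_itv.
apply: fin_bigcap_measurable => // i _.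
rewrite -[X in measurable X]setTI; exact: measurable_coord.
Qed.

(** The rational end points make the union countable. *)
Lemma open_rat_obox (O : set V) : open O -> O =
  \bigcup_(q : 'rV[rat]_n * 'rV[rat]_n)
     (if `[< obox (map_mx ratr q.1) (map_mx ratr q.2) `<=` O >]
      then obox (map_mx ratr q.1) (map_mx ratr q.2) else set0).
Proof.
rewrite openE => oO; apply/seteqP; split => [x Ox|x [q _]]; last first.
  by case: asboolP => // qO /qO.
have /nbhs_ballP[e /= e0 xeO] := oO _ Ox.
have H1 i : exists q : rat, ratr q \in `](x 0 i - e), (x 0 i)[.
  by apply: rat_in_itvoo; rewrite ltrBlDr ltrDl.
have H2 i : exists q : rat, ratr q \in `](x 0 i), (x 0 i + e)[.
  by apply: rat_in_itvoo; rewrite ltrDl.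
have [q1 Q1] := choice H1; have [q2 Q2] := choice H2.
exists (\row_i q1 i, \row_i q2 i) => //=.
rewrite asboolT.
  move=> i; rewrite !mxE; have := Q1 i; have := Q2 i.
  by rewrite !in_itv/= => /andP[-> _] /andP[_ ->].
move=> y yq; apply: xeO; split => // i j; rewrite ord1 /ball/=.
have := yq j; rewrite !mxE => /andP[]; have := Q1 j; have := Q2 j.
rewrite !in_itv/= => /andP[u1 u2] /andP[u3 u4] u5 u6.
by rewrite ltr_norml; apply/andP; split; lra.
Qed.

Lemma measurable_open (O : set V) : open O -> measurable (O : set T).
Proof.
move=> oO; rewrite (open_rat_obox oO); apply: countable_bigcupT_measurable => //.
by move=> q; case: ifP => _ //; exact: measurable_obox.
Qed.

Definition cube (k : nat) : set V := [set x | forall i, `|x 0 i| <= k%:R].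

Lemma measurable_cube k : measurable (cube k : set T).
Proof.
have -> : (cube k : set T) = \bigcap_(i in [set: 'I_n])
    (fun x : T => (x : V) 0 i) @^-1` `[-k%:R, k%:R]%classic.
  apply/seteqP; split => [x H i _ /=|x H i].
    by rewrite in_itv/= -ler_norml.
  by have := H i I; rewrite /= in_itv/= -ler_norml.
apply: fin_bigcap_measurable => // i _.
rewrite -[X in measurable X]setTI; exact: measurable_coord.
Qed.

Lemma lebesgue_le (A B : set T) : A `<=` B -> (lambda A <= lambda B)%E.
Proof. exact: le_outer_measure. Qed.

(** An outer null set satisfies the criterion of Caratheodory, hence is its own
    measurable null cover. *)
Lemma lebesgue0_negligible (A : set T) : (lambda A <= 0)%E -> lambda.-negligible A.
Proof.
move=> A0; have {}A0 : lambda A = 0%E by apply/eqP; rewrite eq_le A0 measure_ge0.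
exists A; split => //; apply: le_caratheodory_measurable => X.
have XA : (lambda (X `&` A : set T) <= 0)%E by rewrite -A0; exact: lebesgue_le.
rewrite -[leRHS]add0e; apply: leeD => //.
by apply: le_outer_measure; exact: subIsetl.
Qed.

Lemma cube_lty k : (lambda (cube k) < +oo)%E.
Proof.
apply: le_lt_trans (ltry (box_vol (const_mx (- k.+1%:R)) (const_mx k%:R) : R)).
apply: le_trans (lebesgue_box_le _ _); apply: lebesgue_le => x kx i.
have := kx i; rewrite !mxE ler_norml => /andP[kx1 ->]; rewrite andbT.
by rewrite (lt_le_trans _ kx1)// ltrN2 ltr_nat.
Qed.

Lemma cubeI_lty (A : set T) k : (lambda (A `&` cube k) < +oo)%E.
Proof. by apply: le_lt_trans (cube_lty k); apply: lebesgue_le; exact: subIsetr. Qed.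

Lemma cube_cover (x : V) : exists k, forall j, (k <= j)%N -> cube j x.
Proof.
exists (Num.truncn (\sum_i `|x 0 i|)).+1 => j kj i.
apply: (@le_trans _ _ (\sum_i `|x 0 i|)).
  by rewrite (bigD1 i)//= lerDl sumr_ge0.
by rewrite (le_trans (ltW (truncnS_gt _)))// ler_nat.
Qed.

(** Inside a cube the hyperplane lies in a slab of volume e: the face of the cube
    has volume M and the slab has thickness e / M. *)
Lemma negligible_hyperplane i (c : R) : lambda.-negligible [set x : T | (x : V) 0 i = c].
Proof.
have -> : [set x : T | (x : V) 0 i = c] =
    \bigcup_k ([set x : T | (x : V) 0 i = c] `&` cube k).
  apply/seteqP; split => [x xc|x [k _ []]//].
  by have [k kx] := cube_cover x; exists k => //; split => //; exact: kx.
apply: negligible_bigcup => k; apply: lebesgue0_negligible.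
apply/lee_addgt0Pr => e e0; rewrite add0e.
pose M := \prod_(j < n | j != i) (k%:R + k.+1%:R : R).
have M0 : 0 < M by apply: prodr_gt0 => j _; rewrite -natrD addnS ltr0n.
pose a : V := \row_j if j == i then c - e / M else - k.+1%:R.
pose b : V := \row_j if j == i then c else k%:R.
apply: (@le_trans _ _ (box_vol a b)%:E).
  apply: le_trans (lebesgue_box_le _ _); apply: lebesgue_le => x [/= xc xk] j.
  rewrite !mxE; case: eqP => [->|_].
    by rewrite xc lexx andbT ltrBlDr ltrDl divr_gt0.
  have := xk j; rewrite ler_norml => /andP[k1 ->]; rewrite andbT.
  by rewrite (lt_le_trans _ k1)// ltrN2 ltr_nat.
rewrite lee_fin /box_vol (bigD1 i)//= !mxE eqxx opprB addrCA subrr addr0.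
under eq_bigr => j ji do rewrite !mxE (negbTE ji) opprK.
rewrite max_r; last by rewrite ltW// divr_gt0.
rewrite (eq_bigr (fun=> (k%:R + k.+1%:R))) => [|j _].
  by rewrite -/M divfK ?gt_eqF.
by rewrite max_r ?addr_ge0.
Qed.

Lemma negligible_countable_bigcup (U : Type) (C : set U) (F : U -> set T) :
  countable C -> (forall c, C c -> lambda.-negligible (F c)) ->
  lambda.-negligible (\bigcup_(c in C) F c).
Proof.
move=> /countable_injP[f finj] nF.
apply: (@negligibleS _ _ _ _
    (\bigcup_k [set x | exists c, [/\ C c, f c = k & F c x]])).
  by move=> x [c Cc Fx]; exists (f c) => //; exists c.
apply: negligible_bigcup => k.
have [[c [Cc fc]]|nc] := pselect (exists c, C c /\ f c = k).
  apply: negligibleS (nF c Cc) => x [d [Cd fd]].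
  by have -> : d = c by apply: finj; rewrite ?inE// fd.
apply: negligibleS (negligible_set0 _) => x [d [Cd fd _]].
by apply: nc; exists d.
Qed.

Lemma box_obox_negligible (C : set (V * V)) : countable C ->
  lambda.-negligible (\bigcup_(c in C) (box c.1 c.2 `\` obox c.1 c.2) : set T).
Proof.
move=> cC; apply: negligible_countable_bigcup => // c _.
apply: (@negligibleS _ _ _ _ (\bigcup_i [set x : T | (x : V) 0 i = c.2 0 i])).
  move=> x [fx /existsNP[i] ni]; exists i => //=.
  apply/eqP; have /andP[xa xb] := fx i; rewrite xa /= in ni.
  by rewrite eq_le xb leNgt; apply/negP.
apply: negligible_countable_bigcup => // i _; exact: negligible_hyperplane.
Qed.

Lemma continuous_coord i : continuous (fun x : V => x 0 i).
Proof. exact: coord_continuous. Qed.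

Lemma open_obox a b : open (obox a b).
Proof.
rewrite openE => x xab; rewrite /interior/=.
suff H i : \forall y \near x, a 0 i < (y : V) 0 i < b 0 i.
  exact: (filter_forall (nbhs_filter x) H).
have : \forall t \near x 0 i, t \in `]a 0 i, b 0 i[.
  by apply: near_in_itvoo; rewrite in_itv/=.
move/(continuous_coord (x := x)).
by apply: (@filterS _ (nbhs x)) => y; rewrite /= in_itv.
Qed.

(** A cover by half-open boxes is replaced by the interiors of the boxes. Only
    countably many faces are lost, whence a negligible remainder in place of an
    inclusion of A in O. *)
Lemma lebesgue_outer_regular (A : set T) (e : R) : measurable A ->
  (lambda A < +oo)%E -> 0 < e -> exists O : set V,
  [/\ open O, lambda.-negligible (A `\` O) & (lambda (O `\` A) <= e%:E)%E].
Proof.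
move=> mA Afin e0.
have finA : lambda A \is a fin_num by rewrite ge0_fin_numE.
have [_ [C [cC AC] <-] Clt] := lb_ereal_inf_adherent e0 finA.
pose O := \bigcup_(c in C) obox c.1 c.2 : set T.
have oO : open (O : set V).
  by apply: bigcup_open => c _; exact: open_obox.
have AO : lambda.-negligible (A `\` O).
  apply: negligibleS (box_obox_negligible cC) => x [/AC[c Cc cx] nOx].
  by exists c => //; split => // xo; apply: nOx; exists c.
exists O; split => //.
have lO : (lambda O <= lambda A + e%:E)%E.
  apply/ltW/(le_lt_trans _ Clt)/ereal_inf_lbound; exists C => //; split => //.
  move=> x [c Cc cx]; exists c => // i; have /andP[-> xb] := cx i.
  exact: ltW.
have mO := measurable_open oO.
have OA : (lambda A <= lambda (O `&` A))%E.
  rewrite (measureDI lambda mA mO) setIC.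
  rewrite -[leRHS]add0e leeD2r// le_eqVlt; apply/orP; left; apply/eqP.
  by apply/negligibleP => //; exact: measurableD.
have : (lambda (O `\` A) + lambda (O `&` A) <= lambda A + e%:E)%E.
  by rewrite -measureDI.
move=> /(le_trans (leeD2l _ OA)).
by rewrite addeC leeD2lE.
Qed.
End lebesgue_basics.

(** * Almost everywhere convergence and integrals *)

Section complete_measure.
Context d (T : measurableType d) (R : realType).
Variable mu : {measure set T -> \bar R}.

Lemma bounded_integrable (D : set T) (f : T -> R) (C : R) :
  measurable D -> (mu D < +oo)%E -> measurable_fun D f ->
  (forall x, D x -> `|f x| <= C) -> mu.-integrable D (EFin \o f).
Proof.
move=> mD Dfin mf fC; apply: measurable_bounded_integrable => //.
exists C; split; first exact: num_real.
by move=> M CM x /= /fC /le_trans; apply; exact: ltW.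
Qed.

Lemma dominated_Rintegral_cvg (D : set T) (f_ : nat -> T -> R) (f g : T -> R) :
  measurable D -> (forall k, measurable_fun D (f_ k)) -> measurable_fun D f ->
  {ae mu, forall x, D x -> f_ k x @[k --> \oo] --> f x} ->
  mu.-integrable D (EFin \o g) -> (forall k x, D x -> `|f_ k x| <= g x) ->
  \int[mu]_(x in D) f_ k x @[k --> \oo] --> \int[mu]_(x in D) f x.
Proof.
move=> mD mf_ mf f_f ig fg.
have [] := @dominated_convergence _ _ _ mu D mD (fun k x => (f_ k x)%:E)
  (EFin \o f) (EFin \o g).
- by move=> k; exact/measurable_EFinP.
- exact/measurable_EFinP.
- apply: filterS f_f => x H Dx; apply: cvg_EFin; first exact: nearW.
  exact: H.
- by [].
- by apply: aeW => x k Dx; rewrite /= lee_fin fg.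
move=> /(integrable_fin_num mD) fi _.
by rewrite -(fineK fi) => /fine_cvgP[].
Qed.

Lemma bounded_Rintegral_cvg (D : set T) (f_ : nat -> T -> R) (f : T -> R) (C : R) :
  measurable D -> (mu D < +oo)%E ->
  (forall k, measurable_fun D (f_ k)) -> measurable_fun D f ->
  {ae mu, forall x, D x -> f_ k x @[k --> \oo] --> f x} ->
  (forall k x, D x -> `|f_ k x| <= C) ->
  \int[mu]_(x in D) f_ k x @[k --> \oo] --> \int[mu]_(x in D) f x.
Proof.
move=> mD Dfin mf_ mf f_f fC.
apply: (@dominated_Rintegral_cvg D f_ f (cst C)) => //.
apply: (bounded_integrable (C := `|C|)) => //; exact: measurable_cst.
Qed.

Hypothesis cmu : measure_is_complete mu.

(** Completeness absorbs the values on the exceptional set. *)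
Lemma measurable_fun_ae_cvg (D : set T) (f_ : nat -> T -> R) (f : T -> R) :
  measurable D -> (forall k, measurable_fun D (f_ k)) ->
  {ae mu, forall x, D x -> f_ k x @[k --> \oo] --> f x} ->
  measurable_fun D f.
Proof.
move=> mD mf_ [N [mN N0 subN]].
have -> : D = (D `\` N) `|` (D `&` N) by rewrite setUC setUIDK.
apply/measurable_funU; [exact: measurableD|exact: measurableI|split].
  apply: (@measurable_fun_cvg _ _ _ _ f_) => [k|x [Dx Nx]].
    by apply: measurable_funS (mf_ k) => //; exact: subDsetl.
  apply: contrapT => nc; apply/Nx/subN => /=; tauto.
move=> _ B mB; apply: cmu; exists N; split => //.
by move=> x [[_ ]].
Qed.

(** The integrals over the exhausting sets B k are summable, so the series of the
    functions cut to B k is finite almost everywhere and its terms tend to 0. A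
    given point lies in all B k but finitely many. *)
Lemma ae_cvg0_summable (D : set T) (B : nat -> set T) (g : nat -> T -> R) :
  measurable D -> (forall k, measurable (B k)) ->
  (forall x, D x -> \forall k \near \oo, B k x) ->
  (forall k, (mu (D `&` B k) < +oo)%E) ->
  (forall k, measurable_fun D (g k)) ->
  (forall k x, D x -> 0 <= g k x <= 1) ->
  (forall k, \int[mu]_(x in D `&` B k) g k x <= (2 ^ k.+1)%:R^-1) ->
  {ae mu, forall x, D x -> g k x @[k --> \oo] --> (0 : R)}.
Proof.
move=> mD mB DB fB mg g01 gint.
have mDB k : measurable (D `&` B k) by exact: measurableI.
pose G k := (fun x => (g k x)%:E) \_ (B k).
have G0 k x : D x -> (0 <= G k x)%E.
  move=> Dx; rewrite /G /restrict; case: ifP => // _.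
  by have /andP[] := g01 k x Dx.
have mG k : measurable_fun D (G k).
  apply/measurable_restrict => //.
  by apply: measurable_funS (mD) _ _ => //; exact/measurable_EFinP.
have intG k : (\int[mu]_(x in D) G k x <= ((2 ^ k.+1)%:R^-1)%:E)%E.
  rewrite /G -integral_mkcondr.
  have gi : mu.-integrable (D `&` B k) (EFin \o g k).
    apply: (bounded_integrable (C := 1)) => //.
      by apply: measurable_funS (mg k) => //; exact: subIsetl.
    by move=> x [Dx _]; have /andP[? ?] := g01 k x Dx; rewrite ger0_norm.
  have := gint k; rewrite /Rintegral -lee_fin fineK//.
  exact: integrable_fin_num.
have sumfin : (\int[mu]_(x in D) (\sum_(k <oo) G k x) < +oo)%E.
  rewrite integral_nneseries//.
  apply: (@le_lt_trans _ _ 1%:E); last exact: ltry.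
  apply: (@le_trans _ _ (\sum_(k <oo) ((2 ^ k.+1)%:R^-1)%:E)%E).
    by apply: lee_nneseries => [k _ _|k _]; [apply: integral_ge0 => x; exact: G0|].
  have := @epsilon_trick0 R 1 xpredT ler01.
  by under eq_eseriesr do rewrite div1r.
have ifin : mu.-integrable D (fun x => (\sum_(k <oo) G k x)%E).
  apply/integrableP; split.
    by apply: ge0_emeasurable_sum => // k x Dx _; exact: G0.
  under eq_integral => x /set_mem Dx.
    rewrite gee0_abs; last by apply: nneseries_ge0 => k _ _; exact: G0.
  over.
  by [].
have := integrable_ae mD ifin; apply: filterS => x H Dx.
have {}H := H Dx.
have Glt : (\sum_(k <oo) G k x < +oo)%E.
  by rewrite -ge0_fin_numE// nneseries_ge0// => k _ _; exact: G0.
have tail := nneseries_tail_cvg Glt (fun k _ => G0 k x Dx).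
apply: (@squeeze_cvgr _ _ _ _ (fun=> 0) (fun k => fine (\sum_(k <= i <oo) G i x)%E)).
- near=> k.
  have Bk : B k x by near: k; exact: DB.
  have /andP[-> _] /= := g01 k x Dx.
  have tfin : (\sum_(k <= i <oo) G i x)%E \is a fin_num.
    rewrite ge0_fin_numE; last by apply: nneseries_ge0 => i _ _; exact: G0.
    apply: le_lt_trans Glt.
    rewrite [leRHS](nneseries_split 0 k)//; last by move=> i _; exact: G0.
    by rewrite add0n leeDr// sume_ge0// => i _; exact: G0.
  rewrite -lee_fin fineK//.
  rewrite (nneseries_split k 1); last by move=> i _; exact: G0.
  rewrite addn1 big_nat1 {1}/G /restrict mem_set//.
  by rewrite leeDl// nneseries_ge0// => i _ _; exact: G0.
- exact: cvg_cst.
- by have /fine_cvgP[] := tail.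
Unshelve. all: by end_near. Qed.

End complete_measure.

Section lebesgue_complete.
Context (R : realType) (n : nat).

Lemma lebesgue_complete : measure_is_complete (lebesgue R n).
Proof. exact: measure_is_complete_caratheodory. Qed.

(** Monotonicity and conjunction are stated for the Lebesgue measure separately:
    unification with the statements for general filters unfolds the outer measure. *)
Lemma ae_mono (P Q : set (leb_type R n)) : (forall x, P x -> Q x) ->
  {ae lebesgue R n, forall x, P x} -> {ae lebesgue R n, forall x, Q x}.
Proof. by move=> PQ; apply: negligibleS => x nQ /PQ. Qed.

Lemma ae_mono2 (P P' Q : set (leb_type R n)) :
  (forall x, P x -> P' x -> Q x) ->
  {ae lebesgue R n, forall x, P x} -> {ae lebesgue R n, forall x, P' x} ->
  {ae lebesgue R n, forall x, Q x}.
Proof.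
move=> PQ aP aP'; apply: negligibleS (negligibleU aP aP') => x nQ.
by apply: contrapT => /not_orP[/contrapT Px /contrapT P'x]; apply/nQ/PQ.
Qed.

End lebesgue_complete.

Lemma lebesgue_measurable_ae_cvg (R : realType) (n : nat) (D : set (leb_type R n))
    (f_ : nat -> leb_type R n -> R) (f : leb_type R n -> R) :
  measurable D -> (forall k, measurable_fun D (f_ k)) ->
  {ae lebesgue R n, forall x, D x -> f_ k x @[k --> \oo] --> f x} ->
  measurable_fun D f.
Proof. by apply: measurable_fun_ae_cvg; exact: lebesgue_complete. Qed.

Lemma measurable_fun_open_preimage d (T : measurableType d) (R : realType)
    (D : set T) (f : T -> R) :
  (forall A : set R, open A -> measurable (D `&` f @^-1` A)) -> measurable_fun D f.
Proof.
move=> H; apply: (measurability (@RGenOpens.G R)).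
  exact: RGenOpens.measurableE.
by move=> _ [_ [x [y ->]] <-]; apply: H; exact: interval_open.
Qed.

Lemma measurable_continuous_lebesgue (R : realType) (n : nat)
    (D : set (leb_type R n)) (f : 'rV[R]_n -> R) :
  measurable D -> continuous f -> measurable_fun D (f : leb_type R n -> R).
Proof.
move=> mD /continuousP cf; apply: measurable_fun_open_preimage => A oA.
by apply: measurableI => //; apply: measurable_open; exact: cf.
Qed.

Lemma measurable_continuous_borel (R : realType) (K : ptopologicalType)
    (D : set (borel K)) (f : K -> R) :
  measurable D -> continuous f -> measurable_fun D (f : borel K -> R).
Proof.
move=> mD /continuousP cf; apply: measurable_fun_open_preimage => A oA.
by apply: measurableI => //; apply: sub_sigma_algebra; exact: cf.
Qed.

Lemma Rintegral_indic d (T : measurableType d) (R : realType)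
    (mu : {measure set T -> \bar R}) (D S : set T) :
  measurable D -> measurable S ->
  \int[mu]_(x in D) (\1_S x : R) = fine (mu (S `&` D)).
Proof. by move=> mD mS; rewrite /Rintegral integral_indic. Qed.

(** The link between smallness in mean and almost everywhere convergence: each
    subsequence below is selected so as to meet the rate 1 / 2 ^ (k + 1) on the
    k-th cube. *)
Lemma lebesgue_ae_cvg0 (R : realType) (n : nat) (D : set (leb_type R n))
    (g : nat -> leb_type R n -> R) :
  measurable D -> (forall k, measurable_fun D (g k)) ->
  (forall k x, D x -> 0 <= g k x <= 1) ->
  (forall k, \int[lebesgue R n]_(x in D `&` cube k) g k x <= (2 ^ k.+1)%:R^-1) ->
  {ae lebesgue R n, forall x, D x -> g k x @[k --> \oo] --> (0 : R)}.
Proof.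
move=> mD mg g01 gint.
have := @ae_cvg0_summable _ _ R (lebesgue R n) D (fun k => cube k) g mD
  (@measurable_cube R n).
apply.
- by move=> x _; have [k0 Hk] := cube_cover x; exists k0.
- by move=> k; exact: cubeI_lty.
- exact: mg.
- exact: g01.
- exact: gint.
Qed.

Lemma measurable_fun_norm d (T : measurableType d) (R : realType) (D : set T)
    (f : T -> R) : measurable_fun D f -> measurable_fun D (fun x => `|f x|).
Proof. by move=> mf; exact: measurableT_comp. Qed.

Lemma lebesgue_bounded_integrable (R : realType) (n : nat)
    (D : set (leb_type R n)) (f : leb_type R n -> R) (C : R) :
  measurable D -> (lebesgue R n D < +oo)%E -> measurable_fun D f ->
  (forall x, D x -> `|f x| <= C) -> (lebesgue R n).-integrable D (EFin \o f).
Proof. exact: bounded_integrable. Qed.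

Lemma lebesgue_bounded_cvg (R : realType) (n : nat)
    (D : set (leb_type R n)) (f_ : nat -> leb_type R n -> R)
    (f : leb_type R n -> R) (C : R) :
  measurable D -> (lebesgue R n D < +oo)%E ->
  (forall k, measurable_fun D (f_ k)) -> measurable_fun D f ->
  {ae lebesgue R n, forall x, D x -> f_ k x @[k --> \oo] --> f x} ->
  (forall k x, D x -> `|f_ k x| <= C) ->
  \int[lebesgue R n]_(x in D) f_ k x @[k --> \oo] -->
  \int[lebesgue R n]_(x in D) f x.
Proof. exact: bounded_Rintegral_cvg. Qed.

Section integrable_EFin.
Context d (T : measurableType d) (R : realType) (mu : {measure set T -> \bar R}).
Variables (D : set T) (mD : measurable D).

Lemma integrable_EFinD (f g : T -> R) :
  mu.-integrable D (EFin \o f) -> mu.-integrable D (EFin \o g) ->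
  mu.-integrable D (EFin \o (fun x => f x + g x)).
Proof. by move=> If Ig; have := integrableD mD If Ig; exact: eq_integrable. Qed.

Lemma integrable_EFinB (f g : T -> R) :
  mu.-integrable D (EFin \o f) -> mu.-integrable D (EFin \o g) ->
  mu.-integrable D (EFin \o (fun x => f x - g x)).
Proof. by move=> If Ig; have := integrableB mD If Ig; exact: eq_integrable. Qed.

End integrable_EFin.

Lemma measurable_bigmax d (T : measurableType d) (R : realType) (D : set T)
    (J : Type) (s : seq J) (h : J -> T -> R) :
  (forall j, measurable_fun D (h j)) ->
  measurable_fun D (fun x => \big[Num.max/0]_(j <- s) h j x).
Proof.
move=> mh; elim: s => [|j s IH].
  rewrite (_ : (fun x : T => _) = cst 0); first exact: measurable_cst.
  by apply/funext => x; rewrite big_nil.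
rewrite (_ : (fun x : T => _) =
    (h j \max (fun x => \big[Num.max/0]_(j <- s) h j x))); last first.
  by apply/funext => x; rewrite big_cons.
exact: measurable_maxr.
Qed.

Lemma cvg_bigsum (R : realType) (J : Type) (s : seq J) (f : J -> nat -> R) (l : J -> R) :
  (forall j, f j k @[k --> \oo] --> l j) ->
  \sum_(j <- s) f j k @[k --> \oo] --> \sum_(j <- s) l j.
Proof.
move=> H; elim: s => [|j s IH].
  by rewrite big_nil; under eq_fun do rewrite big_nil; exact: cvg_cst.
rewrite big_cons; under eq_fun do rewrite big_cons.
exact: cvgD.
Qed.

Section Rintegral_sum.
Context d (T : measurableType d) (R : realType) (mu : {measure set T -> \bar R}).
Variables (D : set T) (mD : measurable D).

Lemma integrable_EFin_sum (J : Type) (s : seq J) (f : J -> T -> R) :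
  (forall j, mu.-integrable D (EFin \o f j)) ->
  mu.-integrable D (EFin \o (fun x => \sum_(j <- s) f j x)).
Proof.
move=> fi; elim: s => [|j s IH].
  rewrite (_ : _ \o _ = cst 0%E); first exact: integrable0.
  by apply/funext => x /=; rewrite big_nil.
rewrite (_ : (fun x => _) = (fun x => f j x + \sum_(j <- s) f j x)).
  exact: integrable_EFinD.
by apply/funext => x; rewrite big_cons.
Qed.

Lemma Rintegral_sum (J : Type) (s : seq J) (f : J -> T -> R) :
  (forall j, mu.-integrable D (EFin \o f j)) ->
  \int[mu]_(x in D) (\sum_(j <- s) f j x) = \sum_(j <- s) \int[mu]_(x in D) f j x.
Proof.
move=> fi; elim: s => [|j s IH].
  rewrite big_nil (_ : (fun x => _) = cst 0); first by rewrite /Rintegral integral0.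
  by apply/funext => x; rewrite big_nil.
rewrite big_cons -IH -RintegralD//; last exact: integrable_EFin_sum.
by apply: eq_Rintegral => x _; rewrite big_cons.
Qed.

Lemma integrable_cut (S : set T) (b : T -> R) (C : R) : measurable S ->
  (mu (D `&` S) < +oo)%E -> measurable_fun D b -> (forall x, D x -> `|b x| <= C) ->
  mu.-integrable D (EFin \o (fun x => b x * \1_S x)).
Proof.
move=> mS fS mb bC; have mDS : measurable (D `&` S) by exact: measurableI.
have i1 : mu.-integrable (D `&` S) (EFin \o b).
  apply: (bounded_integrable (C := C)) => //.
    by apply: measurable_funS mb => //; exact: subIsetl.
  by move=> x [Dx _]; exact: bC.
have := (integrable_mkcond (EFin \o b) mDS).1 i1.
move=> /(integrableS measurableT mD (@subsetT _ _)).
apply: eq_integrable => // x /set_mem Dx; rewrite /restrict in_setI mem_set//=.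
by rewrite indicE; case: ifP => _; rewrite ?mulr1 ?mulr0.
Qed.

End Rintegral_sum.

(** * Towers of derivatives and the function exp(-d/t) *)

Section towers.
Context {R : realType}.
Implicit Types (phi psi : nat -> R -> R).

Lemma deriv_mul (f g : R -> R) (x a b : R) :
  is_derive x 1 f a -> is_derive x 1 g b ->
  is_derive x 1 (fun t => f t * g t) (a * g x + f x * b).
Proof.
move=> df dg; have -> : a * g x + f x * b = f x *: b + g x *: a.
  by rewrite /GRing.scale/= addrC [X in _ + X]mulrC.
exact: (is_deriveM df dg).
Qed.

Lemma deriv_add (f g : R -> R) (x a b : R) :
  is_derive x 1 f a -> is_derive x 1 g b ->
  is_derive x 1 (fun t => f t + g t) (a + b).
Proof. by move=> df dg; exact: (is_deriveD df dg). Qed.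

Lemma deriv_comp (f g : R -> R) (x a b : R) :
  is_derive (g x) 1 f a -> is_derive x 1 g b ->
  is_derive x 1 (fun t => f (g t)) (a * b).
Proof. by move=> df dg; exact: (is_derive1_comp df dg). Qed.

Lemma deriv_eq (f : R -> R) (x a b : R) : is_derive x 1 f a -> a = b ->
  is_derive x 1 f b.
Proof. by move=> df <-. Qed.

Lemma deriv_scale (c : R) (f : R -> R) (x a : R) :
  is_derive x 1 f a -> is_derive x 1 (fun t => c * f t) (c * a).
Proof. by move=> df; exact: (is_deriveZ c df). Qed.

Lemma deriv_exp (k : nat) (f : R -> R) (x a : R) : is_derive x 1 f a ->
  is_derive x 1 (fun t => f t ^+ k) (k%:R * f x ^+ k.-1 * a).
Proof.
move=> df; have := is_deriveX k df; rewrite /GRing.scale/=.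
suff -> : f ^+ k = fun t => f t ^+ k by [].
by apply/funext => t; rewrite exprfctE.
Qed.

(** A function of one variable together with all its derivatives. Products,
    translates and reflections of towers are computed term by term, so smoothness
    never requires an explicit formula for a higher derivative. *)
Definition tower phi := forall j (x : R), is_derive x 1 (phi j) (phi j.+1 x).

Lemma tower_shift phi : tower phi -> tower (fun j => phi j.+1).
Proof. by move=> h j x; exact: h. Qed.

(** Leibniz' rule unfolded one derivative at a time, without binomial coefficients. *)
Fixpoint tower_mul (j : nat) phi psi : R -> R := fun t =>
  if j is j'.+1 then tower_mul j' (fun i => phi i.+1) psi t
                   + tower_mul j' phi (fun i => psi i.+1) t
  else phi 0%N t * psi 0%N t.

Lemma tower_mulP phi psi : tower phi -> tower psi ->
  tower (fun j => tower_mul j phi psi).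
Proof.
move=> + + j; elim: j phi psi => [|j IH] phi psi tphi tpsi x.
  exact: (deriv_mul (tphi 0%N x) (tpsi 0%N x)).
have d1 := IH _ _ (tower_shift tphi) tpsi x.
have d2 := IH _ _ tphi (tower_shift tpsi) x.
exact: (deriv_add d1 d2).
Qed.

Lemma tower_mul_cvg (phi_ psi_ : nat -> nat -> R -> R) phi psi (t : R) :
  (forall j, phi_ k j t @[k --> \oo] --> phi j t) ->
  (forall j, psi_ k j t @[k --> \oo] --> psi j t) ->
  forall j, tower_mul j (phi_ k) (psi_ k) t @[k --> \oo] --> tower_mul j phi psi t.
Proof.
move=> + + j; elim: j phi_ psi_ phi psi => [|j IH] phi_ psi_ phi psi H1 H2 /=.
  exact: cvgM.
apply: cvgD.
  by apply: (IH (fun k i => phi_ k i.+1) psi_ (fun i => phi i.+1)).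
by apply: (IH phi_ (fun k i => psi_ k i.+1) phi (fun i => psi i.+1)).
Qed.

Definition one_tower : nat -> R -> R := fun j _ => (j == 0%N)%:R.

Lemma tower_mul0 j psi (t : R) : tower_mul j (fun _ _ => 0) psi t = 0.
Proof. by elim: j psi => [|j IH] psi /=; rewrite ?mul0r// !IH addr0. Qed.

Lemma tower_mul1 j psi (t : R) : tower_mul j one_tower psi t = psi j t.
Proof.
elim: j psi => [|j IH] psi /=; first by rewrite /one_tower eqxx mul1r.
by rewrite (IH (fun i => psi i.+1)) tower_mul0 add0r.
Qed.

Lemma tower_translate phi (a : R) : tower phi -> tower (fun j t => phi j (t - a)).
Proof.
move=> h j x.
have d : is_derive x 1 (fun t : R => t - a) (1 : R).
  exact: is_derive_shift.
by apply: deriv_eq (deriv_comp (g := fun t => t - a) (h j (x - a)) d) _; rewrite mulr1.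
Qed.

Lemma tower_reflect phi (b : R) : tower phi ->
  tower (fun j t => (-1) ^+ j * phi j (b - t)).
Proof.
move=> h j x.
have d : is_derive x 1 (fun t : R => b - t) (-1 : R).
  apply: deriv_eq (deriv_add (is_derive_cst b _ _) (is_deriveNid _ _)) _.
  by rewrite add0r.
apply: deriv_eq (deriv_scale _ (deriv_comp (g := fun t => b - t) (h j (b - x)) d)) _.
by rewrite exprS mulrN1 mulrN mulN1r mulNr.
Qed.

Definition poly_tower (P : {poly R}) : nat -> R -> R := fun j => horner P^`(j).

Lemma poly_towerP P : tower (poly_tower P).
Proof.
by move=> j x; rewrite /poly_tower derivnS; exact: is_derive_poly.
Qed.

(** The polynomials Q_j for which the j-th derivative of exp(-d/t) is
    t ^ -j Q_j(d/t) exp(-d/t). *)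
Fixpoint expV_poly (j : nat) : {poly R} :=
  if j is j'.+1 then ('X - j'%:R%:P) * expV_poly j' - 'X * (expV_poly j')^`()
  else 1.

Definition expV_tower (d : R) : nat -> R -> R := fun j t =>
  if 0 < t then t^-1 ^+ j * (expV_poly j).[d / t] * expR (- (d / t)) else 0.

Lemma exprn_expR_bounded k (d : R) : 0 < d ->
  exists C, 0 <= C /\ forall y, 0 <= y -> y ^+ k * expR (- (d * y)) <= C.
Proof.
move=> d0; case: k => [|k].
  exists 1; split => // y y0; rewrite expr0 mul1r -expR0 ler_expR oppr_le0.
  by rewrite mulr_ge0// ltW.
exists ((k.+1%:R / d) ^+ k.+1); split; first by rewrite exprn_ge0// divr_ge0// ltW.
move=> y y0; rewrite expRN ler_pdivrMr ?expR_gt0//.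
have -> : expR (d * y) = expR (d * y / k.+1%:R) ^+ k.+1.
  by rewrite -expRM_natl; congr expR; rewrite [RHS]mulrC divfK.
rewrite -exprMn lerXn2r ?nnegrE//; first by rewrite mulr_ge0// ?divr_ge0 ?expR_ge0// ltW.
apply: (@le_trans _ _ (k.+1%:R / d * (d * y / k.+1%:R))).
  have kk : k.+1%:R != 0 :> R by [].
  have dd : d != 0 by rewrite gt_eqF.
  have -> // : k.+1%:R / d * (d * y / k.+1%:R) = y.
  move: k.+1%:R kk => K kk; field.
  by rewrite kk.
apply: ler_wpM2l; first by rewrite divr_ge0// ltW.
by apply: le_trans (expR_ge1Dx _); rewrite lerDr.
Qed.

Lemma poly_expR_bounded (P : {poly R}) (d : R) : 0 < d ->
  exists C, 0 <= C /\ forall y, 0 <= y -> `|P.[y] * expR (- (d * y))| <= C.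
Proof.
move=> d0; have /choice[C HC] := fun k => exprn_expR_bounded k d0.
exists (\sum_(i < size P) `|P`_i| * C i); split.
  by apply: sumr_ge0 => i _; rewrite mulr_ge0//; exact: (HC i).1.
move=> y y0; rewrite horner_coef mulr_suml.
apply: le_trans (ler_norm_sum _ _ _) _; apply: ler_sum => i _.
rewrite -mulrA normrM ler_wpM2l// ger0_norm; first exact: (HC i).2.
by rewrite mulr_ge0 ?exprn_ge0 ?expR_ge0.
Qed.

(** The only delicate point is t = 0. With y = 1/h the difference quotient there is
    y ^ (j + 1) Q_j(d y) exp(- d y); a polynomial times exp(- d y) is bounded for
    y >= 0, and applying this with one more factor y yields a bound by C h. *)
Lemma expV_towerP (d : R) : 0 < d -> tower (expV_tower d).
Proof.
move=> d0 j x; have [x0|x0|->] := ltgtP x 0.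
- have -> : expV_tower d j.+1 x = 0 by rewrite /expV_tower ltNge (ltW x0).
  have E : \forall t \near x, cst 0 t = expV_tower d j t.
    near=> t; have t0 : t < 0 by near: t; exact: lt_nbhsl.
    by rewrite /expV_tower/= ltNge ltW.
  exact: near_eq_is_derive E (is_derive_cst (0 : R) x 1).
- have -> : expV_tower d j.+1 x =
     x^-1 ^+ j.+1 * (expV_poly j.+1).[d / x] * expR (- (d / x)).
    by rewrite /expV_tower x0.
  pose f (t : R) := t^-1 ^+ j * (expV_poly j).[d / t] * expR (- (d / t)).
  have E : \forall t \near x, f t = expV_tower d j t.
    near=> t; have t0 : 0 < t by near: t; exact: lt_nbhsr.
    by rewrite /expV_tower t0.
  apply: near_eq_is_derive E _; rewrite {}/f.
  have xn0 : id x != 0 by rewrite gt_eqF.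
  have dV : is_derive x 1 (fun t : R => t^-1) (- x ^- 2 * 1).
    exact: (@is_deriveV R id x 1 1 xn0 (is_derive_id x 1)).
  have dV' := deriv_scale d dV.
  have dE : is_derive x 1 (fun t => expR (- (d / t))) (expR (- (d / x)) * - (d * (- x ^- 2 * 1))).
    apply: deriv_eq (deriv_comp (f := expR) (g := fun t => - (d / t)) (is_derive_expR _) _) _.
    by [].
  have dP := deriv_comp (g := fun t => d / t) (is_derive_poly (expV_poly j) _) dV'.
  have dX := deriv_exp j dV.
  apply: deriv_eq (deriv_mul (deriv_mul dX dP) dE) _.
  rewrite /= !hornerE -exprVn; move: (x^-1) => y.
  move: (expR _) (expV_poly j).[_] (expV_poly j)^`().[_] => e P P'.
  by case: j {dX dP} => [|j] /=; rewrite ?expr0 ?exprS; ring.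
- have -> : expV_tower d j.+1 0 = 0 by rewrite /expV_tower ltxx.
  (* one power of y more than in the difference quotient, which gains the factor h *)
  have [C [C0 HC]] := poly_expR_bounded ('X^(j.+2) * (expV_poly j \Po (d *: 'X))) d0.
  have H : h^-1 *: (expV_tower d j (h *: 1 + 0) - expV_tower d j 0) @[h --> 0^'] --> (0 : R).
    have f0 : expV_tower d j 0 = 0 by rewrite /expV_tower ltxx.
    apply/norm_cvg0P.
    apply: (@squeeze_cvgr _ _ _ _ (fun=> 0) (fun h : R => C * `|h|)).
    + near=> h; rewrite normr_ge0 /= f0 subr0 addr0 /GRing.scale/= mulr1.
      rewrite /expV_tower; case: ifPn => h0; last first.
        by rewrite mulr0 normr0 mulr_ge0.
      have hV : 0 <= h^-1 by rewrite invr_ge0 ltW.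
      rewrite (ger0_norm (ltW h0)) -ler_pdivrMr//.
      have := HC _ hV; rewrite !hornerE horner_comp !hornerE.
      rewrite -[X in _ -> _ * X <= _](ger0_norm hV) -normrM.
      congr (`|_| <= _); rewrite !exprS.
      rewrite -[RHS]/(h^-1 * h^-1 ^+ j * (expV_poly j).[d / h]
                      * expR (- (d / h)) * h^-1).
      by move: (h^-1) (h^-1 ^+ j) (expR _) (expV_poly j).[_] => *; ring.
    + exact: cvg_cst.
    + have K : (C * `|h|) @[h --> (0 : R)] --> C * `|0 : R|.
        by apply: cvgM; [exact: cvg_cst|apply: cvg_norm; exact: cvg_id].
      rewrite normr0 mulr0 in K.
      exact: cvg_within_filter K.
  by apply: DeriveDef; [apply/cvg_ex; exists 0|exact: cvg_lim].
Unshelve. all: by end_near. Qed.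

Lemma cvg_invS_mul (c : R) : k.+1%:R^-1 * c @[k --> \oo] --> (0 : R).
Proof.
rewrite -[X in _ --> X](mul0r c); apply: cvgM; last exact: cvg_cst.
exact: cvg_harmonic.
Qed.

Lemma expV_poly0 j : (expV_poly j).[0] = (j == 0%N)%:R.
Proof.
have S0 i : (expV_poly i.+1).[0] = - i%:R * (expV_poly i).[0].
  by rewrite [LHS]hornerD !hornerE ?oppr0 ?subr0 ?addr0 ?sub0r.
elim: j => [|j IH]; first by rewrite hornerE.
by rewrite S0 IH; case: j {IH} => [|j]; rewrite ?oppr0 ?mul0r ?mulr0.
Qed.

(** On t > 0 the functions tend to 1 and their derivatives to 0, because
    Q_j(0) = 0 for j > 0. *)
Lemma expV_tower_cvg (t : R) j : 0 < t ->
  expV_tower k.+1%:R^-1 j t @[k --> \oo] --> one_tower j t.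
Proof.
move=> t0; rewrite /expV_tower t0.
have c0 := cvg_invS_mul t^-1.
have -> : one_tower j t = t^-1 ^+ j * (expV_poly j).[0] * expR (- 0).
  rewrite expV_poly0 oppr0 expR0 mulr1 /one_tower.
  by case: j => [|j]; rewrite ?mulr0// expr0 mulr1.
apply: cvgM.
  apply: cvgM; first exact: cvg_cst.
  by apply: continuous_cvg => //; exact: continuous_horner.
apply: continuous_cvg; first exact: continuous_expR.
exact: cvgN.
Qed.

Lemma poly_tower_Xn k (j : nat) : (poly_tower 'X^k j) 0 = if j == k then k`!%:R else 0 :> R.
Proof.
rewrite /poly_tower horner_coef0 coef_derivn addn0 coefXn.
have [->|jk] := eqVneq j k; rewrite ?eqxx ?ffactnn//.
by rewrite ?(negbTE jk) mul0rn.
Qed.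

Lemma tower_continuous phi j : tower phi -> continuous (phi j).
Proof.
move=> h x; apply/differentiable_continuous/derivable1_diffP.
by case: (h j x).
Qed.
End towers.

Section tensor_products.
Context {R : realType} (n : nat).
Local Notation V := 'rV[R]_n.
Implicit Types (phi : 'I_n -> nat -> R -> R) (b : 'I_n -> nat) (x : V).

Definition tprod phi b (x : V) : R := \prod_i phi i (b i) (x 0 i).

Definition letter_count (s : seq 'I_n) : 'I_n -> nat := fun i => count_mem i s.

(** Deriving along the i-th coordinate moves the i-th factor one step up its tower. *)
Lemma is_derive_tprod phi b x i : (forall i, tower (phi i)) ->
  is_derive x (delta_mx 0 i) (tprod phi b)
    (tprod phi (fun j => (i == j) + b j)%N x).
Proof.
move=> tphi.
pose K := \prod_(j < n | j != i) phi j (b j) (x 0 j).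
have E (h : R) : tprod phi b (h *: delta_mx 0 i + x) = phi i (b i) (h *: 1 + x 0 i) * K.
  rewrite /tprod (bigD1 i)//= !mxE !eqxx; congr (_ * _).
  apply: eq_bigr => j ji; rewrite !mxE eqxx (negbTE ji) /=.
  by rewrite mulr0 add0r.
have E0 : tprod phi b x = phi i (b i) (x 0 i) * K by rewrite /tprod (bigD1 i).
have E1 : tprod phi (fun j => (i == j) + b j)%N x = phi i (b i).+1 (x 0 i) * K.
  rewrite /tprod (bigD1 i)//= eqxx; congr (_ * _).
  by apply: eq_bigr => j ji; rewrite eq_sym (negbTE ji).
have H : h^-1 *: (tprod phi b (h *: delta_mx 0 i + x) - tprod phi b x)
    @[h --> 0^'] --> phi i (b i).+1 (x 0 i) * K.
  have [d dE] := tphi i (b i) (x 0 i).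
  under eq_fun do rewrite E E0 -mulrBl scalerAl.
  apply: cvgM; last exact: cvg_cst.
  by move: d => /cvg_ex[l Hl]; rewrite -dE /derive (cvg_lim _ Hl).
rewrite E1; apply: DeriveDef; first by apply/cvg_ex; eexists; exact: H.
exact: cvg_lim.
Qed.

Lemma continuous_tprod phi b : (forall i, tower (phi i)) -> continuous (tprod phi b).
Proof.
move=> tphi; rewrite /tprod.
suff H r : continuous (fun y : V => \prod_(i <- r) phi i (b i) (y 0 i)) by exact: H.
elim: r => [|i r IH].
  rewrite (_ : (fun y : V => _) = cst 1); first exact: cst_continuous.
  by apply/funext => y; rewrite big_nil.
rewrite (_ : (fun y : V => _) = (phi i (b i) \o (fun y : V => y 0 i)) \*
    (fun y : V => \prod_(i <- r) phi i (b i) (y 0 i))); last first.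
  by apply/funext => y; rewrite big_cons.
move=> x; apply: continuousM; last exact: IH.
by apply: continuous_comp; [exact: coord_continuous|exact: tower_continuous].
Qed.

End tensor_products.

Lemma cvg_rV (R : realType) (n : nat) (T : Type) (F : set_system T) {FF : Filter F}
    (f : T -> 'rV[R]_n) (l : 'rV[R]_n) :
  (forall i, f x 0 i @[x --> F] --> l 0 i) -> f x @[x --> F] --> l.
Proof.
move=> H; apply/cvg_ballP => e e0.
have : \forall x \near F, forall i, ball (l 0 i) e (f x 0 i).
  by apply: filter_forall => i; move/cvg_ballP : (H i); apply.
by apply: filterS => x xH; split => // i j; rewrite ord1; exact: xH.
Qed.

(** * Cell sums *)

Lemma tower_mul_eq0l (R : realType) j (phi psi : nat -> R -> R) t :
  (forall i, phi i t = 0) -> tower_mul j phi psi t = 0.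
Proof.
elim: j phi psi => [|j IH] phi psi h /=; first by rewrite h mul0r.
by rewrite !IH ?addr0// => i; exact: h.
Qed.

Lemma tower_mul_eq0r (R : realType) j (phi psi : nat -> R -> R) t :
  (forall i, psi i t = 0) -> tower_mul j phi psi t = 0.
Proof.
elim: j phi psi => [|j IH] phi psi h /=; first by rewrite h mulr0.
by rewrite !IH ?addr0// => i; exact: h.
Qed.

Section cell_functions.
Context {R : realType}.

Definition cell_pt (m : nat) (z : int) : R := z%:~R / m.+1%:R.

(** The product of exp(-d/(t - a)) and exp(-d/(b - t)) on the mesh interval ]a, b[,
    with d = 1/(k + 1). *)
Definition cell_bump (m : nat) (z : int) (k : nat) : nat -> R -> R :=
  fun j => tower_mul j
    (fun i t => expV_tower k.+1%:R^-1 i (t - cell_pt m z))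
    (fun i t => (-1) ^+ i * expV_tower k.+1%:R^-1 i (cell_pt m (z + 1) - t)).

Definition cell_poly (m : nat) (z : int) (e : nat) : nat -> R -> R :=
  fun j t => poly_tower 'X^e j (t - cell_pt m z).

Definition cell_fun (m : nat) (z : int) (k e : nat) : nat -> R -> R :=
  fun j => tower_mul j (cell_bump m z k) (cell_poly m z e).

Lemma tower_cell_fun m z k e : tower (cell_fun m z k e).
Proof.
have k0 : 0 < k.+1%:R^-1 :> R by rewrite invr_gt0.
apply: tower_mulP.
  apply: tower_mulP.
    exact/tower_translate/expV_towerP.
  exact/tower_reflect/expV_towerP.
exact/tower_translate/poly_towerP.
Qed.

Lemma cell_fun_out m z k e j t :
  ~~ (cell_pt m z < t < cell_pt m (z + 1)) -> cell_fun m z k e j t = 0.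
Proof.
move=> tout; apply: tower_mul_eq0l => i; rewrite /cell_bump.
move: tout; rewrite negb_and -!leNgt => /orP[ta|tb].
  by apply: tower_mul_eq0l => l; rewrite /expV_tower subr_gt0 ltNge ta.
by apply: tower_mul_eq0r => l; rewrite /expV_tower subr_gt0 ltNge tb mulr0.
Qed.

Lemma cell_fun_cvg m z e j t : cell_pt m z < t < cell_pt m (z + 1) ->
  cell_fun m z k e j t @[k --> \oo] --> cell_poly m z e j t.
Proof.
move=> /andP[ta tb].
rewrite -[X in _ --> X]tower_mul1.
apply: (tower_mul_cvg (phi_ := fun k => cell_bump m z k)
   (psi_ := fun k => cell_poly m z e)) => i; last exact: cvg_cst.
rewrite -[X in _ --> X]tower_mul1.
apply: (tower_mul_cvg
  (phi_ := fun k i t => expV_tower k.+1%:R^-1 i (t - cell_pt m z))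
  (psi_ := fun k i t => (-1) ^+ i * expV_tower k.+1%:R^-1 i (cell_pt m (z + 1) - t))) => l.
  have := @expV_tower_cvg R (t - cell_pt m z) l; rewrite subr_gt0 => /(_ ta).
  by rewrite /one_tower.
have -> : one_tower l t = (-1) ^+ l * one_tower l (cell_pt m (z + 1) - t).
  by rewrite /one_tower; case: l => [|l] /=; rewrite ?expr0 ?mul1r// mulr0.
apply: cvgM; first exact: cvg_cst.
by apply: expV_tower_cvg; rewrite subr_gt0.
Qed.

(** A monomial has one nonzero derivative at its centre, and the corner of the
    cell that contains t tends to t as the mesh is refined. *)
Lemma cell_poly_cvg (z_ : nat -> int) e j (t : R) :
  (forall m, cell_pt m (z_ m) < t < cell_pt m (z_ m + 1)) ->
  cell_poly m (z_ m) e j t @[m --> \oo] --> (if j == e then e`!%:R else 0 : R).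
Proof.
move=> zt; rewrite -poly_tower_Xn /cell_poly.
apply: continuous_cvg; first exact: continuous_horner.
apply: (@squeeze_cvgr _ _ _ _ (fun=> 0) (fun m => m.+1%:R^-1)).
- near=> m; have /andP[z1 z2] := zt m.
  rewrite subr_ge0 ltW//= lerBlDr; apply: ltW (lt_le_trans z2 _).
  by rewrite /cell_pt intrD mulrDl mul1r addrC.
- exact: cvg_cst.
- exact: cvg_harmonic.
Unshelve. all: by end_near. Qed.

End cell_functions.

Section cell_sums.
Context (R : realType) (n N p : nat) (Omega : set 'rV[R]_n).
Local Notation V := 'rV[R]_n.

Definition multi_index := {ffun 'I_n -> 'I_p.+1}.

(** A rational coefficient, a component, and then the mesh, the corner of the cell,
    the exponents of the monomial and the sharpness of the bump. Codes form a
    countable type. *)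
Definition cell_code : Type :=
  (rat * 'I_N * (nat * {ffun 'I_n -> int} * multi_index * nat))%type.

Definition cell (m : nat) (z : {ffun 'I_n -> int}) : set V :=
  obox (\row_i cell_pt m (z i)) (\row_i cell_pt m (z i + 1)).

Definition code_comp (c : cell_code) : 'I_N := c.1.2.

(** A cell that leaves Omega gets the weight 0, so that every code stands for a
    function supported in Omega. *)
Definition code_coef (c : cell_code) : R :=
  if `[< cell c.2.1.1.1 c.2.1.1.2 `<=` Omega >] then ratr c.1.1 else 0.

Definition code_fun (c : cell_code) : 'I_n -> nat -> R -> R :=
  fun i => cell_fun c.2.1.1.1 (c.2.1.1.2 i) c.2.2 (c.2.1.2 i).

(** The partial derivative of order b of the a-th component, by partial_cell_sum. *)
Definition cell_sum_deriv (l : seq cell_code) (a : 'I_N) (b : 'I_n -> nat) (y : V) : R :=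
  \sum_(c <- l) (if code_comp c == a then code_coef c * tprod (code_fun c) b y else 0).

Definition cell_sum (l : seq cell_code) (y : V) : 'rV[R]_N :=
  \row_a cell_sum_deriv l a (fun=> 0%N) y.

Lemma is_derive_cell_sum l a b y i :
  is_derive y (delta_mx 0 i) (cell_sum_deriv l a b)
    (cell_sum_deriv l a (fun j => (i == j) + b j)%N y).
Proof.
elim: l => [|c l IH].
  rewrite /cell_sum_deriv big_nil.
  rewrite (_ : (fun y : V => _) = cst 0); first exact: is_derive_cst.
  by apply/funext => x; rewrite big_nil.
rewrite /cell_sum_deriv big_cons.
rewrite (_ : (fun y : V => _) =
  (fun y => if code_comp c == a then code_coef c * tprod (code_fun c) b y else 0)
   + cell_sum_deriv l a b); last by apply/funext => x; rewrite big_cons.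
apply: is_deriveD; case: eqP => _; last exact: (is_derive_cst (0 : R)).
apply: (@is_deriveZ _ _ _ (tprod (code_fun c) b)).
by apply: is_derive_tprod => j; exact: tower_cell_fun.
Qed.

Lemma partial_cell_sum l a s :
  partial s (fun y => cell_sum l y 0 a) = cell_sum_deriv l a (letter_count s).
Proof.
elim: s => [|i s IH] /=; first by apply/funext => y; rewrite mxE.
by rewrite IH; apply/funext => y; have [_ ->] := is_derive_cell_sum l a (letter_count s) y i.
Qed.

Lemma continuous_cell_sum_deriv l a b : continuous (cell_sum_deriv l a b).
Proof.
elim: l => [|c l IH].
  rewrite (_ : cell_sum_deriv _ _ _ = cst 0); first exact: cst_continuous.
  by apply/funext => x; rewrite /cell_sum_deriv big_nil.
rewrite (_ : cell_sum_deriv _ _ _ =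
  (fun y => if code_comp c == a then code_coef c * tprod (code_fun c) b y else 0)
   \+ cell_sum_deriv l a b); last first.
  by apply/funext => x; rewrite /cell_sum_deriv big_cons.
move=> y; apply: continuousD; last exact: IH.
case: eqP => _; last exact: cst_continuous.
apply: (@continuousM _ _ (cst (code_coef c))); first exact: cst_continuous.
by apply: continuous_tprod => i; exact: tower_cell_fun.
Qed.

Lemma cell_sum_smooth (D : set V) l : smooth_on D (cell_sum l).
Proof.
move=> a s x _ g; rewrite /g partial_cell_sum; split.
  exact: continuous_cell_sum_deriv.
by move=> i; case: (is_derive_cell_sum l a (letter_count s) x i).
Qed.

Lemma code_term_out c (b : 'I_n -> nat) y : ~ Omega y ->
  code_coef c * tprod (code_fun c) b y = 0.
Proof.
move=> nOy; rewrite /code_coef; case: asboolP => [cO|_]; last by rewrite mul0r.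
have /existsNP[i yi] : ~ cell c.2.1.1.1 c.2.1.1.2 y by move=> /cO.
rewrite /tprod (bigD1 i)//= {1}/code_fun cell_fun_out ?mul0r ?mulr0//.
by apply/negP; move: yi; rewrite !mxE.
Qed.

Lemma cell_sum_deriv_out l a b y : ~ Omega y -> cell_sum_deriv l a b y = 0.
Proof.
move=> nOy; rewrite /cell_sum_deriv big1// => c _.
by case: eqP => // _; exact: code_term_out.
Qed.

(** A cell sum is smooth on the whole space and vanishes outside Omega, so its
    limits at the boundary are 0 by continuity. *)
Lemma cell_sum_smooth_vanishing l : open Omega ->
  smooth_vanishing Omega (cell_sum l).
Proof.
move=> oO; split; first exact: cell_sum_smooth.
move=> y [_ nIy]; have nOy : ~ Omega y by move: oO; rewrite openE => oO /oO.
apply: cvg_within_filter.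
have -> : (0 : 'rV[R]_N) = cell_sum l y.
  by apply/rowP => a; rewrite !mxE cell_sum_deriv_out.
apply: cvg_rV => a; rewrite mxE.
under eq_fun do rewrite mxE.
exact: continuous_cell_sum_deriv.
Qed.

End cell_sums.

(** * Density of the jets of cell sums *)

Lemma increasing_choice (P : nat -> nat -> Prop) :
  (forall k j0, exists j, (j0 <= j)%N /\ P k j) ->
  exists j_ : nat -> nat, increasing_index j_ /\ forall k, P k (j_ k).
Proof.
move=> H; have [f Hf] := choice (fun kj => H kj.1 kj.2).
pose g := fix g k := if k is k'.+1 then f (k, (g k').+1) else f (0%N, 0%N).
exists g; split; last by case=> [|k]; [exact: (Hf (0%N, 0%N)).2|exact: (Hf (k.+1, _)).2].
by apply: homo_ltn => [? ? ?|k]; [exact: ltn_trans|exact: (Hf (k.+1, _)).1].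
Qed.

Section density.
Context (R : realType) (n N p : nat) (Omega : set 'rV[R]_n) (oO : open Omega).
Local Notation V := 'rV[R]_n.
Local Notation T := (leb_type R n).
Local Notation lambda := (lebesgue R n).
Local Notation MI := (multi_index n p).
Local Notation I := ('I_N * MI)%type.
Local Notation code := (cell_code n N p).

Let mO : measurable (Omega : set T). Proof. exact: measurable_open. Qed.

(** Beside the values, the derivatives of order at most p in each variable. *)
Definition code_field (l : seq code) (x : V) (i : I) : R :=
  cell_sum_deriv Omega l i.1 (fun j => i.2 j) x.

(** The closure of the jets of cell sums under almost everywhere limits, iterated
    transfinitely: stability under sums and multiples is then a plain induction,
    and the limit procedures below can be composed freely. *)
Inductive approximable : (V -> I -> R) -> Prop :=
| approximable_code l : approximable (code_field l)
| approximable_lim (c_ : nat -> V -> I -> R) (c : V -> I -> R) :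
    (forall k, approximable (c_ k)) ->
    {ae lambda, forall x, Omega x -> forall i, c_ k x i @[k --> \oo] --> c x i} ->
    approximable c.

Lemma measurable_code_field l i :
  measurable_fun (Omega : set T) (fun x : T => code_field l x i).
Proof.
apply: measurable_continuous_lebesgue => //; exact: continuous_cell_sum_deriv.
Qed.

Lemma approximable_measurable c i : approximable c ->
  measurable_fun (Omega : set T) (fun x : T => c x i).
Proof.
elim=> [l|c_ {}c _ IH cc]; first exact: measurable_code_field.
apply: (lebesgue_measurable_ae_cvg mO IH).
by apply: ae_mono cc => x H Ox; exact: H.
Qed.

Lemma approximable_add c c' : approximable c -> approximable c' ->
  approximable (fun x i => c x i + c' x i).
Proof.
move=> + ac'; elim=> [l|c_ {}c _ IH cc]; last first.
  apply: (approximable_lim IH); apply: ae_mono cc => x H Ox i.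
  by apply: cvgD; [exact: H|exact: cvg_cst].
elim: ac' => [l'|c_ {}c' _ IH cc]; last first.
  apply: (approximable_lim IH); apply: ae_mono cc => x H Ox i.
  by apply: cvgD; [exact: cvg_cst|exact: H].
rewrite (_ : (fun x i => _) = code_field (l ++ l')); first exact: approximable_code.
by apply/funext => x; apply/funext => i; rewrite /code_field /cell_sum_deriv big_cat.
Qed.

Lemma approximable0 : approximable (fun _ _ => 0).
Proof.
rewrite (_ : (fun _ _ => _) = code_field [::]); first exact: approximable_code.
by apply/funext => x; apply/funext => i; rewrite /code_field /cell_sum_deriv big_nil.
Qed.

Lemma approximable_sum (J : Type) (s : seq J) (P : pred J) (c_ : J -> V -> I -> R) :
  (forall j, approximable (c_ j)) ->
  approximable (fun x i => \sum_(j <- s | P j) c_ j x i).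
Proof.
move=> H; elim: s => [|j s IH].
  by under eq_fun do under eq_fun do rewrite big_nil; exact: approximable0.
under eq_fun do under eq_fun do rewrite big_cons.
by case: (P j) => //; exact: approximable_add.
Qed.

Lemma approximable_ext c c' : (forall x, Omega x -> forall i, c x i = c' x i) ->
  approximable c -> approximable c'.
Proof.
move=> cc' ac; apply: (@approximable_lim (fun=> c)) => //.
by apply: aeW => x Ox i; rewrite -cc'//; exact: cvg_cst.
Qed.

Lemma approximable_scale_rat (q : rat) c : approximable c ->
  approximable (fun x i => ratr q * c x i).
Proof.
elim=> [l|c_ {}c _ IH cc]; last first.
  apply: (approximable_lim IH); apply: ae_mono cc => x H Ox i.
  by apply: cvgM; [exact: cvg_cst|exact: H].
rewrite (_ : (fun x i => _) =
  code_field [seq (q * c.1.1, c.1.2, c.2) | c <- l]); first exact: approximable_code.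
apply/funext => x; apply/funext => i; rewrite /code_field /cell_sum_deriv.
rewrite big_map mulr_sumr; apply: eq_bigr => e _.
rewrite /code_comp/=; case: eqP => _; rewrite ?mulr0// mulrA; congr (_ * _).
by rewrite /code_coef /=; case: ifP => _; rewrite ?mulr0// rmorphM.
Qed.

(** Codes carry rational coefficients; real ones are reached in the limit. *)
Lemma approximable_scale (r : R) c : approximable c ->
  approximable (fun x i => r * c x i).
Proof.
move=> ac.
have H k : exists q : rat, ratr q \in `]r, (r + k.+1%:R^-1)[.
  by apply: rat_in_itvoo; rewrite ltrDl invr_gt0.
have [q Hq] := choice H.
apply: (approximable_lim (fun k => approximable_scale_rat (q k) ac)).
apply: aeW => x Ox i; apply: cvgM; last exact: cvg_cst.
apply: (@squeeze_cvgr _ _ _ _ (fun=> r) (fun k => r + k.+1%:R^-1)).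
- by near=> k; have := Hq k; rewrite in_itv/= => /andP[/ltW -> /ltW ->].
- exact: cvg_cst.
- rewrite -[X in _ --> X]addr0; apply: cvgD; first exact: cvg_cst.
  exact: cvg_harmonic.
Unshelve. all: by end_near. Qed.

(** The limit of a single bump as its sharpness grows: a monomial with its
    derivatives, restricted to a cell. *)
Definition cell_field (m : nat) (z : {ffun 'I_n -> int}) (a : 'I_N) (b : MI)
    (x : V) (i : I) : R :=
  \1_(cell m z : set V) x * (a == i.1)%:R *
  \prod_j cell_poly m (z j) (b j) (i.2 j) (x 0 j).

Lemma approximable_cell m z a b : cell m z `<=` Omega ->
  approximable (cell_field m z a b).
Proof.
move=> cO; pose cd k : code := (1%Q, a, (m, z, b, k)).
apply: (approximable_lim (fun k => approximable_code [:: cd k])).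
apply: aeW => x Ox i.
have E k : code_field [:: cd k] x i =
    if a == i.1 then tprod (code_fun (cd k)) (fun j => i.2 j) x else 0.
  rewrite /code_field /cell_sum_deriv big_seq1 /code_comp/= /code_coef/=.
  by rewrite asboolT// rmorph1 mul1r.
under eq_fun do rewrite E.
rewrite /cell_field; have [ai|ai] := eqVneq a i.1; last first.
  by rewrite mulr0 mul0r; exact: cvg_cst.
rewrite mulr1; have [xc|xc] := pselect (cell m z x); last first.
  rewrite indicE memNset// mul0r.
  rewrite (_ : (fun k : nat => _) = fun=> 0); first exact: cvg_cst.
  apply/funext => k; have /existsNP[j xj] := xc.
  rewrite /tprod (bigD1 j)//= /code_fun/= cell_fun_out ?mul0r//.
  by apply/negP; move: xj; rewrite !mxE.
rewrite indicE mem_set// mul1r /tprod.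
suff H s : \prod_(j <- s) code_fun (cd k) j (i.2 j) (x 0 j) @[k --> \oo] -->
    \prod_(j <- s) cell_poly m (z j) (b j) (i.2 j) (x 0 j) by exact: H.
elim: s => [|j s IH].
  by rewrite big_nil; under eq_fun do rewrite big_nil; exact: cvg_cst.
rewrite big_cons; under eq_fun do rewrite big_cons.
apply: cvgM => //; rewrite /code_fun/=; apply: cell_fun_cvg.
by have := xc j; rewrite !mxE.
Qed.

Definition unit_field (A : set V) (i0 : I) (x : V) (i : I) : R :=
  \1_A x * (i0 == i)%:R.

Lemma cell_floor m z (x : V) : cell m z x -> forall j, z j = Num.floor (x 0 j * m.+1%:R).
Proof.
move=> xz j; have := xz j; rewrite !mxE /cell_pt => /andP[z1 z2].
apply/esym/floor_def; rewrite -ler_pdivrMr// -ltr_pdivlMr// z2 andbT.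
exact: ltW.
Qed.

Definition grid : set T := [set x | exists j m z, (x : V) 0 j = cell_pt m z].

Lemma negligible_grid : lambda.-negligible grid.
Proof.
apply: (@negligibleS _ _ _ _ (\bigcup_(q : 'I_n * nat * int)
   [set x : T | (x : V) 0 q.1.1 = cell_pt q.1.2 q.2])).
  by move=> x [j [m [z xz]]]; exists (j, m, z).
by apply: negligible_countable_bigcup => // q _; exact: negligible_hyperplane.
Qed.

(** Large enough for the cells of width 1 / (m + 1) to cover the cube of radius m. *)
Definition mesh_radius (m : nat) := (m.+1 ^ 2)%N.

Definition mesh (m : nat) (g : {ffun 'I_n -> 'I_(mesh_radius m).*2.+1}) :
  {ffun 'I_n -> int} := [ffun j => (g j)%:Z - (mesh_radius m)%:Z].

Lemma mesh_inj m : injective (@mesh m).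
Proof.
move=> g g' /ffunP gg; apply/ffunP => j; apply/val_inj.
by have := gg j; rewrite !ffunE => /addIr[].
Qed.

Lemma mesh_surj m (z : {ffun 'I_n -> int}) :
  (forall j, (`|z j| <= mesh_radius m)%N) -> exists g, @mesh m g = z.
Proof.
move=> zb; have H j : (`|(z j + (mesh_radius m)%:Z)%R| < (mesh_radius m).*2.+1)%N.
  have := zb j; move: (z j) (mesh_radius m) => u K; lia.
exists [ffun j => Ordinal (H j)]; apply/ffunP => j; rewrite !ffunE/=.
have := zb j; move: (z j) (mesh_radius m) => u K; lia.
Qed.

Lemma floor_cell m (x : V) : ~ grid x ->
  cell m [ffun j => Num.floor (x 0 j * m.+1%:R)] x.
Proof.
move=> xg j; rewrite !mxE ffunE /cell_pt ltr_pdivlMr// ltr_pdivrMr//.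
have /andP[f1 ->] := floor_itv (x 0 j * m.+1%:R); rewrite andbT lt_neqAle f1 andbT.
apply/eqP => E; apply: xg; exists j, m, (Num.floor (x 0 j * m.+1%:R)).
by rewrite /cell_pt E mulfK.
Qed.

Lemma mesh_radius_bound m (t : R) : `|t| <= m%:R ->
  (`|Num.floor (t * m.+1%:R)| <= mesh_radius m)%N.
Proof.
rewrite ler_norml => /andP[t1 t2].
rewrite -lez_nat abszE ler_norml; apply/andP; split.
  rewrite floor_ge_int intrN -[_%:~R]/((m.+1 ^ 2)%:R : R) natrX expr2 -mulNr.
  by rewrite ler_wpM2r// (le_trans _ t1)// lerN2 ler_nat.
have /andP[f1 _] := floor_itv (t * m.+1%:R).
rewrite -(ler_int R) (le_trans f1)// -[leRHS]/((m.+1 ^ 2)%:R : R) natrX expr2.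
by rewrite ler_wpM2r// (le_trans t2)// ler_nat.
Qed.

(** The sum runs over the cells of the mesh that are contained in O. At a point x of
    O outside the grids, the only cell that contributes is the one around x, and
    the derivatives of its monomial tend to 0 at x except the one whose order is
    the exponent, which is a product of factorials. *)
Lemma approximable_open (O : set V) (i0 : I) : open O -> O `<=` Omega ->
  approximable (unit_field O i0).
Proof.
case: i0 => a b oO' OO.
pose c_ m x (i : I) := \sum_(g : {ffun 'I_n -> 'I_(mesh_radius m).*2.+1})
  (if `[< cell m (@mesh m g) `<=` O >] then cell_field m (@mesh m g) a b x i else 0).
have ac m : approximable (c_ m).
  apply: (approximable_sum _ _ (c_ := fun g x i =>
    if `[< cell m (@mesh m g) `<=` O >] then cell_field m (@mesh m g) a b x i else 0)).
  move=> g; case: asboolP => gO; last exact: approximable0.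
  by apply: approximable_cell; exact: subset_trans OO.
pose bf : R := \prod_j (b j)`!%:R.
have bf0 : bf != 0 by apply/prodf_neq0 => j _; rewrite pnatr_eq0 -lt0n fact_gt0.
suff H : approximable (fun x i => bf * unit_field O (a, b) x i).
  have := approximable_scale bf^-1 H; congr approximable.
  by apply/funext => x; apply/funext => i; rewrite mulKf.
apply: (approximable_lim ac).
apply: (@negligibleS _ _ _ _ grid); last exact: negligible_grid.
apply: subsetCl => x xg Ox i.
have [Oxx|nOx] := pselect (O x); last first.
  rewrite /unit_field indicE memNset// mul0r mulr0.
  rewrite (_ : (fun k : nat => _) = fun=> 0); first exact: cvg_cst.
  apply/funext => m; rewrite /c_ big1// => g _; case: asboolP => // gO.
  by rewrite /cell_field indicE memNset ?mul0r// => /gO.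
pose z m := [ffun j => Num.floor (x 0 j * m.+1%:R)] : {ffun 'I_n -> int}.
have near_c : \forall m \near \oo,
    (a == i.1)%:R * \prod_j cell_poly m (z m j) (b j) (i.2 j) (x 0 j) = c_ m x i.
  have [k Hk] := cube_cover x.
  have /nbhs_ballP[e /= e0 xeO] : nbhs x O by move: oO'; rewrite openE; apply.
  near=> m.
  have [g gz] : exists g, @mesh m g = z m.
    apply: mesh_surj => j; rewrite ffunE; apply: mesh_radius_bound.
    by apply: Hk; near: m; exact: nbhs_infty_ge.
  have zO : cell m (z m) `<=` O.
    move=> y yz; apply: xeO; split=> // i1 j; rewrite ord1 /ball/=.
    have := yz j; have := floor_cell m xg j; rewrite !mxE => /andP[x1 x2] /andP[y1 y2].
    have me : m.+1%:R^-1 < e by near: m; exact: near_infty_natSinv_lt (PosNum e0).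
    move: x2 y2; rewrite /cell_pt intrD mulrDl mul1r -!/(cell_pt _ _) => x2 y2.
    move: (cell_pt m _) (x 0 j) (y 0 j) m.+1%:R^-1 x1 y1 me x2 y2 => q s t h *.
    by rewrite ltr_norml; apply/andP; split; lra.
  rewrite /c_ (bigD1 g)//= gz asboolT// [X in _ + X]big1 => [|g' g'g].
    rewrite addr0 /cell_field indicE mem_set ?mul1r//; exact: floor_cell.
  case: asboolP => // _; rewrite /cell_field indicE memNset ?mul0r// => xg'.
  case/eqP: g'g; apply: mesh_inj; rewrite gz; apply/ffunP => j.
  by rewrite [RHS]ffunE; exact: (cell_floor xg').
apply: cvg_trans (near_eq_cvg near_c) _.
rewrite /unit_field indicE mem_set// mul1r.
rewrite (_ : bf * _ = (a == i.1)%:R *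
    \prod_j (if i.2 j == b j :> nat then (b j)`!%:R else 0)); last first.
  rewrite mulrC -pair_eqE /=; case: eqP => _; rewrite ?mul0r//= ?mul1r.
  have [bi|bi] := eqVneq b i.2.
    by rewrite mul1r; apply: eq_bigr => j _; rewrite bi eqxx.
  rewrite mul0r; have [j bij] : exists j, b j != i.2 j.
    by apply/existsP; rewrite -negb_forall; apply: contra bi => /forallP H;
       apply/eqP/ffunP => j; exact/eqP.
  rewrite (bigD1 j)//= ifF ?mul0r//; apply/negbTE.
  by rewrite eq_sym; apply: contra bij => /eqP/val_inj ->.
apply: cvgM; first exact: cvg_cst.
suff H s : \prod_(j <- s) cell_poly m (z m j) (b j) (i.2 j) (x 0 j) @[m --> \oo] -->
   (\prod_(j <- s) (if i.2 j == b j :> nat then (b j)`!%:R else 0) : R) by exact: H.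
elim: s => [|j s IH].
  by rewrite big_nil; under eq_fun do rewrite big_nil; exact: cvg_cst.
rewrite big_cons; under eq_fun do rewrite big_cons.
apply: cvgM => //; apply: (cell_poly_cvg (z_ := fun m => z m j)) => m.
by have := floor_cell m xg j; rewrite !mxE.
Unshelve. all: by end_near. Qed.

(** Open sets that approximate A from outside, with errors 1 / 2 ^ (k + 1), have
    indicators converging to that of A almost everywhere. *)
Lemma approximable_fin_set (A : set T) i0 : measurable A -> A `<=` Omega ->
  (lambda A < +oo)%E -> approximable (unit_field A i0).
Proof.
move=> mA AO Afin.
have H k : exists O : set V, [/\ open O, lambda.-negligible (A `\` O) &
    (lambda (O `\` A) <= ((2 ^ k.+1)%:R^-1)%:E)%E].
  by apply: lebesgue_outer_regular => //; rewrite invr_gt0 ltr0n expn_gt0.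
have [B_ HO] := choice H.
pose G k : set T := B_ k `&` Omega.
have oG k : open (G k : set V) by apply: openI => //; case: (HO k).
have mG k : measurable (G k) by exact: measurable_open.
have aG k : approximable (unit_field (G k) i0).
  by apply: approximable_open => //; exact: subIsetr.
apply: (approximable_lim aG).
pose S k : set T := (G k `\` A) `|` (A `\` G k).
have mS k : measurable (S k) by apply: measurableU; exact: measurableD.
have SG k x : `|\1_(G k) x - \1_A x| = \1_(S k) x :> R.
  rewrite !indicE /S in_setU !in_setD;
  by case: (x \in G k); case: (x \in A); rewrite /= ?subrr ?normr0 ?subr0 ?sub0r ?normrN ?normr1.
have : {ae lambda, forall x, Omega x -> \1_(S k) x @[k --> \oo] --> (0 : R)}.
  apply: (@lebesgue_ae_cvg0 R n Omega (fun k => \1_(S k))) => //.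
  - by move=> k x _; rewrite indicE; case: (x \in _); rewrite /= ?lexx ?ler01.
  - move=> k; rewrite Rintegral_indic//; last first.
      by apply: measurableI => //; exact: measurable_cube.
    have Sle : (lambda (S k) <= ((2 ^ k.+1)%:R^-1)%:E)%E.
      apply: le_trans (measureU2 _ _ _) _; [exact: measurableD|exact: measurableD|].
      have [_ nAO lO] := HO k; rewrite -[leRHS]adde0; apply: leeD.
        apply: le_trans lO; apply: lebesgue_le => x [[Ox _] nAx]; by split.
      have nAG : lambda.-negligible (A `\` G k).
        by apply: negligibleS nAO => x [Ax nGx]; split => // Okx; apply: nGx; split => //; exact: AO.
      by rewrite le_eqVlt; apply/orP; left; apply/eqP/negligibleP => //; exact: measurableD.
    have Sle' : (lambda (S k `&` (Omega `&` cube k)) <= ((2 ^ k.+1)%:R^-1)%:E)%E.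
      by apply: le_trans Sle; apply: lebesgue_le; exact: subIsetl.
    rewrite -lee_fin fineK// ge0_fin_numE ?measure_ge0//.
    exact: le_lt_trans Sle' (ltry _).
apply: ae_mono => x Sx Ox i; rewrite /unit_field.
apply: cvgM; last exact: cvg_cst.
apply/subr_cvg0/norm_cvg0P; under eq_fun do rewrite SG.
exact: Sx.
Qed.

Lemma approximable_set (A : set T) i0 : measurable A -> A `<=` Omega ->
  approximable (unit_field A i0).
Proof.
move=> mA AO.
have aA k : approximable (unit_field (A `&` cube k : set T) i0).
  apply: approximable_fin_set.
  - by apply: measurableI => //; exact: measurable_cube.
  - by move=> x [/AO].
  - exact: cubeI_lty.
apply: (approximable_lim aA).
apply: aeW => x Ox i; rewrite /unit_field; apply: cvgM; last exact: cvg_cst.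
have [k0 Hk0] := cube_cover x.
suff H : \forall k \near \oo, \1_A x = \1_(A `&` cube k : set T) x :> R.
  by apply: cvg_trans (near_eq_cvg H) _; exact: cvg_cst.
near=> k; rewrite !indicE; congr (_%:R); congr nat_of_bool.
have kx : cube k x by apply: Hk0; near: k; exact: nbhs_infty_ge.
by rewrite in_setI (mem_set kx) andbT.
Unshelve. all: by end_near. Qed.

Import HBSimple.

Lemma approximable_fun (f : T -> R) (i0 : I) : measurable_fun (Omega : set T) f ->
  approximable (fun x i => f x * (i0 == i)%:R).
Proof.
move=> mf.
have mf' : measurable_fun (Omega : set T) (EFin \o f) by exact/measurable_EFinP.
have [g Hg] := approximation_sfun mO mf'.
have ag k : approximable (fun x i => g k x * (i0 == i)%:R).
  pose A y : set T := g k @^-1` [set y] `&` Omega.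
  have ext (x : V) : Omega x -> forall i : I,
      \sum_(y <- fset_set (range (g k))) y * unit_field (A y) i0 x i =
      g k x * (i0 == i)%:R.
    move=> Ox i; rewrite fimfunE fsbig_finite//= mulr_suml.
    apply: eq_bigr => y _; rewrite mulrA; congr (_ * _ * _).
    rewrite !indicE /A in_setI; rewrite [X in _ && X](_ : _ = true) ?andbT//.
    exact/mem_set.
  apply: (approximable_ext ext).
  apply: (approximable_sum _ _ (c_ := fun y x i => y * unit_field (A y) i0 x i)) => y.
  apply: approximable_scale; apply: approximable_set; last exact: subIsetr.
  exact: measurableI.
apply: (approximable_lim ag); apply: aeW => x Ox i.
apply: cvgM; last exact: cvg_cst.
by have /fine_cvgP[] := Hg x Ox.
Qed.

(** The components of c are unrelated to each other: the approximating functions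
    oscillate on finer and finer scales, so that their derivatives do not follow
    their values. *)
Lemma approximable_measurable_field (c : V -> I -> R) :
  (forall i, measurable_fun (Omega : set T) (fun x : T => c x i)) -> approximable c.
Proof.
move=> mc.
rewrite (_ : c = fun x i => \sum_i0 c x i0 * (i0 == i)%:R); last first.
  apply/funext => x; apply/funext => i; rewrite (bigD1 i)//= eqxx mulr1.
  by rewrite big1 ?addr0// => j /negbTE ->; rewrite mulr0.
apply: (approximable_sum _ _ (c_ := fun i0 x i => c x i0 * (i0 == i)%:R)) => i0.
exact: approximable_fun.
Qed.

(** Truncation makes the gap integrable on sets of finite measure; its integrals
    measure convergence locally in measure. *)
Definition field_gap (c c' : V -> I -> R) (x : V) : R :=
  Num.min 1 (\sum_i `|c x i - c' x i|).

Lemma field_gap01 c c' x : 0 <= field_gap c c' x <= 1.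
Proof. by rewrite /field_gap ge_min lexx andbT le_min ler01 sumr_ge0. Qed.

Lemma field_gap_triangle c c1 c' x :
  field_gap c c' x <= field_gap c c1 x + field_gap c1 c' x.
Proof.
rewrite /field_gap; set s := (X in Num.min 1 X <= _).
set s1 := (X in _ <= Num.min 1 X + _); set s2 := (X in _ <= _ + Num.min 1 X).
have ss : s <= s1 + s2.
  by rewrite /s /s1 /s2 -big_split ler_sum// => i _; exact: ler_distD.
have s1_ge0 : 0 <= s1 by exact: sumr_ge0.
have s2_ge0 : 0 <= s2 by exact: sumr_ge0.
by rewrite /Num.min; repeat case: ifPn; rewrite -?leNgt => *; lra.
Qed.

Lemma measurable_field_gap c c' :
  (forall i, measurable_fun (Omega : set T) (fun x : T => c x i)) ->
  (forall i, measurable_fun (Omega : set T) (fun x : T => c' x i)) ->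
  measurable_fun (Omega : set T) (fun x : T => field_gap c c' x).
Proof.
move=> mc mc'; apply: measurable_minr; first exact: measurable_cst.
apply: (@measurable_sum _ T R (Omega : set T) I (index_enum _)
  (fun i (x : T) => `|c x i - c' x i|)) => i.
apply: (@measurable_fun_norm _ T R); exact: (@measurable_funB _ T R).
Qed.

Lemma field_gap_cvg (c_ : nat -> V -> I -> R) (c : V -> I -> R) (x : V) :
  (forall i, c_ k x i @[k --> \oo] --> c x i) <->
  field_gap (c_ k) c x @[k --> \oo] --> (0 : R).
Proof.
split => [H|H i].
  have S0 (s : seq I) : \sum_(i <- s) `|c_ k x i - c x i| @[k --> \oo] --> (0 : R).
    elim: s => [|i s IH].
      by under eq_fun do rewrite big_nil; exact: cvg_cst.
    rewrite -[X in _ --> X]addr0; under eq_fun do rewrite big_cons.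
    apply: cvgD => //.
    by apply/norm_cvg0P/subr_cvg0; exact: H.
  apply: (squeeze_cvgr _ (cvg_cst 0) (S0 (index_enum _))).
  near=> k; have /andP[-> _] /= := field_gap01 (c_ k) c x.
  by rewrite /field_gap ge_min lexx orbT.
apply/cvgrPdist_lt => e e0.
have m0 : 0 < Num.min 1 e by rewrite lt_min ltr01.
move/cvgrPdist_lt : H => /(_ _ m0); apply: filterS => k.
rewrite sub0r normrN ger0_norm; last by have /andP[] := field_gap01 (c_ k) c x.
rewrite /field_gap lt_min !gt_min ltxx /= => /andP[s1 se].
have {s1}se : \sum_i `|c_ k x i - c x i| < e.
  by case/orP : se => // e1; exact: lt_trans s1 e1.
apply: le_lt_trans se; rewrite distrC (bigD1 i)//= lerDl; exact: sumr_ge0.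
Unshelve. all: by end_near. Qed.

Local Notation dist k c c' :=
  (\int[lambda]_(x in (Omega : set T) `&` cube k) field_gap c c' x).

Let mOk k : measurable ((Omega : set T) `&` cube k).
Proof. by apply: measurableI => //; exact: measurable_cube. Qed.

Lemma integrable_field_gap k c c' :
  (forall i, measurable_fun (Omega : set T) (fun x : T => c x i)) ->
  (forall i, measurable_fun (Omega : set T) (fun x : T => c' x i)) ->
  lambda.-integrable ((Omega : set T) `&` cube k) (EFin \o (fun x : T => field_gap c c' x)).
Proof.
move=> mc mc'; apply: (@lebesgue_bounded_integrable R n _ _ 1).
- exact: mOk.
- exact: cubeI_lty.
- exact: (measurable_funS mO (@subIsetl _ _ _) (measurable_field_gap mc mc')).
by move=> x _; have /andP[? ?] := field_gap01 c c' x; rewrite ger0_norm.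
Qed.

(** In terms of the mean gap, membership in the transfinite closure reduces to
    approximation by a single code: the property passes to almost everywhere
    limits by dominated convergence and the triangle inequality. *)
Lemma approximable_dist c (k : nat) (e : R) : approximable c -> 0 < e ->
  exists l, dist k (code_field l) c < e.
Proof.
move=> ac; elim: ac e => [l|c_ {}c ac_ IH cc] e e0.
  exists l; rewrite (_ : (fun x => _) = cst 0).
    by rewrite /Rintegral integral0.
  apply/funext => x; rewrite /field_gap big1 => [|i _]; last by rewrite subrr normr0.
  by rewrite min_r.
have mc_ j i : measurable_fun (Omega : set T) (fun x : T => c_ j x i).
  exact: approximable_measurable.
have mc i : measurable_fun (Omega : set T) (fun x : T => c x i).
  by apply: approximable_measurable; apply: (approximable_lim ac_).
have d0 : dist k (c_ j) c @[j --> \oo] --> (0 : R).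
  have -> : (0 : R) = \int[lambda]_(x in (Omega : set T) `&` cube k) cst 0 x.
    by rewrite /Rintegral integral0.
  apply: (@lebesgue_bounded_cvg R n _ _ _ 1).
  - exact: mOk.
  - exact: cubeI_lty.
  - move=> j.
    exact: (measurable_funS mO (@subIsetl _ _ _) (measurable_field_gap (mc_ j) mc)).
  - exact: measurable_cst.
  - by apply: ae_mono cc => x H [Ox _]; apply/field_gap_cvg; exact: H.
  - by move=> j x _; have /andP[? ?] := field_gap01 (c_ j) c x; rewrite ger0_norm.
have e2 : 0 < e / 2 by rewrite divr_gt0.
move/cvgrPdist_lt : d0 => /(_ _ e2) [j0 _ /(_ j0 (leqnn _))] /=.
rewrite sub0r normrN => /(le_lt_trans (ler_norm _)) dj.
have [l dl] := IH j0 _ e2; exists l.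
have ml i := measurable_code_field l i.
apply: (@le_lt_trans _ _ (dist k (code_field l) (c_ j0) + dist k (c_ j0) c)).
  rewrite -RintegralD//; [|exact: integrable_field_gap|exact: integrable_field_gap].
  apply: le_Rintegral => //; first exact: integrable_field_gap.
    apply: (@integrable_EFinD _ T R lambda _ (mOk k)); exact: integrable_field_gap.
  by move=> x _; exact: field_gap_triangle.
by rewrite (splitr e) ltrD.
Qed.

(** The second component of the decoded pair is a dummy, so that each list of codes
    occurs at arbitrarily large indices and approximants can be selected with
    increasing indices. *)
Definition decode_cells (j : nat) : seq code :=
  if (choice.unpickle j : option (seq code * nat)) is Some lt then lt.1 else [::].

Lemma decode_surj (l : seq code) (j0 : nat) : exists j, (j0 <= j)%N /\ decode_cells j = l.
Proof.
have [t Ht] : exists t : nat, (j0 <= choice.pickle (l, t : nat))%N.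
  apply: contrapT => /forallNP H.
  (* otherwise infinitely many distinct pairs would have codes below j0 *)
  have H' (t : nat) : (choice.pickle (l, t) < j0)%N by rewrite ltnNge; apply/negP.
  pose f (t : 'I_j0.+1) : 'I_j0 := Ordinal (H' t).
  have /leq_card : injective f.
    move=> t1 t2 /(congr1 val) /= /(pcan_inj choice.pickleK)[] tt; exact/val_inj.
  by rewrite !card_ord ltnn.
by exists (choice.pickle (l, t)); split => //; rewrite /decode_cells choice.pickleK.
Qed.

Lemma decode_ae_cvg (c : V -> I -> R) :
  (forall i, measurable_fun (Omega : set T) (fun x : T => c x i)) ->
  exists j_ : nat -> nat, increasing_index j_ /\
   {ae lambda, forall x, Omega x -> forall i,
     code_field (decode_cells (j_ k)) x i @[k --> \oo] --> c x i}.
Proof.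
move=> mc; have ac := approximable_measurable_field mc.
have [k j0|j_ [ij dj]] := @increasing_choice (fun k j =>
  dist k (code_field (decode_cells j)) c < (2 ^ k.+1)%:R^-1).
  have [|l dl] := @approximable_dist c k (2 ^ k.+1)%:R^-1 ac.
    by rewrite invr_gt0 ltr0n expn_gt0.
  by have [j [jj0 jl]] := decode_surj l j0; exists j; rewrite jl.
exists j_; split => //.
have := @lebesgue_ae_cvg0 R n Omega
  (fun k x => field_gap (code_field (decode_cells (j_ k))) c x) mO.
move=> H; apply: ae_mono (H _ _ _) => {H}.
- move=> x H Ox.
  exact: ((field_gap_cvg (fun k => code_field (decode_cells (j_ k))) c x).2 (H Ox)).
- move=> k; apply: (@measurable_field_gap (code_field (decode_cells (j_ k))) c) => i.
    exact: measurable_code_field.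
  exact: mc.
- by move=> k x _; exact: field_gap01.
- by move=> k; apply/ltW; exact: dj.
Qed.
End density.

(** * Topology of jets and of their compactification *)

Section finite_products.
Context (I : finType) (T : I -> topologicalType).

(** The filter of boxes converges to x along each projection, hence in the product
    topology. *)
Lemma nbhs_prod_fin (x : prod_topology T) (A : set (prod_topology T)) :
  nbhs x A -> exists U : forall i, set (T i),
    (forall i, nbhs (x i) (U i)) /\ (forall y, (forall i, U i (y i)) -> A y).
Proof.
move=> xA.
pose F : set_system (prod_topology T) :=
  filter_from [set U : forall i, set (T i) | forall i, nbhs (x i) (U i)]
    (fun U => [set y | forall i, U i (y i)]).
have FF : Filter F.
  apply: filter_from_filter; first by exists (fun=> setT) => i; exact: filterT.
  move=> U W HU HW; exists (fun i => U i `&` W i).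
    by move=> i; exact: filterI.
  by move=> y H; split => i; have [] := H i.
have : F --> (x : prod_topology T).
  apply/cvg_sup => i.
  move=> B [_ [[/= Q oQ <-] Qx] QB].
  exists (fun j => [set t | forall y : (forall k, T k), y j = t -> j = i -> Q (y i)]).
    move=> j; have [->|ji] := eqVneq j i.
      have := open_nbhs_nbhs (conj oQ Qx).
      by apply: filterS => t Qt y /= ->.
    by apply: filterS filterT => t _ y _ /eqP; rewrite (negbTE ji).
  by move=> y Hy; apply: QB; exact: Hy i y erefl erefl.
by move=> /(_ _ xA) [U HU UA]; exists U; split => // y; exact: UA.
Qed.

Lemma nbhs_prod_box (x : prod_topology T) (U : forall i, set (T i)) :
  (forall i, nbhs (x i) (U i)) -> nbhs x [set y | forall i, U i (y i)].
Proof.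
move=> xU; apply: (filter_forall (nbhs_filter x)) => i.
exact: (@proj_continuous I T i x (U i) (xU i)).
Qed.
End finite_products.

Lemma finite_pos_lb (R : realType) (I : finType) (e : I -> R) :
  (forall i, 0 < e i) -> exists d, 0 < d /\ forall i, d <= e i.
Proof.
move=> e0; have S0 : 0 <= \sum_i (e i)^-1.
  by apply: sumr_ge0 => i _; rewrite invr_ge0 ltW.
exists (1 + \sum_i (e i)^-1)^-1; split; first by rewrite invr_gt0 ltr_pwDl.
move=> i; rewrite invf_ple ?posrE ?ltr_pwDl//.
rewrite (bigD1 i)//= addrCA lerDl addr_ge0// sumr_ge0// => j _.
by rewrite invr_ge0 ltW.
Qed.

Section jets.
Context (R : realType) (N n : nat).

Definition near_tensor q (X Y : tensor R N n q) (e : R) :=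
  forall ai, `|X ai - Y ai| < e.

Lemma nbhs_tensorP q (X : tensor R N n q) (A : set (tensor R N n q)) :
  nbhs X A <-> exists2 e, 0 < e & forall Y, near_tensor X Y e -> A Y.
Proof.
split => [/nbhs_prod_fin[U [XU UA]]|[e e0 eA]].
  have H ai : exists e : R, 0 < e /\ forall t, `|X ai - t| < e -> U ai t.
    by have /nbhs_ballP[e /= e0 eU] := XU ai; exists e; split => // t; exact: eU.
  have [e He] := choice H.
  have [d [d0 de]] := finite_pos_lb (fun ai => (He ai).1).
  exists d => // Y XY; apply: UA => ai; apply: (He ai).2.
  exact: lt_le_trans (XY ai) (de ai).
have : nbhs X [set Y : tensor R N n q | forall ai, ball (X ai) e (Y ai)].
  apply: (nbhs_prod_box (T := fun=> R) (U := fun ai => ball (X ai) e)) => ai.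
  exact: nbhsx_ballx.
by apply: filterS => Y XY; exact: eA.
Qed.

Lemma nbhs_symtP q (X : symt R N n q) (A : set (symt R N n q)) :
  nbhs X A <-> exists2 e, 0 < e & forall Y, near_tensor (\val X) (\val Y) e -> A Y.
Proof.
split.
  move=> [_ [[/= Q oQ <-] QX] QA].
  have /nbhs_tensorP[e e0 eQ] := open_nbhs_nbhs (conj oQ QX).
  by exists e => // Y /eQ/QA.
move=> [e e0 eA].
have : nbhs (\val X : tensor R N n q) [set Y | near_tensor (\val X) Y e].
  by apply/nbhs_tensorP; exists e.
move/(@initial_continuous _ _ (\val : symt R N n q -> tensor R N n q) X) => H.
by apply: (@filterS _ (nbhs X) _ _ _ _ H) => Y; exact: eA.
Qed.

Context (p : nat).
Local Notation jet := (jet R N n p).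
Local Notation K := (jet_bar R N n p).

Definition near_jet (X Y : jet) (e : R) :=
  forall q, near_tensor (\val (X q)) (\val (Y q)) e.

Lemma nbhs_jetP (X : jet) (A : set jet) :
  nbhs X A <-> exists2 e, 0 < e & forall Y, near_jet X Y e -> A Y.
Proof.
split => [/nbhs_prod_fin[U [XU UA]]|[e e0 eA]].
  have H q : exists e : R, 0 < e /\ forall t, near_tensor (\val (X q)) (\val t) e -> U q t.
    by have /nbhs_symtP[e e0 eU] := XU q; exists e.
  have [e He] := choice H.
  have [d [d0 de]] := finite_pos_lb (fun q => (He q).1).
  exists d => // Y XY; apply: UA => q; apply: (He q).2 => ai.
  exact: lt_le_trans (XY q ai) (de q).
have : nbhs X [set Y : jet | forall q, near_tensor (\val (X q)) (\val (Y q)) e].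
  apply: (nbhs_prod_box (T := fun q : 'I_p => symt R N n q.+1)
     (U := fun q => [set Y | near_tensor (\val (X q)) (\val Y) e])) => q.
  by apply/nbhs_symtP; exists e.
by apply: filterS => Y XY; exact: eA.
Qed.

Lemma continuous_symt_coord q ai : continuous (fun X : symt R N n q => \val X ai).
Proof.
move=> X A /nbhs_ballP[e /= e0 eA]; apply/nbhs_symtP; exists e => // Y XY.
by apply: eA; exact: XY.
Qed.

Lemma continuous_jet_coord q ai : continuous (fun X : jet => \val (X q) ai).
Proof.
move=> X A /nbhs_ballP[e /= e0 eA]; apply/nbhs_jetP; exists e => // Y XY.
by apply: eA; exact: XY.
Qed.

Lemma cvg_jet (Z : Type) (G : set_system Z) {FG : Filter G} (f : Z -> jet) (X : jet) :
  (forall q ai, \val (f z q) ai @[z --> G] --> \val (X q) ai) -> f @ G --> X.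
Proof.
move=> H A /nbhs_jetP[e e0 eA].
have : \forall z \near G, forall q ai, `|\val (X q) ai - \val (f z q) ai| < e.
  apply: filter_forall => q; apply: filter_forall => ai.
  by move/cvgrPdist_lt : (H q ai); exact.
by apply: filterS => z Hz; apply: eA.
Qed.

Lemma near_tensor_sym q (X Y : tensor R N n q) e :
  near_tensor X Y e -> near_tensor (sym_average X) (sym_average Y) e.
Proof.
move=> XY ai; rewrite /sym_average -mulrBr -sumrB normrM.
have q0 : 0 < q`!%:R :> R by rewrite ltr0n fact_gt0.
rewrite ger0_norm ?invr_ge0 1?ltW// ltr_pdivrMl//.
apply: le_lt_trans (ler_norm_sum _ _ _) _.
apply: (@lt_le_trans _ _ (\sum_(s : 'S_q) e)).
  apply: ltr_sum => [|s _]; last exact: XY.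
  by apply/hasP; exists 1%g; rewrite ?mem_index_enum.
by rewrite sumr_const card_Sn mulr_natl.
Qed.

Lemma continuous_sym q : continuous (@sym R N n q).
Proof.
move=> X A /nbhs_symtP[e e0 eA]; apply/nbhs_tensorP; exists e => // Y XY.
by apply: eA; exact: near_tensor_sym.
Qed.

Lemma sym_val q (X : symt R N n q) : sym (\val X) = X.
Proof.
apply/val_inj; apply/funext => -[a i]; rewrite /= /sym_average /=.
have Xs : symmetric_tensor (\val X) by exact: set_valP.
under eq_bigr do rewrite Xs.
by rewrite sumr_const card_Sn -[X in _ * X]mulr_natl mulKf// pnatr_eq0 -lt0n fact_gt0.
Qed.

Definition symt_cube q (r : R) : set (symt R N n q) :=
  [set X | forall ai, `|\val X ai| <= r].
Arguments symt_cube : clear implicits.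

Lemma compact_symt_cube q r : compact (symt_cube q r).
Proof.
pose C : set (tensor R N n q) := [set X | forall ai, `[- r, r]%classic (X ai)].
have cC : compact C.
  apply: (tychonoff (T := fun=> (R : topologicalType)) (A := fun=> `[- r, r]%classic)).
  move=> _; exact: segment_compact.
suff -> : symt_cube q r = (@sym R N n q) @` C.
  apply: continuous_compact => //; apply: continuous_subspaceT.
  exact: continuous_sym.
apply/seteqP; split => [X Xr|_ [X XC <-] ai].
  exists (\val X); last exact: sym_val.
  by move=> ai /=; rewrite in_itv/= -ler_norml; exact: Xr.
rewrite /= /sym_average normrM.
have q0 : 0 < q`!%:R :> R by rewrite ltr0n fact_gt0.
have qV : 0 <= q`!%:R^-1 :> R by rewrite invr_ge0 ltW.
rewrite (ger0_norm qV) ler_pdivrMl//.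
apply: le_trans (ler_norm_sum _ _ _) _.
apply: (@le_trans _ _ (\sum_(s : 'S_q) r)).
  apply: ler_sum => s _; have := XC (ai.1, permute s ai.2).
  by rewrite /= in_itv/= -ler_norml.
by rewrite sumr_const card_Sn mulr_natl.
Qed.

Lemma closed_symt_cube q r : closed (symt_cube q r).
Proof.
move=> X cX ai; rewrite leNgt; apply/negP => Xr.
have : nbhs X [set Y : symt R N n q | r < `|\val Y ai|].
  apply/nbhs_symtP; exists (`|\val X ai| - r); first by rewrite subr_gt0.
  move=> Y /(_ ai); have := ler_distD (\val Y ai) (\val X ai) 0.
  by rewrite !subr0 => h1 h2 /=; lra.
by move=> /cX[Y [/(_ ai)]] /=; rewrite leNgt => /negP.
Qed.

(** The cubes are compact and closed and exhaust the space, so their complements are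
    neighbourhoods of infinity. *)
Lemma continuous_opc q (phi : one_point_compactification (symt R N n q) -> R) :
  continuous (fun X : symt R N n q => phi (Some X)) ->
  (forall e, 0 < e -> exists r, forall X : symt R N n q,
     (exists ai, r < `|\val X ai|) -> `|phi (Some X) - phi None| < e) ->
  continuous phi.
Proof.
move=> c0 cinf [X|].
  by move=> A Hphi; exact: (c0 X A Hphi).
move=> A /nbhs_ballP[e /= e0 eA].
have [r Hr] := cinf _ e0.
exists (symt_cube q r).
  by split; [exact: compact_symt_cube|exact: closed_symt_cube].
move=> _ [[X nX <-]|->]; last exact/eA/ballxx.
apply: eA; rewrite /ball/= distrC; apply: Hr.
by move: nX => /existsNP[ai /negP]; rewrite -ltNge; exists ai.
Qed.

Definition sqn q (X : symt R N n q) : R := 1 + \sum_ai (\val X ai) ^+ 2.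

Lemma sqn_ge1 q (X : symt R N n q) : 1 <= sqn X.
Proof. by rewrite lerDl sumr_ge0// => ai _; exact: sqr_ge0. Qed.

Lemma sqn_gt0 q (X : symt R N n q) : 0 < sqn X.
Proof. exact: lt_le_trans ltr01 (sqn_ge1 X). Qed.

Lemma sqn_coord q (X : symt R N n q) ai : (\val X ai) ^+ 2 <= sqn X.
Proof.
rewrite /sqn (bigD1 ai)//= addrCA lerDl addr_ge0// sumr_ge0// => j _.
exact: sqr_ge0.
Qed.

Lemma continuous_sqn q : continuous (@sqn q).
Proof.
rewrite (_ : @sqn q = (cst 1 \+ (fun X => \sum_ai (\val X ai) ^+ 2))) //.
move=> X; apply: continuousD; first exact: cst_continuous.
suff H s : continuous (fun X : symt R N n q => \sum_(ai <- s) (\val X ai) ^+ 2) by exact: H.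
elim: s => [|ai s IH].
  rewrite (_ : (fun X : symt R N n q => _) = cst 0); first exact: cst_continuous.
  by apply/funext => Y; rewrite big_nil.
rewrite (_ : (fun X : symt R N n q => _) = (fun X => \val X ai ^+ 2) \+
   (fun X => \sum_(ai <- s) (\val X ai) ^+ 2)); last first.
  by apply/funext => Y; rewrite big_cons.
move=> Y; apply: continuousD; last exact: IH.
apply: (@continuous_comp _ _ _ (fun X : symt R N n q => \val X ai) (fun t : R => t ^+ 2)).
  exact: continuous_symt_coord.
exact: exprn_continuous.
Qed.

(** Coordinates of an embedding into a Euclidean space: with s = 1 + |X|^2, the
    point X is sent to (X / s^2, 1 / s) and infinity to 0. It plays the role of
    stereographic projection. *)
Definition opc_chart q (l : option ('I_N * q.-tuple 'I_n))
    (z : one_point_compactification (symt R N n q)) : R :=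
  if z is Some X then
    (if l is Some ai then \val X ai * (sqn X)^-1 ^+ 2 else (sqn X)^-1)
  else 0.

Lemma opc_chart_le q l (X : symt R N n q) : `|opc_chart l (Some X)| <= (sqn X)^-1.
Proof.
have s0 := sqn_gt0 X; have sV : 0 < (sqn X)^-1 by rewrite invr_gt0.
rewrite /opc_chart; case: l => [ai|]; last by rewrite ger0_norm// ltW.
rewrite normrM (ger0_norm (sqr_ge0 _)) expr2 mulrA ger_pMl// ler_pdivrMr// mul1r.
have := sqn_coord X ai; have := sqn_ge1 X.
rewrite -(real_normK (num_real (\val X ai))); move: `|_| (normr_ge0 (\val X ai)) (sqn X).
by move=> t t0 s s1 ts; have [t1|t1] := leP t 1; [lra|nra].
Qed.

Lemma continuous_opc_chart q l : continuous (@opc_chart q l).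
Proof.
have cV : continuous (fun X : symt R N n q => (sqn X)^-1).
  by move=> X; apply: continuousV; [rewrite gt_eqF ?sqn_gt0|exact: continuous_sqn].
apply: continuous_opc => [|e e0].
  rewrite /opc_chart; case: l => [ai|//] X.
  apply: (@continuousM _ _ (fun X : symt R N n q => \val X ai)
     (fun X : symt R N n q => (sqn X)^-1 ^+ 2)).
    exact: continuous_symt_coord.
  apply: (@continuous_comp _ _ _ (fun X : symt R N n q => (sqn X)^-1) (fun t : R => t ^+ 2)).
    exact: cV.
  exact: exprn_continuous.
exists (1 + e^-1) => X [ai Xai]; rewrite [opc_chart l None]/= subr0.
apply: le_lt_trans (opc_chart_le l X) _.
have eV : 0 < e^-1 by rewrite invr_gt0.
rewrite invf_plt ?posrE ?sqn_gt0//.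
apply: lt_le_trans (sqn_coord X ai).
rewrite -(real_normK (num_real (\val X ai))).
move: `|_| Xai => t Xt; nra.
Qed.

Lemma opc_chart_inj q z z' : (forall l, @opc_chart q l z = opc_chart l z') -> z = z'.
Proof.
have s0 (X : symt R N n q) : (sqn X)^-1 != 0 :> R by rewrite invr_neq0// gt_eqF ?sqn_gt0.
case: z z' => [X|] [Y|] H //.
- have := H None => /= /invr_inj sXY; congr Some; apply/val_inj/funext => ai.
  have := H (Some ai) => /=; rewrite sXY => /mulIf; apply.
  by rewrite expf_neq0// invr_neq0// gt_eqF ?sqn_gt0.
- by have := H None => /= /eqP; rewrite (negbTE (s0 X)).
- by have := H None => /= /esym/eqP; rewrite (negbTE (s0 Y)).
Qed.

Definition chart_index : finType := {q : 'I_p & option ('I_N * q.+1.-tuple 'I_n)}.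

Definition jet_chart (l : chart_index) (z : K) : R := opc_chart (tagged l) (z (tag l)).

Lemma continuous_jet_chart l : continuous (jet_chart l).
Proof.
move=> z.
apply: (@continuous_comp _ _ _ (fun z : K => z (tag l)) (opc_chart (tagged l))).
  exact: (@proj_continuous _ _ (tag l)).
exact: continuous_opc_chart.
Qed.

Lemma jet_chart_inj z z' : (forall l, jet_chart l z = jet_chart l z') -> z = z'.
Proof.
move=> H; apply: functional_extensionality_dep => q; apply: opc_chart_inj => l.
exact: (H (Tagged (fun q : 'I_p => option ('I_N * q.+1.-tuple 'I_n)) l)).
Qed.

Lemma compact_jet_bar : compact [set: K].
Proof.
have : compact [set f : K | forall q : 'I_p, [set: one_point_compactification (symt R N n q.+1)] (f q)].
  apply: (tychonoff (T := fun q : 'I_p => one_point_compactification (symt R N n q.+1))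
    (A := fun=> setT)) => q.
  exact: one_point_compactification_compact.
by congr compact; apply/seteqP; split.
Qed.

Lemma continuous_jet_incl : continuous (@jet_incl R N n p).
Proof.
move=> X A /nbhs_prod_fin[U [XU UA]].
have H q : nbhs X [set Y : jet | U q (Some (Y q))].
  have c1 : continuous (fun Y : jet => Y q) by exact: proj_continuous.
  have : nbhs (X q) [set Y | U q (Some Y)] := XU q.
  exact: c1.
by apply: filterS (filter_forall (nbhs_filter X) H) => Y HY; exact: UA.
Qed.

Definition finite_jet (z : K) : bool := [forall q, z q != None :> option _].
Definition finite_part (z : K) : jet := fun q => odflt (sym (fun=> 0)) (z q : option _).

Lemma finite_jetP (z : K) : finite_jet z -> jet_incl (finite_part z) = z.
Proof.
move=> /forallP zf; apply: functional_extensionality_dep => q.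
by rewrite /jet_incl /finite_part; have := zf q; case: (z q).
Qed.

Lemma finite_jet_incl (X : jet) : finite_jet (jet_incl X).
Proof. by apply/forallP. Qed.

Lemma finite_part_incl (X : jet) : finite_part (jet_incl X) = X.
Proof. exact: functional_extensionality_dep. Qed.

Definition jet_extend (phi : jet -> R) (z : K) : R :=
  if finite_jet z then phi (finite_part z) else 0.

Lemma nbhs_jet_incl (X : jet) (A : set jet) :
  nbhs X A -> nbhs (jet_incl X) (@jet_incl R N n p @` A).
Proof.
move=> /nbhs_prod_fin[U [XU UA]].
have : nbhs (jet_incl X) [set z : K | forall q, (Some @` U q) (z q)].
  apply: (nbhs_prod_box (T := fun q : 'I_p => one_point_compactification (symt R N n q.+1))
    (U := fun q => Some @` U q)) => q.
  by apply: (@filterS _ (nbhs (X q)) _ _ _ _ (XU q)) => Y UY; exists Y.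
apply: filterS => z Hz.
have zf : finite_jet z.
  by apply/forallP => q; have [Y _ <-] := Hz q.
exists (finite_part z); last exact: finite_jetP.
apply: UA => q; have [Y UY zq] := Hz q.
by rewrite /finite_part -zq.
Qed.

(** At a jet with an infinite component, nearby values of that component are infinite
    or outside of the cube of radius r, where phi vanishes. *)
Lemma continuous_jet_extend (phi : jet -> R) (r : R) : continuous phi ->
  (forall X q ai, r < `|\val (X q) ai| -> phi X = 0) ->
  continuous (jet_extend phi).
Proof.
move=> cphi phi0 z; have [zf|] := boolP (finite_jet z).
  rewrite -(finite_jetP zf) => A.
  rewrite {1}/jet_extend finite_jet_incl finite_part_incl => pA.
  have := nbhs_jet_incl (cphi _ _ pA); apply: filterS => _ [X XA <-] /=.
  by rewrite /jet_extend finite_jet_incl finite_part_incl.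
rewrite negb_forall => /existsP[q]; rewrite negbK => /eqP zq A.
have zinf : ~~ finite_jet z by rewrite negb_forall; apply/existsP; exists q; rewrite zq.
rewrite {1}/jet_extend (negbTE zinf) => A0.
have : nbhs (z q) ((Some @` (~` symt_cube q.+1 r)) `|` [set None]).
  rewrite zq; exists (symt_cube q.+1 r) => //.
  by split; [exact: compact_symt_cube|exact: closed_symt_cube].
have cq : continuous (fun z : K => z q) by exact: proj_continuous.
move/(cq z) => H.
apply: (@filterS _ (nbhs (z : K)) (nbhs_filter (z : K)) _ _ _ H) => w [[X nX Xw]|wq] /=.
  rewrite /jet_extend; case: ifPn => [wf|_]; last exact: nbhs_singleton.
  have /existsNP[ai /negP] := nX; rewrite -ltNge => Xr.
  rewrite (phi0 _ q ai); first exact: nbhs_singleton.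
  by rewrite /finite_part -Xw.
rewrite /jet_extend ifF; first exact: nbhs_singleton.
by apply/negbTE; rewrite negb_forall; apply/existsP; exists q; rewrite wq.
Qed.

End jets.

(** * Partitions of unity on a compact space with finitely many charts *)

Section continuous_functions_on_compact.
Context (R : realType) (K : ptopologicalType) (cK : compact [set: K]).
Context (L : finType) (g : L -> K -> R).
Hypothesis cg : forall l, continuous (g l).
Hypothesis ginj : forall z w, (forall l, g l z = g l w) -> z = w.

Definition chart_dist (z w : K) : R := \sum_l `|g l z - g l w|.

Lemma continuous_bigsum (Z : topologicalType) (J : Type) (s : seq J) (f : J -> Z -> R) :
  (forall j, continuous (f j)) -> continuous (fun z => \sum_(j <- s) f j z).
Proof.
move=> cf; elim: s => [|j s IH].
  rewrite (_ : (fun z : Z => _) = cst 0); first exact: cst_continuous.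
  by apply/funext => y; rewrite big_nil.
rewrite (_ : (fun z : Z => _) = f j \+ (fun z => \sum_(j <- s) f j z)); last first.
  by apply/funext => y; rewrite big_cons.
by move=> y; apply: continuousD; [exact: cf|exact: IH].
Qed.

Lemma continuous_normr (Z : topologicalType) (f : Z -> R) :
  continuous f -> continuous (fun z => `|f z|).
Proof.
move=> cf z; apply: (@continuous_comp _ _ _ f (fun t : R => `|t|)); first exact: cf.
exact: norm_continuous.
Qed.

Lemma continuous_sub (Z : topologicalType) (f h : Z -> R) :
  continuous f -> continuous h -> continuous (fun z => f z - h z).
Proof. by move=> cf ch z; apply: continuousB; [exact: cf|exact: ch]. Qed.

Lemma continuous_compo (Z Y X : topologicalType) (f : Z -> Y) (h : Y -> X) :
  continuous f -> continuous h -> continuous (fun z => h (f z)).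
Proof. by move=> cf ch z; apply: continuous_comp; [exact: cf|exact: ch]. Qed.

(** Uniform continuity: the pairs of points at which Psi differs by at least e form
    a compact set disjoint from the diagonal, so the distance has a positive
    minimum on it. *)
Lemma chart_dist_modulus (Psi : K -> R) (e : R) : continuous Psi -> 0 < e ->
  exists2 d, 0 < d & forall z w, chart_dist z w < d -> `|Psi z - Psi w| < e.
Proof.
move=> cPsi e0.
have c1 (h : K -> R) : continuous h -> continuous (fun x : K * K => h x.1).
  by move=> ch; apply: (continuous_compo (f := fst)) ch => x; exact: cvg_fst.
have c2 (h : K -> R) : continuous h -> continuous (fun x : K * K => h x.2).
  by move=> ch; apply: (continuous_compo (f := snd)) ch => x; exact: cvg_snd.
pose D (x : K * K) := `|Psi x.1 - Psi x.2|.
have cD : continuous D.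
  by apply/continuous_normr/continuous_sub; [exact: c1|exact: c2].
pose C := D @^-1` [set t | e <= t].
have clC : closed C.
  by apply: closed_comp => [x _|]; [exact: cD|exact: closed_ge].
have cptC : compact C.
  apply: (subclosed_compact clC) (_ : C `<=` [set: K] `*` [set: K]); last by [].
  exact: compact_setX.
have [C0|/set0P C0] := eqVneq C set0.
  exists 1 => // z w _; rewrite ltNge; apply/negP => h.
  by have : C (z, w) by []; rewrite C0.
have cd : continuous (fun x : K * K => chart_dist x.1 x.2).
  apply: continuous_bigsum => l; apply/continuous_normr/continuous_sub.
    exact: c1.
  exact: c2.
have [c /set_mem cC cmin] := compact_EVT_min C0 cptC (continuous_subspaceT cd).
exists (chart_dist c.1 c.2).
  rewrite lt_neqAle sumr_ge0// andbT; apply/negP => /eqP/esym d0.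
  have E : c.1 = c.2.
    apply: ginj => l; apply/eqP; rewrite -subr_eq0 -normr_eq0; apply/eqP.
    have := psumr_eq0P (P := xpredT) (fun l _ => normr_ge0 (g l c.1 - g l c.2)) d0.
    exact.
  by move: cC; rewrite /C /D /= E subrr normr0 leNgt e0.
move=> z w zw; rewrite ltNge; apply/negP => h.
have := cmin (z, w) (mem_set (h : C (z, w))).
by rewrite leNgt zw.
Qed.

Lemma exists_net (m : nat) : exists s : seq K,
  forall z, exists2 w, w \in s & chart_dist z w < m.+1%:R^-1.
Proof.
have := cK; rewrite compact_cover => /(_ _ [set: K]
  (fun w => [set z | chart_dist z w < m.+1%:R^-1])).
case.
- move=> w _.
  apply: (@open_comp _ _ (chart_dist^~ w) [set t | t < m.+1%:R^-1]) => [z _|]; last exact: open_lt.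
  apply: continuous_bigsum => l; apply/continuous_normr/continuous_sub => //.
  exact: cst_continuous.
- move=> z _; exists z => //=; rewrite /chart_dist big1 ?invr_gt0// => l _.
  by rewrite subrr normr0.
- move=> D _ Dcov; exists (enum_fset D) => z.
  by have [w Dw zw] := Dcov z I; exists w.
Qed.

Definition net (m : nat) : seq K := projT1 (cid (exists_net m)).

Lemma netP m z : exists2 w, w \in net m & chart_dist z w < m.+1%:R^-1.
Proof. exact: (projT2 (cid (exists_net m))). Qed.

Definition net_pt (m : nat) (i : 'I_(size (net m))) : K := tnth (in_tuple (net m)) i.

Definition net_bump (m : nat) (i : 'I_(size (net m))) (z : K) : R :=
  Num.max 0 (m.+1%:R^-1 - chart_dist z (net_pt i)).

(** Each point is within 1 / (m + 1) of the net, so some bump is positive there and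
    the denominator does not vanish. *)
Definition net_part (m : nat) (i : 'I_(size (net m))) (z : K) : R :=
  net_bump i z / \sum_j net_bump (m := m) j z.

Lemma net_bump_ge0 m i z : 0 <= @net_bump m i z.
Proof. by rewrite le_max lexx. Qed.

Lemma net_bump_sum_gt0 m z : 0 < \sum_j @net_bump m j z.
Proof.
have [w wn zw] := netP m z.
have /tnthP[i wi] : w \in in_tuple (net m) by [].
rewrite (bigD1 i)//= ltr_pwDl//; last by apply: sumr_ge0 => j _; exact: net_bump_ge0.
by rewrite /net_bump lt_max subr_gt0 /net_pt -wi zw orbT.
Qed.

Lemma continuous_net_bump m i : continuous (@net_bump m i).
Proof.
pose h (z : K) := m.+1%:R^-1 - chart_dist z (net_pt i) : R.
have ch : continuous h.
  apply: (@continuous_sub _ (cst _)); first exact: cst_continuous.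
  apply: continuous_bigsum => l; apply/continuous_normr/continuous_sub => //.
  exact: cst_continuous.
move=> z; have := @continuous_max _ _ (cst (0 : R)) h z.
apply; [exact: cst_continuous|exact: ch].
Qed.

Lemma continuous_net_part m i : continuous (@net_part m i).
Proof.
move=> z; apply: continuousM; first exact: continuous_net_bump.
apply: continuousV; first by rewrite gt_eqF ?net_bump_sum_gt0.
by apply: continuous_bigsum => j; exact: continuous_net_bump.
Qed.

Lemma net_part_ge0 m i z : 0 <= @net_part m i z.
Proof. by rewrite divr_ge0 ?net_bump_ge0// ltW// net_bump_sum_gt0. Qed.

Lemma net_part_sum m z : \sum_i @net_part m i z = 1.
Proof. by rewrite -mulr_suml divff// gt_eqF// net_bump_sum_gt0. Qed.

Definition net_interp (m : nat) (Psi : K -> R) (z : K) : R :=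
  \sum_i Psi (net_pt i) * @net_part m i z.

(** At z the interpolant is a mean of values of Psi at nodes near z. *)
Lemma net_interp_near (m : nat) (Psi : K -> R) (e d : R) :
  (forall z w, chart_dist z w < d -> `|Psi z - Psi w| < e) -> m.+1%:R^-1 <= d ->
  forall z, `|Psi z - net_interp m Psi z| <= e.
Proof.
move=> Pd md z.
rewrite -[Psi z]mulr1 -(net_part_sum m z) mulr_sumr -sumrB.
apply: le_trans (ler_norm_sum _ _ _) _.
rewrite -[leRHS]mulr1 -(net_part_sum m z) mulr_sumr; apply: ler_sum => i _.
rewrite -mulrBl normrM (ger0_norm (net_part_ge0 _ _)).
have [d_lt|d_ge] := ltP (chart_dist z (net_pt i)) m.+1%:R^-1.
  apply: ler_wpM2r; first exact: net_part_ge0.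
  by apply/ltW/Pd; exact: lt_le_trans md.
suff -> : net_part i z = 0 by rewrite !mulr0.
by rewrite /net_part /net_bump max_l ?mul0r// subr_le0.
Qed.

Lemma net_interp_cvg (Psi : K -> R) (e : R) : continuous Psi -> 0 < e ->
  \forall m \near \oo, forall z, `|Psi z - net_interp m Psi z| <= e.
Proof.
move=> cPsi e0; have [d d0 Pd] := chart_dist_modulus cPsi e0.
near=> m; apply: (net_interp_near Pd); apply: ltW.
by near: m; exact: near_infty_natSinv_lt (PosNum d0).
Unshelve. all: by end_near. Qed.

Lemma compact_fun_bounded (Psi : K -> R) : continuous Psi ->
  exists C, forall z, `|Psi z| <= C.
Proof.
move=> cPsi.
have [c _ cmax] := compact_EVT_max (ex_intro _ point I : [set: K] !=set0) cK
  (continuous_subspaceT (continuous_normr cPsi)).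
by exists `|Psi c| => z; apply: cmax; rewrite inE.
Qed.

End continuous_functions_on_compact.

(** * Young measures tested against separated functions *)

Section probability_integral.
Context (R : realType) (K : ptopologicalType) (cK : compact [set: K]).
Implicit Types (theta : probability (borel K) R) (Psi : K -> R).

Lemma continuous_integrable theta Psi : continuous Psi ->
  theta.-integrable [set: borel K] (EFin \o (Psi : borel K -> R)).
Proof.
move=> cPsi; have [C HC] := compact_fun_bounded cK cPsi.
apply: (bounded_integrable (C := C)) => //.
  by apply: (@le_lt_trans _ _ 1%E); [exact: probability_le1|exact: ltry].
exact: measurable_continuous_borel.
Qed.

Lemma prob_int_cst theta (c : R) : \int[theta]_z c = c.
Proof.
rewrite Rintegral_cst// -[RHS]mulr1; congr (_ * _).
exact: (congr1 fine (probability_setT theta)).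
Qed.

Lemma prob_int_le theta Psi Psi' : continuous Psi -> continuous Psi' ->
  (forall z, Psi z <= Psi' z) -> \int[theta]_z Psi z <= \int[theta]_z Psi' z.
Proof. by move=> c c' h; apply: le_Rintegral => //; exact: continuous_integrable. Qed.

Lemma prob_int_bound theta Psi C : continuous Psi -> (forall z, `|Psi z| <= C) ->
  `|\int[theta]_z Psi z| <= C.
Proof.
move=> cPsi HC; apply: le_trans (le_normr_Rintegral _ (continuous_integrable theta cPsi)) _ => //.
rewrite -[leRHS](prob_int_cst theta C).
apply: prob_int_le => //; [exact: continuous_normr|exact: cst_continuous].
Qed.

Lemma prob_int_sub theta Psi Psi' : continuous Psi -> continuous Psi' ->
  \int[theta]_z (Psi z - Psi' z) = \int[theta]_z Psi z - \int[theta]_z Psi' z.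
Proof. by move=> c c'; rewrite RintegralB//; exact: continuous_integrable. Qed.

Lemma prob_int_sum theta (s : Type) (l : seq s) (c : s -> R) (f : s -> K -> R) :
  (forall j, continuous (f j)) ->
  \int[theta]_z (\sum_(j <- l) c j * f j z) = \sum_(j <- l) c j * \int[theta]_z f j z.
Proof.
move=> cf; elim: l => [|j l IH].
  by rewrite big_nil; under eq_Rintegral do rewrite big_nil; exact: prob_int_cst.
rewrite big_cons -IH; under eq_Rintegral do rewrite big_cons.
have cc i : continuous (fun z => c i * f i z).
  by move=> z; apply: (@continuousM _ _ (cst (c i))); [exact: cst_continuous|exact: cf].
rewrite RintegralD//; [congr (_ + _)|exact: continuous_integrable|].
  by rewrite RintegralZl//; exact: continuous_integrable.
apply: continuous_integrable; exact: continuous_bigsum.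
Qed.

Lemma prob_int_dirac (v : K) Psi : continuous Psi ->
  \int[\d_(v : borel K)]_z Psi z = Psi v.
Proof.
move=> cPsi; rewrite /Rintegral integral_dirac//; last first.
  by apply/measurable_EFinP; apply: measurable_continuous_borel.
by rewrite diracT mul1e.
Qed.

End probability_integral.

Section sup_norm.
Context (R : realType) (K : ptopologicalType) (cK : compact [set: K]).
Implicit Types Psi : K -> R.

Definition nrm Psi : R := fine (supnorm Psi).

Lemma supnorm_ge0 Psi : (0%E <= supnorm Psi)%E.
Proof.
apply: (@le_trans _ _ `|Psi point|%:E); first by rewrite lee_fin.
by apply: ereal_sup_ubound; exists point.
Qed.

Lemma supnormE Psi : continuous Psi -> supnorm Psi = (nrm Psi)%:E.
Proof.
move=> cPsi; rewrite fineK// ge0_fin_numE ?supnorm_ge0//.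
have [C HC] := compact_fun_bounded cK cPsi.
apply: (@le_lt_trans _ _ C%:E); last exact: ltry.
by apply: ge_ereal_sup => _ [z _ <-]; rewrite lee_fin.
Qed.

Lemma nrm_ge Psi z : continuous Psi -> `|Psi z| <= nrm Psi.
Proof.
by move=> cPsi; rewrite -lee_fin -supnormE//; apply: ereal_sup_ubound; exists z.
Qed.

Lemma nrm_le Psi C : continuous Psi -> (forall z, `|Psi z| <= C) -> nrm Psi <= C.
Proof.
move=> cPsi HC; rewrite -lee_fin -supnormE//.
by apply: ge_ereal_sup => _ [z _ <-]; rewrite lee_fin.
Qed.

Lemma nrm_ge0 Psi : continuous Psi -> 0 <= nrm Psi.
Proof. by move=> cPsi; exact: le_trans (normr_ge0 _) (nrm_ge point cPsi). Qed.
End sup_norm.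

Lemma measurable_truncate d (T : measurableType d) (R : realType) (D : set T)
    (b : T -> R) (c : R) : measurable_fun D b ->
  measurable_fun D (fun x => b x * \1_[set y | y <= c] `|b x|).
Proof.
move=> mb; apply: measurable_funM => //.
apply: (@measurableT_comp _ _ _ T R R (\1_[set y : R | y <= c])).
  apply: measurable_indic.
  rewrite (_ : [set y : R | _] = [set` `]-oo, c]]); first exact: measurable_itv.
  by rewrite set_itvE.
exact: measurableT_comp.
Qed.

Lemma measurable_trunc_code d (T : measurableType d) (R : realType) (D : set T)
    (g : T -> R) (q : nat) (j : 'I_q.+1) : measurable D -> measurable_fun D g ->
  measurable (D `&` [set x : T | inord (Num.truncn (g x)) = j]).
Proof.
move=> mD mg.
rewrite (_ : [set x : T | _] = g @^-1` [set y : R | inord (Num.truncn y) = j])//.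
apply: mg => //.
rewrite (_ : [set y : R | _] = \bigcup_(l in [set l : nat | inord l = j])
   ((if l == 0%N then [set` `]-oo, 0[] else set0) `|` [set` `[l%:R, l.+1%:R[])).
  apply: bigcup_measurable => l _; apply: measurableU; last exact: measurable_itv.
  by case: ifP => _; [exact: measurable_itv|exact: measurable0].
apply/seteqP; split => [y /= yj|y [l /= lj]].
  exists (Num.truncn y) => //; have [y0|y0] := leP 0 y.
    by right; rewrite /= in_itv/= truncn_itv.
  left; rewrite (_ : Num.truncn y = 0%N) /= ?in_itv//.
  by apply/truncn0Pn; rewrite -ltNge (lt_trans y0).
case=> /=; last first.
  rewrite in_itv/= => /andP[h1 h2]; rewrite -[in RHS]lj; congr inord.
  by apply/eqP; rewrite truncn_eq ?h1 ?h2// (le_trans _ h1).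
case: eqP => // l0 /=; rewrite in_itv/= => y0; rewrite -lj l0; congr inord.
by apply/truncn0Pn; rewrite -ltNge (lt_trans y0).
Qed.

Lemma near_cube (R : realType) n (x : 'rV[R]_n) : \forall k \near \oo, cube k x.
Proof.
by have [k hk] := cube_cover x; exists k.
Qed.

Section young_tests.
Context (R : realType) (n : nat) (Omega : set 'rV[R]_n).
Local Notation V := 'rV[R]_n.
Local Notation T := (leb_type R n).
Local Notation lambda := (lebesgue R n).
Hypothesis mO : measurable (Omega : set T).
Context (K : ptopologicalType) (cK : compact [set: K]).
Context (sz : nat -> nat) (pt : forall m, 'I_(sz m) -> K)
  (part : forall m, 'I_(sz m) -> K -> R).
Hypothesis cpart : forall m i, continuous (@part m i).
Hypothesis part_ge0 : forall m i z, 0 <= @part m i z.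
Hypothesis part_sum : forall m z, \sum_i @part m i z = 1.
Let interp m (Psi : K -> R) (z : K) : R := \sum_i Psi (pt i) * @part m i z.
Hypothesis interp_near : forall (Psi : K -> R) e, continuous Psi -> 0 < e ->
  \forall m \near \oo, forall z, `|Psi z - interp m Psi z| <= e.

Lemma continuous_interp m Psi : continuous (interp m Psi).
Proof.
apply: continuous_bigsum => i z; apply: (@continuousM _ _ (cst (Psi (pt i)))).
  exact: cst_continuous.
exact: cpart.
Qed.

Lemma interp_le m Psi C z : (forall i : 'I_(sz m), `|Psi (pt i)| <= C) ->
  `|interp m Psi z| <= C.
Proof.
move=> HC; apply: le_trans (ler_norm_sum _ _ _) _.
rewrite -[leRHS]mulr1 -(part_sum m z) mulr_sumr; apply: ler_sum => i _.
by rewrite normrM (ger0_norm (part_ge0 _ _)) ler_wpM2r.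
Qed.

Definition net_max m (Psi : K -> R) : R := \big[Num.max/0]_i `|Psi (@pt m i)|.

(** It exhibits the supremum norm as a limit of maxima over finite sets, whence its
    measurability in x. *)
Lemma net_max_cvg Psi : continuous Psi ->
  net_max m Psi @[m --> \oo] --> nrm Psi.
Proof.
move=> cPsi; apply/cvgrPdist_le => e e0.
apply: filterS (interp_near cPsi e0) => m He.
have max_le : net_max m Psi <= nrm Psi.
  by apply: bigmax_le => [|i _]; [exact: nrm_ge0|exact: nrm_ge].
rewrite ger0_norm ?subr_ge0// lerBlDr.
apply: nrm_le => // z; rewrite -[Psi z](subrK (interp m Psi z)).
apply: le_trans (ler_normD _ _) _; apply: lerD; first exact: He.
by apply: interp_le => i; exact: le_bigmax_cond.
Qed.

Lemma measurable_nrm (Phi : V -> K -> R) :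
  (forall x, Omega x -> continuous (Phi x)) ->
  (forall z, measurable_fun (Omega : set T) (fun x : T => Phi x z)) ->
  measurable_fun (Omega : set T) (fun x : T => nrm (Phi x)).
Proof.
move=> cPhi mPhi.
apply: (@measurable_fun_cvg _ T R (Omega : set T) (fun m (x : T) => net_max m (Phi x))).
  move=> m; apply: (@measurable_bigmax _ T R _ _ _ (fun i (x : T) => `|Phi x (@pt m i)|)).
  by move=> i; apply: (@measurable_fun_norm _ T R).
by move=> x Ox; exact: net_max_cvg (cPhi x Ox).
Qed.

(** Measurability for each fixed second argument, in place of approximation by
    simple maps. The two notions of integrability agree on a compact space with
    interpolations (L1C0_admissible and L1C0_of_admissible), and this one is
    easy to verify. *)
Definition admissible (Phi : V -> K -> R) : Prop :=
  [/\ forall x, Omega x -> continuous (Phi x),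
      forall z, measurable_fun (Omega : set T) (fun x : T => Phi x z) &
      lambda.-integrable (Omega : set T) (EFin \o (fun x : T => nrm (Phi x)))].

Lemma admissible_dom (Phi : V -> K -> R) (B : V -> R) :
  (forall x, Omega x -> continuous (Phi x)) ->
  (forall z, measurable_fun (Omega : set T) (fun x : T => Phi x z)) ->
  lambda.-integrable (Omega : set T) (EFin \o (B : T -> R)) ->
  (forall x z, Omega x -> `|Phi x z| <= B x) -> admissible Phi.
Proof.
move=> cPhi mPhi iB PB; split => //.
have mn := measurable_nrm cPhi mPhi.
apply: (@le_integrable _ T R lambda _ mO _ (EFin \o (B : T -> R))) => //.
  exact/measurable_EFinP.
move=> x Ox /=; rewrite lee_fin ger0_norm; last exact/nrm_ge0/cPhi.
apply: le_trans (ler_norm _).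
by apply: nrm_le => [//||z]; [exact: cPhi|exact: PB].
Qed.

Lemma L1C0_admissible Phi : L1C0 Omega Phi -> admissible Phi.
Proof.
move=> [cPhi [s [ss sPhi]] iPhi].
have mPhi z : measurable_fun (Omega : set T) (fun x : T => Phi x z).
  apply: (@lebesgue_measurable_ae_cvg R n _ (fun k (x : T) => s k x z) _ mO).
    move=> k; have [cs fs ms] := ss k.
    move=> _ B mB.
    rewrite (_ : _ `&` _ = \bigcup_(Psi in (s k @` Omega) `&` [set Psi | B (Psi z)])
        (Omega `&` s k @^-1` [set Psi])).
      apply: fin_bigcup_measurable => [|Psi _]; last exact: ms.
      exact: finite_setIl.
    apply/seteqP; split => [x [Ox Bx]|x [Psi [_ /= BPsi] [Ox sx]]]; last first.
      by split => //; rewrite /preimage/= sx.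
    by exists (s k x) => //; split => //; exists x.
  apply: ae_mono sPhi => x H Ox; have {}H := H Ox.
  apply/cvgrPdist_le => e e0.
  have /fine_cvgP[_ /cvgrPdist_lt/(_ _ e0)] := H.
  apply: filterS => k; rewrite sub0r normrN /= => /ltW; apply: le_trans.
  have c : continuous (fun z => Phi x z - s k x z).
    by apply: continuous_sub; [exact: cPhi|have [cs _ _] := ss k; exact: cs].
  exact: le_trans (nrm_ge cK z c) (ler_norm _).
split => //; apply/integrableP; split.
  exact/measurable_EFinP/measurable_nrm.
rewrite (_ : (\int[_]_(x in _) _)%E = (\int[lambda]_(x in (Omega : set T)) supnorm (Phi x))%E) //.
apply: eq_integral => x /set_mem Ox /=.
by rewrite ger0_norm ?(supnormE cK (cPhi x Ox))//; exact/nrm_ge0/cPhi.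
Qed.

Lemma admissible_near (Phi : V -> K -> R) x e : admissible Phi -> Omega x -> 0 < e ->
  \forall m \near \oo, forall z, `|Phi x z - interp m (Phi x) z| <= e.
Proof. by move=> [cPhi _ _] Ox; apply: interp_near; exact: cPhi. Qed.

(** Integrals of arbitrary continuous functions are limits of finite combinations of
    integrals of the partition functions. *)
Lemma young_int_cvg (theta : probability (borel K) R) (Psi : K -> R) : continuous Psi ->
  \sum_(i < sz m) Psi (pt i) * \int[theta]_z part i z @[m --> \oo] -->
  \int[theta]_z Psi z.
Proof.
move=> cPsi; apply/cvgrPdist_le => e e0.
apply: filterS (interp_near cPsi e0) => m He.
rewrite -prob_int_sum// -prob_int_sub//; last exact: continuous_interp.
apply: prob_int_bound => //.
by apply: continuous_sub => //; exact: continuous_interp.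
Qed.

Lemma measurable_young_int (theta : young_map R n K) (Phi : V -> K -> R) :
  young Omega theta -> (forall x, Omega x -> continuous (Phi x)) ->
  (forall z, measurable_fun (Omega : set T) (fun x : T => Phi x z)) ->
  measurable_fun (Omega : set T) (fun x : T => \int[theta x]_z Phi x z).
Proof.
move=> ytheta cPhi mPhi.
apply: (@measurable_fun_cvg _ T R (Omega : set T)
  (fun m (x : T) => \sum_(i < sz m) Phi x (pt i) * \int[theta x]_z part i z)).
  move=> m; apply: (@measurable_sum _ T R (Omega : set T) _ _
    (fun i (x : T) => Phi x (@pt m i) * \int[theta x]_z part i z)) => i.
  apply: (@measurable_funM _ T R); first exact: mPhi.
  exact: ytheta.
by move=> x Ox; apply: young_int_cvg; exact: cPhi.
Qed.

Lemma integrable_young_int (theta : young_map R n K) (Phi : V -> K -> R) :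
  young Omega theta -> admissible Phi ->
  lambda.-integrable (Omega : set T) (EFin \o (fun x : T => \int[theta x]_z Phi x z)).
Proof.
move=> ytheta [cPhi mPhi iPhi].
apply: (@le_integrable _ T R lambda _ mO _ (EFin \o (fun x : T => nrm (Phi x)))) => //.
  by apply/measurable_EFinP; exact: measurable_young_int.
move=> x Ox /=; rewrite lee_fin; apply: le_trans (ler_norm _).
apply: prob_int_bound => [//||z]; first exact: cPhi.
by apply: nrm_ge => //; exact: cPhi.
Qed.

Lemma young_pairing_close (theta : young_map R n K) (Phi Phi' : V -> K -> R) (B : V -> R) :
  young Omega theta -> admissible Phi -> admissible Phi' ->
  lambda.-integrable (Omega : set T) (EFin \o (B : T -> R)) ->
  (forall x z, Omega x -> `|Phi x z - Phi' x z| <= B x) ->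
  `|young_pairing Omega theta Phi - young_pairing Omega theta Phi'| <=
    \int[lambda]_(x in (Omega : set T)) B x.
Proof.
move=> yt aP aP' iB PB.
have i1 := integrable_young_int yt aP; have i2 := integrable_young_int yt aP'.
rewrite /young_pairing -(RintegralB mO i1 i2).
have iD := integrable_EFinB mO i1 i2.
apply: le_trans (le_normr_Rintegral mO iD) _.
apply: (le_Rintegral mO _ iB); first exact: (integrable_norm iD).
move=> x Ox; have [cP _ _] := aP; have [cP' _ _] := aP'.
rewrite -prob_int_sub//; [|exact: cP|exact: cP'].
apply: prob_int_bound => [//||z]; last exact: PB.
by apply: continuous_sub; [exact: cP|exact: cP'].
Qed.

(** Convergence survives a uniform error e on both the sequence and its limit, if e
    is arbitrary. *)
Lemma approx_cvg (P_ : nat -> R) (P : R) :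
  (forall e, 0 < e -> exists2 Q : nat -> R, exists2 q, Q k @[k --> \oo] --> q &
     `|P - q| <= e & forall k, `|P_ k - Q k| <= e) ->
  P_ k @[k --> \oo] --> P.
Proof.
move=> H; apply/cvgrPdist_le => e e0.
have e3 : 0 < e / 3 by rewrite divr_gt0.
have [Q [q Qq Pq] PQ] := H _ e3.
move/cvgrPdist_le : Qq => /(_ _ e3); apply: filterS => k Qk.
have := PQ k; have := Pq; have := Qk.
move: (P_ k) (Q k) => u w; rewrite !ler_norml => /andP[? ?] /andP[? ?] /andP[? ?].
by apply/andP; split; lra.
Qed.

Definition separated_test (b : V -> R) m (i : 'I_(sz m)) : V -> K -> R :=
  fun x z => b x * part i z.

Lemma separated_admissible (b : V -> R) m (i : 'I_(sz m)) :
  lambda.-integrable (Omega : set T) (EFin \o (b : T -> R)) ->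
  admissible (separated_test b i).
Proof.
move=> ib; have mb : measurable_fun (Omega : set T) (b : T -> R).
  by apply/measurable_EFinP; case/integrableP : ib.
apply: (admissible_dom (B := fun x => `|b x|)).
- move=> x _ z; apply: (@continuousM _ _ (cst (b x))); first exact: cst_continuous.
  exact: cpart.
- move=> z; apply: (@measurable_funM _ T R) => //; exact: measurable_cst.
- exact: (integrable_norm ib).
- move=> x z _; rewrite /separated_test normrM ler_piMr//.
  rewrite ger0_norm// -(part_sum m z) (bigD1 i)//= lerDl.
  by apply: sumr_ge0.
Qed.

Definition cube_cut (k : nat) (b : V -> R) : V -> R := fun x => b x * \1_(cube k) x.

Lemma cut_integrable k (b : V -> R) (C : R) :
  measurable_fun (Omega : set T) (b : T -> R) ->
  (forall x, Omega x -> `|b x| <= C) ->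
  lambda.-integrable (Omega : set T) (EFin \o (cube_cut k b : T -> R)).
Proof.
move=> mb bC; apply: (@integrable_cut _ T R lambda _ mO (cube k) b C) => //.
  exact: measurable_cube.
exact: cubeI_lty.
Qed.

Lemma part_le1 m (i : 'I_(sz m)) z : part i z <= 1.
Proof. by rewrite -(part_sum m z) (bigD1 i)//= lerDl; apply: sumr_ge0. Qed.

Section determined.
Context (a : nat -> V -> R).
Hypothesis ma : forall j, measurable_fun (Omega : set T) (a j : T -> R).
Hypothesis a1 : forall j x, `|a j x| <= 1.
Hypothesis a_dense : forall b : V -> R, measurable_fun (Omega : set T) (b : T -> R) ->
  (forall x, Omega x -> `|b x| <= 1) ->
  exists j_ : nat -> nat,
    {ae lambda, forall x, Omega x -> a (j_ l) x @[l --> \oo] --> b x}.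
Context (theta_ : nat -> young_map R n K) (theta : young_map R n K).
Hypotheses (ytheta_ : forall l, young Omega (theta_ l)) (ytheta : young Omega theta).
Hypothesis theta_cvg : forall k j m (i : 'I_(sz m)),
  young_pairing Omega (theta_ l) (separated_test (cube_cut k (a j)) i) @[l --> \oo] -->
  young_pairing Omega theta (separated_test (cube_cut k (a j)) i).

Let cvg_at (Phi : V -> K -> R) :=
  young_pairing Omega (theta_ l) Phi @[l --> \oo] --> young_pairing Omega theta Phi.

(** The total mass of the measures is 1, so a test that is approximated in the mean
    of the supremum norm has pairings approximated uniformly in the sequence. *)
Lemma cvg_at_approx (Phi : V -> K -> R) (Phi_ : nat -> V -> K -> R)
    (B : nat -> V -> R) (g : V -> R) :
  admissible Phi -> (forall m, admissible (Phi_ m)) -> (forall m, cvg_at (Phi_ m)) ->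
  (forall m, measurable_fun (Omega : set T) (B m : T -> R)) ->
  lambda.-integrable (Omega : set T) (EFin \o (g : T -> R)) ->
  (forall m x, Omega x -> `|B m x| <= g x) ->
  {ae lambda, forall x, Omega x -> B m x @[m --> \oo] --> 0} ->
  (forall m x z, Omega x -> `|Phi x z - Phi_ m x z| <= B m x) -> cvg_at Phi.
Proof.
move=> aP aP_ cP_ mB ig Bg B0 PB.
have IB : \int[lambda]_(x in (Omega : set T)) B m x @[m --> \oo] --> (0 : R).
  rewrite [X in _ --> X](_ : 0 = \int[lambda]_(x in (Omega : set T)) cst 0 x); last first.
    by rewrite /Rintegral integral0.
  exact: (@dominated_Rintegral_cvg _ T R lambda Omega (fun m (x : T) => B m x) (cst 0) g
    mO mB (measurable_cst _) B0 ig Bg).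
apply: approx_cvg => e e0.
move/cvgrPdist_le : IB => /(_ _ e0)[m _ /(_ m (leqnn _))].
rewrite /= sub0r normrN => /(le_trans (ler_norm _)) Bm.
have iB : lambda.-integrable (Omega : set T) (EFin \o (B m : T -> R)).
  apply: (@le_integrable _ T R lambda _ mO _ (EFin \o (g : T -> R)) _ _ ig).
    exact/measurable_EFinP/mB.
  by move=> x Ox /=; rewrite lee_fin; apply: le_trans (Bg m x Ox) (ler_norm _).
have close (th : young_map R n K) : young Omega th ->
    `|young_pairing Omega th Phi - young_pairing Omega th (Phi_ m)| <= e.
  move=> yth; apply: le_trans Bm.
  exact: (young_pairing_close yth aP (aP_ m) iB (PB m)).
exists (fun l => young_pairing Omega (theta_ l) (Phi_ m)).
  exists (young_pairing Omega theta (Phi_ m)); first exact: cP_.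
  exact: close.
by move=> l; exact: close.
Qed.

Lemma separated_dist (b b' : V -> R) m (i : 'I_(sz m)) x z :
  `|separated_test b i x z - separated_test b' i x z| <= `|b x - b' x|.
Proof.
rewrite /separated_test -mulrBl normrM (ger0_norm (part_ge0 _ _)).
by rewrite ler_piMr// part_le1.
Qed.

Lemma cvg_at_cut1 k (b : V -> R) m (i : 'I_(sz m)) :
  measurable_fun (Omega : set T) (b : T -> R) ->
  (forall x, Omega x -> `|b x| <= 1) -> cvg_at (separated_test (cube_cut k b) i).
Proof.
move=> mb b1; have [j_ jb] := a_dense mb b1.
have ia l := cut_integrable k (ma (j_ l)) (fun x _ => a1 (j_ l) x).
have ib := cut_integrable k mb b1.
have i2 : lambda.-integrable (Omega : set T) (EFin \o (cube_cut k (cst 2) : T -> R)).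
  apply: (cut_integrable k (C := 2)); first exact: measurable_cst.
  by move=> x _; rewrite ger0_norm.
apply: (cvg_at_approx (Phi_ := fun l => separated_test (cube_cut k (a (j_ l))) i)
  (B := fun l (x : V) => `|cube_cut k b x - cube_cut k (a (j_ l)) x|) _ _ _ _ i2).
- exact: separated_admissible.
- by move=> l; apply: separated_admissible; exact: ia.
- by move=> l; exact: theta_cvg.
- move=> l; apply/measurable_EFinP.
  by have /integrable_norm/integrableP[] := integrable_EFinB mO ib (ia l).
- move=> l x Ox; rewrite normr_id /cube_cut -mulrBl normrM.
  rewrite (ger0_norm (_ : 0 <= \1_(cube k) x)); last by rewrite indicE ler0n.
  apply: ler_wpM2r; first by rewrite indicE ler0n.
  apply: le_trans (ler_normB _ _) _.
  by rewrite -[leRHS]/(2 : R) (_ : 2 = 1 + 1)// lerD// ?a1// b1.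
- apply: ae_mono jb => x H Ox; rewrite /cube_cut.
  have -> : (0 : R) = `|b x * \1_(cube k) x - b x * \1_(cube k) x|.
    by rewrite subrr normr0.
  apply: cvg_norm; apply: cvgB; first exact: cvg_cst.
  by apply: cvgM; [exact: H|exact: cvg_cst].
- by move=> l x z _; exact: separated_dist.
Qed.

Lemma cvg_at_cut k (b : V -> R) m (i : 'I_(sz m)) (C : R) :
  measurable_fun (Omega : set T) (b : T -> R) -> 0 < C ->
  (forall x, Omega x -> `|b x| <= C) -> cvg_at (separated_test (cube_cut k b) i).
Proof.
move=> mb C0 bC.
have mb' : measurable_fun (Omega : set T) (fun x : T => b x * C^-1).
  by apply: (@measurable_funM _ T R) => //; exact: measurable_cst.
have b1 x : Omega x -> `|b x * C^-1| <= 1.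
  by move=> Ox; rewrite normrM normfV (gtr0_norm C0) ler_pdivrMr// mul1r bC.
have scale (th : young_map R n K) : young Omega th ->
    young_pairing Omega th (separated_test (cube_cut k b) i) =
    C * young_pairing Omega th (separated_test (cube_cut k (fun x => b x * C^-1)) i).
  move=> yth; rewrite /young_pairing -RintegralZl//; last first.
    apply: (integrable_young_int yth); apply: separated_admissible.
    exact: cut_integrable mb' b1.
  apply: eq_Rintegral => x /set_mem Ox; rewrite /separated_test.
  rewrite !RintegralZl//; [|exact: continuous_integrable..].
  by rewrite /cube_cut; field; rewrite gt_eqF.
rewrite /cvg_at scale//.
rewrite (_ : (fun l => young_pairing Omega (theta_ l) (separated_test (cube_cut k b) i)) =
  fun l => C * young_pairing Omega (theta_ l) (separated_test (cube_cut k (fun x => b x * C^-1)) i));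
  last by apply/funext => l; exact: scale.
apply: cvgM; first exact: cvg_cst.
exact: cvg_at_cut1.
Qed.

Lemma cvg_at_integrable (b : V -> R) m (i : 'I_(sz m)) :
  lambda.-integrable (Omega : set T) (EFin \o (b : T -> R)) ->
  cvg_at (separated_test b i).
Proof.
move=> ib; have mb : measurable_fun (Omega : set T) (b : T -> R).
  by apply/measurable_EFinP; case/integrableP : ib.
pose bk k (x : V) := b x * \1_[set y | y <= k%:R] `|b x|.
have mbk k : measurable_fun (Omega : set T) (bk k : T -> R).
  exact: (@measurable_truncate _ T R Omega b k%:R mb).
have bkk k x : Omega x -> `|bk k x| <= k.+1%:R.
  move=> _; rewrite /bk indicE; case: (boolP (_ \in _)) => [/set_mem/= h|_].
    by rewrite mulr1 (le_trans h)// ler_nat.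
  by rewrite mulr0 normr0.
have mc k : measurable_fun (Omega : set T) (cube_cut k (bk k) : T -> R).
  by apply/measurable_EFinP; have /integrableP[] := cut_integrable k (mbk k) (bkk k).
apply: (cvg_at_approx (Phi_ := fun k => separated_test (cube_cut k (bk k)) i)
  (B := fun k (x : V) => `|b x - cube_cut k (bk k) x|) _ _ _ _ (integrable_norm ib)).
- exact: separated_admissible.
- by move=> k; apply: separated_admissible; exact: cut_integrable (mbk k) (bkk k).
- by move=> k; exact: (@cvg_at_cut k (bk k) m i _ (mbk k) (ltr0Sn R k) (bkk k)).
- move=> k; apply: (@measurable_fun_norm _ T R); exact: (@measurable_funB _ T R).
- move=> k x _; rewrite normr_id /cube_cut /bk !indicE.
  by case: (_ \in _); case: (_ \in _); rewrite ?(mulr1,mulr0,subr0,subrr,normr0) /=.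
- apply: aeW => x _.
  apply/cvgrPdist_le => e e0; near=> k.
  rewrite sub0r normrN normr_id /cube_cut /bk !indicE !mem_set ?mulr1 ?subrr ?normr0 ?ltW//=.
    near: k; exact: near_cube.
  near: k; exists (Num.truncn `|b x|).+1 => // k /= kt.
  by apply/ltW; apply: (lt_le_trans (truncnS_gt _)); rewrite ler_nat.
- by move=> k x z _; exact: separated_dist.
Unshelve. all: by end_near.
Qed.

Lemma admissible_integrable (Phi : V -> K -> R) z : admissible Phi ->
  lambda.-integrable (Omega : set T) (EFin \o ((Phi^~ z) : T -> R)).
Proof.
move=> [cPhi mPhi iPhi].
apply: (@le_integrable _ T R lambda _ mO _ (EFin \o (fun x : T => nrm (Phi x)))) => //.
  exact/measurable_EFinP.
move=> x Ox /=; rewrite lee_fin; apply: le_trans (ler_norm _).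
by apply: nrm_ge => //; exact: cPhi.
Qed.

(** The interpolations of Phi are finite sums of separated tests, and they converge
    to Phi with the integrable bound 2 |Phi|. *)
Lemma cvg_at_admissible (Phi : V -> K -> R) : admissible Phi -> cvg_at Phi.
Proof.
move=> aP; have [cPhi mPhi iPhi] := aP.
pose Q m (x : V) z := interp m (Phi x) z.
have cQ m x : continuous (Q m x) by exact: continuous_interp.
have mQ m z : measurable_fun (Omega : set T) (fun x : T => Q m x z).
  apply: (@measurable_sum _ T R) => i.
  apply: (@measurable_funM _ T R); [exact: mPhi|exact: measurable_cst].
have nQ m x z : Omega x -> `|Q m x z| <= nrm (Phi x).
  by move=> Ox; apply: interp_le => i; apply: (nrm_ge cK); exact: cPhi.
have aQ m : admissible (Q m).
  exact: (admissible_dom (fun x _ => cQ m x) (mQ m) iPhi (nQ m)).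
have cD m x : Omega x -> continuous (fun z => Phi x z - Q m x z).
  by move=> Ox; apply: continuous_sub; [exact: cPhi|exact: cQ].
apply: (cvg_at_approx (Phi_ := Q) (B := fun m x => nrm (fun z => Phi x z - Q m x z))
  (g := fun x => nrm (Phi x) + nrm (Phi x)) aP aQ).
- move=> m.
  have pairing (th : young_map R n K) : young Omega th ->
      young_pairing Omega th (Q m) =
      \sum_(i < sz m) young_pairing Omega th (separated_test (Phi^~ (pt i)) i).
    move=> yth.
    have is_ (i : 'I_(sz m)) := integrable_young_int yth
      (separated_admissible i (admissible_integrable (pt i) aP)).
    rewrite /young_pairing -(Rintegral_sum mO (index_enum _) is_).
    apply: eq_Rintegral => x _; rewrite prob_int_sum//; apply: eq_bigr => i _.
    by rewrite RintegralZl//; exact: continuous_integrable.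
  rewrite /cvg_at pairing//.
  rewrite (_ : (fun l => young_pairing Omega (theta_ l) (Q m)) = fun l =>
     \sum_(i < sz m) young_pairing Omega (theta_ l) (separated_test (Phi^~ (pt i)) i));
    last by apply/funext => l; exact: pairing.
  apply: cvg_bigsum => i; apply: cvg_at_integrable.
  exact: admissible_integrable.
- move=> m; apply: (measurable_nrm (Phi := fun x z => Phi x z - Q m x z)) => [|z].
    exact: cD.
  exact: (@measurable_funB _ T R).
- exact: integrable_EFinD.
- move=> m x Ox; rewrite ger0_norm; last exact/(nrm_ge0 cK)/cD.
  apply: (nrm_le cK); first exact: cD.
  move=> z; apply: le_trans (ler_normB _ _) _; apply: lerD; last exact: nQ.
  by apply: (nrm_ge cK); exact: cPhi.
- apply: aeW => x Ox; apply/cvgrPdist_le => e e0.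
  apply: filterS (admissible_near aP Ox e0) => m He.
  rewrite sub0r normrN ger0_norm; last exact/(nrm_ge0 cK)/cD.
  by apply: (nrm_le cK) => //; exact: cD.
- by move=> m x z Ox; apply: (nrm_ge cK z); exact: cD.
Qed.

(** Countably many tests, namely the functions a_j cut to a cube times a partition
    function, decide convergence against all tests: density of the a_j gives
    bounded coefficients, truncation gives integrable ones, and interpolation
    gives the general case. *)
Lemma young_determined : young_cvg Omega theta_ theta.
Proof. by split => // Phi /L1C0_admissible; exact: cvg_at_admissible. Qed.

End determined.

(** The simple maps are obtained by rounding the values at the nodes of the net
    down to the grid of mesh 1 / (m + 1) in [-m, m] and interpolating. *)
Lemma L1C0_of_admissible (Phi : V -> K -> R) : admissible Phi -> L1C0 Omega Phi.
Proof.
move=> aP; have [cPhi mPhi iPhi] := aP.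
have mn : measurable_fun (Omega : set T) (fun x : T => nrm (Phi x)).
  exact: measurable_nrm.
split => //; last first.
  move/integrableP : iPhi => [_]; apply: le_lt_trans.
  rewrite le_eqVlt; apply/orP; left; apply/eqP.
  apply: eq_integral => x /set_mem Ox /=.
  by rewrite ger0_norm ?(supnormE cK (cPhi x Ox))//; exact/nrm_ge0/cPhi.
(* shifting by m makes the levels of the values in [-m, m] natural numbers *)
pose lev m (t : R) : nat := Num.truncn (m.+1%:R * (t + m%:R)).
pose code m (x : V) : {ffun 'I_(sz m) -> 'I_(m.+1 * (m + m)).+1} :=
  [ffun i => inord (lev m (Phi x (pt i)))].
pose dec m (r : {ffun 'I_(sz m) -> 'I_(m.+1 * (m + m)).+1}) (z : K) : R :=
  \sum_i ((r i)%:R / m.+1%:R - m%:R) * @part m i z.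
have cdec m r : continuous (@dec m r).
  apply: continuous_bigsum => i z; apply: (@continuousM _ _ (cst _)).
    exact: cst_continuous.
  exact: cpart.
have mcode m r : measurable ((Omega : set T) `&` [set x : T | code m x = r]).
  rewrite (_ : _ `&` _ = \bigcap_(i in [set: 'I_(sz m)])
      ((Omega : set T) `&` [set x : T | inord (lev m (Phi x (pt i))) = r i]) `&` Omega).
    apply: measurableI; last exact: mO.
    apply: (@fin_bigcap_measurable _ T) => [|i _]; first exact: finite_finset.
    apply: (@measurable_trunc_code _ T R Omega (fun x : T => m.+1%:R * (Phi x (pt i) + m%:R)) _ _ mO).
    apply: (@measurable_funM _ T R); first exact: measurable_cst.
    by apply: (@measurable_funD _ T R) => //; exact: measurable_cst.
  apply/seteqP; split => x /=.
    by move=> [Ox xr]; split => // i _; split => //=; rewrite -xr ffunE.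
  by move=> [H Ox]; split => //; apply/ffunP => i; rewrite ffunE; have [] := H i I.
exists (fun m x => dec m (code m x)); split.
  move=> m; split.
  - by move=> x _; exact: cdec.
  - apply: (@sub_finite_set _ _ ((fun r => @dec m r) @` setT)).
      by move=> _ [x _ <-]; exists (code m x).
    apply: finite_image; exact: finite_finset.
  - move=> Psi; rewrite (_ : _ `&` _ = \bigcup_(r in [set r | @dec m r = Psi])
        ((Omega : set T) `&` [set x : T | code m x = r])).
      apply: fin_bigcup_measurable => [|r _]; last exact: mcode.
      exact: finite_finset.
    apply/seteqP; split => x /=; first by move=> [Ox xP]; exists (code m x).
    by move=> [r rP [Ox xr]]; split => //; rewrite /preimage/= xr.
apply: aeW => x Ox.
have cD m : continuous (fun z => Phi x z - dec m (code m x) z).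
  by apply: continuous_sub; [exact: cPhi|exact: cdec].
rewrite (_ : (fun m => _) = fun m => (nrm (fun z => Phi x z - dec m (code m x) z))%:E); last first.
  by apply/funext => m; rewrite (supnormE cK)//; exact: cD.
apply/fine_cvgP; split; first by near=> m.
apply/cvgrPdist_le => e e0; near=> m; rewrite /= sub0r normrN.
rewrite ger0_norm; last exact/(nrm_ge0 cK)/cD.
apply: (nrm_le cK) => [|z]; first exact: cD.
rewrite -[_ - _](subrKA (interp m (Phi x) z)) [e]splitr.
apply: le_trans (ler_normD _ _) _; apply: lerD.
  by move: z; near: m; apply: admissible_near => //; rewrite divr_gt0.
apply: (@le_trans _ _ m.+1%:R^-1); last first.
  near: m; exists (Num.truncn (e / 2)^-1) => // m /= em.
  rewrite -[leRHS]invrK lef_pV2 ?posrE ?invr_gt0 ?divr_gt0//.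
  by apply/ltW; apply: (lt_le_trans (truncnS_gt _)); rewrite ler_nat.
rewrite /interp /dec -sumrB; under eq_bigr do rewrite -mulrBl.
have close i : `|Phi x (@pt m i) - ((code m x i)%:R / m.+1%:R - m%:R)| <= m.+1%:R^-1.
  have nm : nrm (Phi x) <= m%:R.
    near: m; exists (Num.truncn (nrm (Phi x))).+1 => // m /= em.
    by apply/ltW; apply: (lt_le_trans (truncnS_gt _)); rewrite ler_nat.
  have := le_trans (nrm_ge cK (pt i) (cPhi x Ox)) nm.
  rewrite ler_norml => /andP[h1 h2]; rewrite ffunE /lev.
  set t := _ * (_ + _); have t0 : 0 <= t by rewrite mulr_ge0//; lra.
  have /andP[t1 t2] := truncn_itv t0.
  rewrite inordK; last first.
    rewrite ltnS -(ler_nat R) (le_trans t1)// /t natrM natrD ler_pM2l//; lra.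
  have m0 : (0 : R) < m.+1%:R by [].
  have mV : (m.+1%:R : R) * m.+1%:R^-1 = 1 by rewrite mulfV// gt_eqF.
  have tE : t / m.+1%:R = Phi x (pt i) + m%:R by rewrite /t mulrC mulKf ?gt_eqF.
  have d1 : (Num.truncn t)%:R / m.+1%:R <= Phi x (pt i) + m%:R.
    by rewrite -tE ler_pM2r// invr_gt0.
  have d2 : Phi x (pt i) + m%:R <= (Num.truncn t)%:R / m.+1%:R + m.+1%:R^-1.
    rewrite -tE -[X in _ + X]mul1r -mulrDl ler_pM2r ?invr_gt0//.
    by rewrite -natr1 in t2; exact: ltW.
  rewrite ger0_norm; first by rewrite lerBlDr addrA lerBrDr [leRHS]addrC.
  by rewrite subr_ge0 lerBlDr.
apply: le_trans (ler_norm_sum _ _ _) _.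
apply: (@le_trans _ _ (\sum_i m.+1%:R^-1 * @part m i z)); last first.
  by rewrite -mulr_sumr part_sum mulr1.
apply: ler_sum => i _.
by rewrite normrM (ger0_norm (part_ge0 _ _)) ler_wpM2r.
Unshelve. all: by end_near.
Qed.

End young_tests.

(** * Young measures reached by a sequence of maps *)

Lemma exp2V_near (R : realType) (e : R) : 0 < e ->
  \forall k \near \oo, (2 ^ k.+1)%:R^-1 <= e.
Proof.
move=> e0; exists (Num.truncn e^-1) => // k /= ek.
rewrite -[leRHS]invrK lef_pV2 ?posrE ?invr_gt0 ?ltr0n ?expn_gt0//.
apply/ltW; apply: (lt_le_trans (truncnS_gt _)); rewrite ler_nat.
exact: leq_ltn_trans ek (ltn_trans (ltnSn k) (ltn_expl k.+1 (isT : (1 < 2)%N))).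
Qed.

Section charted_tests.
Context (R : realType) (n : nat) (Omega : set 'rV[R]_n).
Local Notation V := 'rV[R]_n.
Local Notation T := (leb_type R n).
Local Notation lambda := (lebesgue R n).
Hypothesis mO : measurable (Omega : set T).
Context (K : ptopologicalType) (cK : compact [set: K]).
Context (L : finType) (g : L -> K -> R).
Hypothesis cg : forall l, continuous (g l).
Hypothesis ginj : forall z w, (forall l, g l z = g l w) -> z = w.

Let cpart m i : continuous (@net_part R K cK L g cg m i).
Proof. exact: continuous_net_part. Qed.
Let part_ge0 m i z : 0 <= @net_part R K cK L g cg m i z.
Proof. exact: net_part_ge0. Qed.
Let part_sum m z : \sum_i @net_part R K cK L g cg m i z = 1.
Proof. exact: net_part_sum. Qed.
Let interp_near (Psi : K -> R) e : continuous Psi -> 0 < e -> \forall m \near \oo,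
  forall z, `|Psi z - \sum_i Psi (net_pt i) * @net_part R K cK L g cg m i z| <= e.
Proof. exact: net_interp_cvg. Qed.

Lemma L1C0_dominated (Phi : V -> K -> R) (B : V -> R) :
  (forall x, Omega x -> continuous (Phi x)) ->
  (forall z, measurable_fun (Omega : set T) (fun x : T => Phi x z)) ->
  lambda.-integrable (Omega : set T) (EFin \o (B : T -> R)) ->
  (forall x z, Omega x -> `|Phi x z| <= B x) -> L1C0 Omega Phi.
Proof.
move=> cP mP iB PB; apply: (L1C0_of_admissible mO cK cpart part_ge0 part_sum interp_near).
exact: (admissible_dom mO cK part_ge0 part_sum interp_near cP mP iB PB).
Qed.

Lemma L1C0_integrable (theta : young_map R n K) (Phi : V -> K -> R) :
  young Omega theta -> L1C0 Omega Phi ->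
  lambda.-integrable (Omega : set T) (EFin \o (fun x : T => \int[theta x]_z Phi x z)).
Proof.
move=> yt iPhi; have aP := L1C0_admissible mO cK part_ge0 part_sum interp_near iPhi.
exact: (integrable_young_int mO cK cpart interp_near yt aP).
Qed.

Lemma L1C0_nrm_integrable (Phi : V -> K -> R) : L1C0 Omega Phi ->
  lambda.-integrable (Omega : set T) (EFin \o (fun x : T => nrm (Phi x))).
Proof. by move/(L1C0_admissible mO cK part_ge0 part_sum interp_near) => -[]. Qed.

Lemma young_dirac_int (v : V -> K) (Psi : K -> R) (x : V) : continuous Psi ->
  \int[young_dirac v x]_z Psi z = Psi (v x).
Proof. exact: prob_int_dirac. Qed.

(** Dominated convergence applies, with the norm of the test as the bound. *)
Lemma young_cvg_dirac (Y_ : nat -> V -> K) (Y : V -> K) :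
  (forall l, young Omega (young_dirac (Y_ l) : young_map R n K)) ->
  young Omega (young_dirac Y : young_map R n K) ->
  {ae lambda, forall x, Omega x -> Y_ l x @[l --> \oo] --> Y x} ->
  young_cvg Omega (fun l => young_dirac (Y_ l)) (young_dirac Y : young_map R n K).
Proof.
move=> yY_ yY YY; split => // Phi iPhi; have [cPhi _ _] := iPhi.
have E (v : V -> K) x : Omega x -> \int[young_dirac v x]_z Phi x z = Phi x (v x).
  by move=> Ox; apply: young_dirac_int; exact: cPhi.
apply: (@dominated_Rintegral_cvg _ T R lambda Omega
  (fun l (x : T) => \int[young_dirac (Y_ l) x]_z Phi x z) _ (fun x => nrm (Phi x)) mO).
- by move=> l; apply/measurable_EFinP; have /integrableP[] := L1C0_integrable (yY_ l) iPhi.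
- by apply/measurable_EFinP; have /integrableP[] := L1C0_integrable yY iPhi.
- apply: ae_mono YY => x H Ox.
  rewrite E//; under eq_fun do rewrite E//.
  exact: continuous_cvg (cPhi x Ox (Y x)) (H Ox).
- exact: L1C0_nrm_integrable.
- by move=> l x Ox; rewrite E//; apply: (nrm_ge cK); exact: cPhi.
Qed.

End charted_tests.

Section reachable.
Context (R : realType) (n : nat) (Omega : set 'rV[R]_n).
Local Notation V := 'rV[R]_n.
Local Notation T := (leb_type R n).
Local Notation lambda := (lebesgue R n).
Hypothesis mO : measurable (Omega : set T).
Context (K : ptopologicalType) (cK : compact [set: K]).
Context (L : finType) (g : L -> K -> R).
Hypothesis cg : forall l, continuous (g l).
Hypothesis ginj : forall z w, (forall l, g l z = g l w) -> z = w.

Context (Y : nat -> V -> K) (D : nat -> nat -> R).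
Hypothesis yY : forall j, young Omega (young_dirac (Y j) : young_map R n K).

(** Late members of the fixed sequence Y meet finitely many tests and the bound on D
    simultaneously. In contrast to convergence along a subsequence, this notion is
    stable under weak limits without any diagonal argument. *)
Definition reachable (theta : young_map R n K) : Prop :=
  young Omega theta /\
  forall (S : finType) (Phi : S -> V -> K -> R), (forall s, L1C0 Omega (Phi s)) ->
  forall (e : R) (k j0 : nat), 0 < e ->
  exists j, (j0 <= j)%N /\
    (forall s, `|young_pairing Omega (young_dirac (Y j)) (Phi s) -
                 young_pairing Omega theta (Phi s)| <= e) /\ D k j <= e.

Lemma reachable_closed (theta_ : nat -> young_map R n K) theta :
  (forall l, reachable (theta_ l)) -> young_cvg Omega theta_ theta -> reachable theta.
Proof.
move=> rt [yt_ yt ct]; split => // S Phi iPhi e k j0 e0.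
have e2 : 0 < e / 2 by rewrite divr_gt0.
have : \forall l \near \oo, forall s,
    `|young_pairing Omega theta (Phi s) - young_pairing Omega (theta_ l) (Phi s)| <= e / 2.
  apply: filter_forall => s.
  by have /cvgrPdist_le/(_ _ e2) := ct _ (iPhi s).
case=> l _ /(_ l (leqnn _)) Hl.
have [j [jj0 [Hj Dj]]] := (rt l).2 S Phi iPhi (e / 2) k j0 e2.
exists j; split => //; split; last by apply: le_trans Dj _; lra.
move=> s; rewrite -(subrKA (young_pairing Omega (theta_ l) (Phi s))) (splitr e).
apply: le_trans (ler_normD _ _) _; apply: lerD; first exact: Hj.
by rewrite distrC; exact: Hl.
Qed.

(** Measurability of the terms is part of the convergence itself; for the difference
    quotients it is read off in this way. *)
Lemma successive_young (I : eqType) (s : seq I) (f : (I -> nat) -> young_map R n K) theta m :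
  s != [::] -> successive_lim (@young_cvg R n K Omega) s f theta -> young Omega (f m).
Proof.
case: s => [//|c s] _ /= [h [/(_ m)[yf _ _] _]].
rewrite (_ : m = [eta m with c |-> m c]); first exact: yf.
by apply/funext => i /=; case: eqP => // ->.
Qed.

Lemma reachable_successive (I : eqType) (s : seq I) (f : (I -> nat) -> young_map R n K) theta :
  (forall m, reachable (f m)) ->
  successive_lim (@young_cvg R n K Omega) s f theta -> reachable theta.
Proof.
elim: s f => [|c s IH] f rf /=; first by move=> /(_ (fun=> 0%N)) <-.
by move=> [h [hc]]; apply: IH => m; apply: reachable_closed (hc m) => l; exact: rf.
Qed.

Context (a : nat -> V -> R).
Hypothesis ma : forall j, measurable_fun (Omega : set T) (a j : T -> R).
Hypothesis a1 : forall j x, `|a j x| <= 1.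
Hypothesis a_dense : forall b : V -> R, measurable_fun (Omega : set T) (b : T -> R) ->
  (forall x, Omega x -> `|b x| <= 1) ->
  exists j_ : nat -> nat,
    {ae lambda, forall x, Omega x -> a (j_ l) x @[l --> \oo] --> b x}.

(** The k-th index is chosen to meet the tests indexed below k + 1 within the error
    1 / 2 ^ (k + 1), out of a countable family that determines convergence. *)
Lemma reachable_sequence (theta : young_map R n K) : reachable theta ->
  exists j_ : nat -> nat, [/\ increasing_index j_,
    young_cvg Omega (fun k => young_dirac (Y (j_ k))) theta &
    forall k, D k (j_ k) <= (2 ^ k.+1)%:R^-1].
Proof.
move=> [yt rt].
pose sz m := size (net cK cg m).
pose prt m (i : 'I_(sz m)) := net_part i.
(* the tests whose three indices are at most l *)
pose S l : finType := ('I_l.+1 * 'I_l.+1 * {m : 'I_l.+1 & 'I_(sz m)})%type.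
pose tst (k j m : nat) (i : 'I_(sz m)) := separated_test prt (cube_cut k (a j)) i.
pose Phi l (s : S l) := tst s.1.1 s.1.2 _ (tagged s.2).
have cprt m (i : 'I_(sz m)) : continuous (prt m i) by exact: continuous_net_part.
have prt0 m (i : 'I_(sz m)) z : 0 <= prt m i z by exact: net_part_ge0.
have prt1 m z : \sum_i prt m i z = 1 by exact: net_part_sum.
have near (Psi : K -> R) e : continuous Psi -> 0 < e -> \forall m \near \oo, forall z,
    `|Psi z - \sum_(i < sz m) Psi (net_pt i) * prt m i z| <= e.
  exact: net_interp_cvg.
have iPhi l s : L1C0 Omega (Phi l s).
  apply: (L1C0_of_admissible mO cK cprt prt0 prt1 near).
  apply: separated_admissible => //; first exact: near.
  exact: (cut_integrable mO _ (ma _) (fun x _ => a1 _ x)).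
have [k j0|j_ [ij Hj]] := @increasing_choice (fun k j => (forall s,
   `|young_pairing Omega (young_dirac (Y j)) (Phi k s) -
     young_pairing Omega theta (Phi k s)| <= (2 ^ k.+1)%:R^-1) /\ D k j <= (2 ^ k.+1)%:R^-1).
  apply: rt; first exact: iPhi.
  by rewrite invr_gt0 ltr0n expn_gt0.
exists j_; split => //; last by move=> k; case: (Hj k).
apply: (young_determined mO cK cprt prt0 prt1 near ma a1 a_dense (fun l => yY (j_ l)) yt).
move=> k j m i; apply/cvgrPdist_le => e e0; near=> l.
have hk : (k < l.+1)%N by near: l; exists k.
have hj : (j < l.+1)%N by near: l; exists j.
have hm : (m < l.+1)%N by near: l; exists m.
pose s : S l := (Ordinal hk, Ordinal hj, @Tagged _ (Ordinal hm) (fun m : 'I_l.+1 => 'I_(sz m)) i).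
have := (Hj l).1 s; rewrite distrC => /le_trans; apply.
by near: l; exact: exp2V_near.
Unshelve. all: by end_near.
Qed.

End reachable.

(** * Diffuse jets are reached by cell sums *)

Lemma continuous_minr (R : realType) (Z : topologicalType) (f h : Z -> R) :
  continuous f -> continuous h -> continuous (fun z => Num.min (f z) (h z)).
Proof. by move=> cf ch z; exact: (continuous_min (cf z) (ch z)). Qed.

Lemma continuous_maxr (R : realType) (Z : topologicalType) (f h : Z -> R) :
  continuous f -> continuous h -> continuous (fun z => Num.max (f z) (h z)).
Proof. by move=> cf ch z; exact: (continuous_max (cf z) (ch z)). Qed.

Lemma letter_count_perm (n : nat) (s t : seq 'I_n) :
  (letter_count s =1 letter_count t) <-> perm_eq s t.
Proof.
split=> [st|/seq.permP st i]; last exact: st.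
by apply/allP => i _; apply/eqP; exact: st.
Qed.

Lemma letter_count_le (n : nat) (s : seq 'I_n) i : (letter_count s i <= size s)%N.
Proof. exact: count_size. Qed.

Lemma symmetric_perm_eq (R : realType) N n q (X : symt R N n q) a (i j : q.-tuple 'I_n) :
  perm_eq i j -> \val X (a, i) = \val X (a, j).
Proof.
case/tuple_permP => s /val_inj ->.
by rewrite -(set_valP X a s j); congr (\val X (_, _)); apply: val_inj.
Qed.

Section cell_sum_jets.
Context (R : realType) (n N p : nat) (Omega : set 'rV[R]_n) (oO : open Omega).
Local Notation V := 'rV[R]_n.
Local Notation T := (leb_type R n).
Local Notation lambda := (lebesgue R n).
Local Notation MI := (multi_index n p).
Local Notation I := ('I_N * MI)%type.
Local Notation code := (cell_code n N p).
Local Notation K := (jet_bar R N n p).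
Local Notation jet := (jet R N n p).
Local Notation cell_sum := (@cell_sum R n N p Omega).
Let mO : measurable (Omega : set T). Proof. exact: measurable_open. Qed.

Definition word_index (s : seq 'I_n) : MI := [ffun d => inord (letter_count s d)].

Lemma word_indexE (q : 'I_p) (t : q.+1.-tuple 'I_n) d :
  word_index t d = letter_count t d :> nat.
Proof.
rewrite ffunE inordK// ltnS (leq_trans (letter_count_le _ _))// size_tuple.
exact: ltn_ord.
Qed.

(** The array of partial derivatives is symmetric already, since a derivative of a
    cell sum depends on the letter counts only. *)
Lemma jet_of_cell_sum (l : seq code) x (q : 'I_p) a (i : q.+1.-tuple 'I_n) :
  \val (jet_of p (cell_sum l) x q) (a, i) =
  code_field Omega l x (a, word_index i).
Proof.
pose X : tensor R N n q.+1 := fun ai => partial ai.2 (fun y => cell_sum l y 0 ai.1) x.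
have Xs : symmetric_tensor X.
  move=> b s j; rewrite /X /= !partial_cell_sum.
  congr (cell_sum_deriv _ _ _ _ _); apply/funext.
  by apply/letter_count_perm/tuple_permP; exists s.
have -> : \val (jet_of p (cell_sum l) x q) = sym_average X by [].
have XX : X \in @symmetric_tensor R N n q.+1 by exact/mem_set.
have := congr1 val (sym_val (exist _ X XX : symt R N n q.+1)) => /= ->.
rewrite /X /= partial_cell_sum /code_field /=.
by congr (cell_sum_deriv _ _ _ _ _); apply/funext => d; rewrite word_indexE.
Qed.

Lemma continuous_jet_of_cell_sum (l : seq code) : continuous (jet_of p (cell_sum l)).
Proof.
move=> x; apply: (@cvg_jet R N n p V (nbhs x) (nbhs_filter x) (jet_of p (cell_sum l))) => q [a i].
under eq_fun do rewrite jet_of_cell_sum.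
rewrite jet_of_cell_sum; exact: continuous_cell_sum_deriv.
Qed.

Lemma cell_sum_coord (l : seq code) x a :
  cell_sum l x 0 a = code_field Omega l x (a, [ffun=> ord0]).
Proof.
by rewrite mxE /code_field /=; congr (cell_sum_deriv _ _ _ _ _); apply/funext => d; rewrite ffunE.
Qed.

Lemma young_cell_sum (l : seq code) :
  young Omega (young_dirac (fun x => jet_incl (jet_of p (cell_sum l) x)) : young_map R n K).
Proof.
move=> Psi cPsi.
rewrite (_ : (fun x : T => _) = (fun x : T => Psi (jet_incl (jet_of p (cell_sum l) x)))).
  apply: (@measurable_continuous_lebesgue R n (Omega : set T)
     (fun x : V => Psi (jet_incl (jet_of p (cell_sum l) x))) mO).
  apply: (continuous_compo (f := jet_of p (cell_sum l)) (h := Psi \o @jet_incl R N n p)).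
    exact: continuous_jet_of_cell_sum.
  by apply: (continuous_compo (f := @jet_incl R N n p) (h := Psi)); [exact: continuous_jet_incl|].
by apply/funext => x; rewrite young_dirac_int.
Qed.

(** Testing against the charts gives the functions X / s^2 and 1 / s of the finite
    jet, from which X is recovered. *)
Lemma measurable_jet_coord (X : V -> jet) q ai :
  young Omega (young_dirac (fun x => jet_incl (X x)) : young_map R n K) ->
  measurable_fun (Omega : set T) (fun x : T => \val (X x q) ai).
Proof.
move=> yX.
have mchart l : measurable_fun (Omega : set T) (fun x : T => jet_chart l (jet_incl (X x))).
  have := yX _ (@continuous_jet_chart R N n p l).
  by under eq_fun do rewrite (young_dirac_int _ _ (@continuous_jet_chart R N n p l)).
pose tg (o : option ('I_N * q.+1.-tuple 'I_n)) : chart_index N n p :=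
  Tagged (fun q : 'I_p => option ('I_N * q.+1.-tuple 'I_n)) o.
rewrite (_ : (fun x : T => _) = (fun x : T => jet_chart (tg (Some ai)) (jet_incl (X x)) *
   (jet_chart (tg None) (jet_incl (X x)) ^+ 2)^-1)).
  apply: (@measurable_funM _ T R); first exact: mchart.
  rewrite (_ : (fun x : T => _) = (fun x : T =>
      (jet_chart (tg None) (jet_incl (X x)) ^+ 2) `^ (-1))); last first.
    by apply/funext => x; rewrite powR_inv1// sqr_ge0.
  apply: (@measurableT_comp _ _ _ T R R (fun t : R => t `^ (-1))); first exact: measurable_powR.
  by apply: (@measurable_funM _ T R); exact: mchart.
apply/funext => x; rewrite /jet_chart /=.
by rewrite mulfK// expf_neq0// invr_neq0// gt_eqF ?sqn_gt0.
Qed.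

Lemma measurable_map_comp (X : ptopologicalType) (f : V -> X) (h : X -> R) :
  measurable_map Omega f -> continuous h ->
  measurable_fun (Omega : set T) (fun x : T => h (f x)).
Proof.
move=> mf ch; apply: (@measurable_fun_open_preimage _ T R) => A oA.
move/continuousP : ch => /(_ A oA) oh.
have := mf mO (h @^-1` A); apply.
exact: sub_sigma_algebra.
Qed.

Definition word : finType := {q : 'I_p & q.+1.-tuple 'I_n}.

(** The prescribed derivatives: u itself for the multi-index 0 and the entries of
    the jet X otherwise. By symmetry all words with a given multi-index give the
    same entry, so any of them may be picked. *)
Definition jet_field (u : V -> 'rV[R]_N) (X : V -> jet) (x : V) (i : I) : R :=
  if [pick t : word | word_index (tagged t) == i.2] is Some t
  then \val (X x (tag t)) (i.1, tagged t) else u x 0 i.1.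

Lemma jet_field_word u X x (q : 'I_p) a (i : q.+1.-tuple 'I_n) :
  jet_field u X x (a, word_index i) = \val (X x q) (a, i).
Proof.
rewrite /jet_field; case: pickP => [[q' t] /= /eqP E|/(_ (Tagged (fun q : 'I_p => q.+1.-tuple 'I_n) i))].
  have ti : perm_eq t i.
    by apply/letter_count_perm => d; rewrite -!word_indexE E.
  have /val_inj qq : q' = q :> nat by move/perm_size : ti; rewrite !size_tuple => -[].
  by case: _ / qq i ti E => i ti _; exact: symmetric_perm_eq.
by rewrite /= eqxx.
Qed.

Lemma jet_field0 u X x a : jet_field u X x (a, [ffun=> ord0]) = u x 0 a.
Proof.
rewrite /jet_field; case: pickP => [[q t] /= /eqP /ffunP/(_ (thead t))|//].
move=> /(congr1 (@nat_of_ord _)); rewrite word_indexE ffunE /= /letter_count.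
by rewrite (tuple_eta t) /= eqxx.
Qed.

Local Notation chart := (@jet_chart R N n p).
Local Notation cchart := (@continuous_jet_chart R N n p).
Local Notation Y j := (fun x => jet_incl (jet_of p (cell_sum (decode_cells n N p j)) x)).
Local Notation const_field v := (fun (x : V) (i : I) => v x 0 i.1).

Definition value_gap (u : V -> 'rV[R]_N) (k j : nat) : R :=
  \int[lambda]_(x in (Omega : set T) `&` cube k)
    field_gap (const_field (cell_sum (decode_cells n N p j))) (const_field u) x.

Lemma decode_jet_cvg (u : V -> 'rV[R]_N) (X : V -> jet) :
  (forall a, measurable_fun (Omega : set T) (fun x : T => u x 0 a)) ->
  young Omega (young_dirac (fun x => jet_incl (X x)) : young_map R n K) ->
  exists j_ : nat -> nat, increasing_index j_ /\
  {ae lambda, forall x, Omega x ->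
     Y (j_ l) x @[l --> \oo] --> jet_incl (X x) /\
     forall a, cell_sum (decode_cells n N p (j_ l)) x 0 a @[l --> \oo] --> u x 0 a}.
Proof.
move=> mu yX.
have [|j_ [ij jc]] := @decode_ae_cvg R n N p Omega oO (jet_field u X).
  move=> [a b]; rewrite /jet_field /=; case: pickP => [t _|_]; last exact: mu.
  exact: measurable_jet_coord.
exists j_; split => //; apply: ae_mono jc => x H Ox; split.
  apply: (continuous_cvg _ (@continuous_jet_incl R N n p (X x))).
  apply: (@cvg_jet R N n p nat \oo _ (fun l => jet_of p (cell_sum (decode_cells n N p (j_ l))) x)) => q [a i].
  rewrite -(jet_field_word u X).
  under eq_fun do rewrite jet_of_cell_sum.
  exact: H.
move=> a; rewrite -(jet_field0 u X).
under eq_fun do rewrite cell_sum_coord.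
exact: H.
Qed.

Lemma increasing_index_ge (j_ : nat -> nat) k : increasing_index j_ -> (k <= j_ k)%N.
Proof. by move=> ij; elim: k => // k IH; exact: leq_ltn_trans IH (ij _ _ (ltnSn k)). Qed.

Lemma measurable_cell_sum l a : measurable_fun (Omega : set T) (fun x : T => cell_sum l x 0 a).
Proof.
rewrite (_ : (fun x : T => _) = fun x : T => code_field Omega l x (a, [ffun=> ord0])).
  exact: measurable_code_field.
by apply/funext => x; exact: cell_sum_coord.
Qed.

(** The finite jet X and the map u are prescribed independently, so late cell sums
    approach both. *)
Lemma reachable_dirac (u : V -> 'rV[R]_N) (X : V -> jet) :
  (forall a, measurable_fun (Omega : set T) (fun x : T => u x 0 a)) ->
  young Omega (young_dirac (fun x => jet_incl (X x)) : young_map R n K) ->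
  reachable Omega (fun j => Y j) (value_gap u) (young_dirac (fun x => jet_incl (X x))).
Proof.
move=> mu yX; split => // S Phi iPhi e k j0 e0.
have [j_ [ij jc]] := decode_jet_cvg mu yX.
have [_ _ YX] : young_cvg Omega (fun l => young_dirac (Y (j_ l)))
    (young_dirac (fun x => jet_incl (X x))).
  apply: (young_cvg_dirac mO (@compact_jet_bar R N n p) cchart (@jet_chart_inj R N n p)) => //.
    by move=> l; exact: young_cell_sum.
  by apply: ae_mono jc => x H Ox; have [] := H Ox.
have D0 : value_gap u k (j_ l) @[l --> \oo] --> (0 : R).
  rewrite [X in _ --> X](_ : 0 = \int[lambda]_(x in (Omega : set T) `&` cube k) cst 0 x); last first.
    by rewrite /Rintegral integral0.
  have mOk : measurable ((Omega : set T) `&` cube k).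
    by apply: measurableI => //; exact: measurable_cube.
  apply: (@lebesgue_bounded_cvg R n _ (fun l => field_gap
     (const_field (cell_sum (decode_cells n N p (j_ l)))) (const_field u)) (cst 0) 1 mOk).
  - exact: cubeI_lty.
  - move=> l; apply: (measurable_funS mO (@subIsetl _ _ _)).
    apply: measurable_field_gap => -[a b]; [exact: measurable_cell_sum|exact: mu].
  - exact: measurable_cst.
  - apply: ae_mono jc => x H [Ox _]; have [_ {}H] := H Ox.
    apply: (field_gap_cvg (fun l => const_field (cell_sum (decode_cells n N p (j_ l))))
      (const_field u) x).1.
    by move=> [a b]; exact: H.
  - by move=> l x _; have /andP[? ?] := field_gap01 (const_field (cell_sum (decode_cells n N p (j_ l)))) (const_field u) x;
      rewrite ger0_norm.
have : \forall l \near \oo, forall s,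
    `|young_pairing Omega (young_dirac (fun x => jet_incl (X x))) (Phi s) -
      young_pairing Omega (young_dirac (Y (j_ l))) (Phi s)| <= e.
  apply: filter_forall => s.
  by have /cvgrPdist_le/(_ _ e0) := YX _ (iPhi s).
move/cvgrPdist_le : D0 => /(_ _ e0) D0 H.
have [l [lj0 [Hl Dl]]] : exists l, (j0 <= l)%N /\ (forall s,
    `|young_pairing Omega (young_dirac (fun x => jet_incl (X x))) (Phi s) -
      young_pairing Omega (young_dirac (Y (j_ l))) (Phi s)| <= e) /\ `|0 - value_gap u k (j_ l)| <= e.
  have [l0 _ Hl0] := filterI H D0.
  have [h1 h2] := Hl0 (maxn l0 j0) (leq_maxl _ _).
  by exists (maxn l0 j0); split => //; exact: leq_maxr.
exists (j_ l); split; first exact: leq_trans lj0 (increasing_index_ge l ij).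
split; first by move=> s; rewrite distrC; exact: Hl.
by apply: le_trans Dl; rewrite sub0r normrN; exact: ler_norm.
Qed.

Definition clamp (t : R) : R := Num.max (-1) (Num.min 1 t).

Lemma clamp_le1 t : `|clamp t| <= 1.
Proof.
rewrite ler_norml /clamp le_max lexx/= ge_max ge_min lexx /= andbT.
by rewrite (@le_trans _ _ 0)// oppr_le0.
Qed.

Lemma clamp_id t : `|t| <= 1 -> clamp t = t.
Proof. by rewrite ler_norml => /andP[h1 h2]; rewrite /clamp (min_r h2) (max_r h1). Qed.

Lemma continuous_clamp : continuous clamp.
Proof.
have cid : continuous (id : R -> R) by move=> t; exact: cvg_id.
have c1 := @continuous_minr R R (cst 1) id (@cst_continuous _ _ _) cid.
exact: (@continuous_maxr R R (cst (-1)) _ (@cst_continuous _ _ _) c1).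
Qed.

(** The cell sums supply their own test coefficients. *)
Lemma clamped_dense (i0 : I) (b : V -> R) :
  measurable_fun (Omega : set T) (b : T -> R) -> (forall x, Omega x -> `|b x| <= 1) ->
  exists j_ : nat -> nat, {ae lambda, forall x, Omega x ->
    clamp (code_field Omega (decode_cells n N p (j_ l)) x i0) @[l --> \oo] --> b x}.
Proof.
move=> mb b1.
have [//|j_ [_ jc]] := @decode_ae_cvg R n N p Omega oO (fun x _ => b x).
exists j_; apply: ae_mono jc => x H Ox.
rewrite -[b x]clamp_id; last exact: b1.
by apply: (continuous_cvg _ (@continuous_clamp _)); exact: H.
Qed.

(** The jets of difference quotients are finite, hence reachable; their successive
    limit J is reachable by closedness. *)
Lemma diffuse_jet_sequence (E : 'I_N -> 'rV[R]_N) (Ef : 'I_N -> 'I_n -> 'rV[R]_n)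
    (u : V -> 'rV[R]_N) (h : tri p -> nat -> R) (J : young_map R n K) :
  (0 < p)%N -> (0 < N)%N -> measurable_map Omega u -> diffuse_jet E Ef Omega u h J ->
  exists j_ : nat -> nat, [/\ increasing_index j_,
    young_cvg Omega (fun k => young_dirac (Y (j_ k))) J &
    {ae lambda, forall x, Omega x -> forall a,
      cell_sum (decode_cells n N p (j_ k)) x 0 a @[k --> \oo] --> u x 0 a}].
Proof.
move=> p0 N0 mu [k ik slim].
have mua a : measurable_fun (Omega : set T) (fun x : T => u x 0 a).
  by apply: (measurable_map_comp (h := fun v : 'rV[R]_N => v 0 a) mu); exact: continuous_coord.
have tri0 : tri_order p != [::].
  by case: p p0 => // p' _; rewrite /tri_order enum_ordSl /= enum_ordSl.
have rJ : reachable Omega (fun j => Y j) (value_gap u) J.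
  apply: (reachable_successive _ slim) => m.
  have ym := @successive_young _ _ _ _ _ _ _ _ m tri0 slim.
  exact: (@reachable_dirac u
    (fun x => diffquot_jet E Ef Omega u (fun c => h c (k c (m c))) x) mua ym).
pose i0 : I := (Ordinal N0, [ffun=> ord0]).
have ma j : measurable_fun (Omega : set T)
    (fun x : T => clamp (code_field Omega (decode_cells n N p j) x i0)).
  apply: (@measurableT_comp _ _ _ T R R clamp); last exact: measurable_code_field.
  exact: continuous_measurable_fun continuous_clamp.
have [j_ [ij yj gj]] := reachable_sequence mO (@compact_jet_bar R N n p) cchart
  (@jet_chart_inj R N n p) (fun j => young_cell_sum (decode_cells n N p j))
  (a := fun j x => clamp (code_field Omega (decode_cells n N p j) x i0))
  ma
  (fun j x => clamp_le1 _) (clamped_dense i0) rJ.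
exists j_; split => //.
have := @lebesgue_ae_cvg0 R n Omega
  (fun k x => field_gap (const_field (cell_sum (decode_cells n N p (j_ k)))) (const_field u) x) mO.
move=> H; apply: ae_mono (H _ _ _) => {H}.
- move=> x H Ox a.
  exact: ((field_gap_cvg (fun k => const_field (cell_sum (decode_cells n N p (j_ k))))
    (const_field u) x).2 (H Ox) (a, [ffun=> ord0])).
- move=> l; apply: measurable_field_gap => -[a b]; [exact: measurable_cell_sum|exact: mua].
- by move=> l x _; exact: field_gap01.
- exact: gj.
Qed.

End cell_sum_jets.

(** * Superposition with Caratheodory maps *)

Lemma measurable_floor_level d (T : measurableType d) (R : realType) (D : set T)
    (g : T -> R) (m : nat) (z : int) : measurable D -> measurable_fun D g ->
  measurable (D `&` [set x : T | Num.floor (g x * m.+1%:R) = z]).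
Proof.
move=> mD mg.
have mh : measurable_fun D (fun x => g x * m.+1%:R).
  by apply: measurable_funM => //; exact: measurable_cst.
rewrite (_ : [set x : T | _] = (fun x => g x * m.+1%:R) @^-1` `[z%:~R, (z + 1)%:~R[).
  by apply: mh => //; exact: measurable_itv.
apply/seteqP; split => x /=; first by move=> <-; rewrite in_itv/= floor_itv.
by rewrite in_itv/= => zx; exact: floor_def.
Qed.

Lemma floor_grid_cvg (R : realType) (t : R) :
  (Num.floor (t * m.+1%:R))%:~R / m.+1%:R @[m --> \oo] --> t.
Proof.
apply/cvgrPdist_le => e e0; near=> m.
have m0 : (0 : R) < m.+1%:R by [].
have /andP[h1 h2] := floor_itv (t * m.+1%:R).
have h3 : (Num.floor (t * m.+1%:R))%:~R / m.+1%:R <= t by rewrite ler_pdivrMr.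
rewrite ger0_norm ?subr_ge0//; apply: (@le_trans _ _ m.+1%:R^-1).
  rewrite lerBlDl -[X in _ + X]mul1r -mulrDl ler_pdivlMr//.
  by rewrite intrD1 in h2; exact: ltW.
near: m; exists (Num.truncn e^-1) => // m /= em.
rewrite -[leRHS]invrK lef_pV2 ?posrE ?invr_gt0//.
by apply/ltW; apply: (lt_le_trans (truncnS_gt _)); rewrite ler_nat.
Unshelve. all: by end_near.
Qed.

Lemma cvg_to_pair (Z : Type) (G : set_system Z) {FG : Filter G} (A B : topologicalType)
    (f : Z -> A) (g : Z -> B) (a : A) (b : B) :
  f @ G --> a -> g @ G --> b -> (f z, g z) @[z --> G] --> (a, b).
Proof. by move=> fa gb; exact: (cvg_pair fa gb). Qed.

(** Open sets are countable unions of rational boxes. *)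
Lemma measurable_rV_coord (R : realType) n M (D : set (leb_type R n)) (f : 'rV[R]_n -> 'rV[R]_M) :
  measurable D ->
  (forall i, measurable_fun D (fun x : leb_type R n => f x 0 i)) ->
  measurable_map D f.
Proof.
move=> mD mf; rewrite /measurable_map.
apply: (@measurability _ _ (leb_type R n) (borel 'rV[R]_M) D f (@open 'rV[R]_M) erefl).
move=> _ [B oB <-].
rewrite (open_rat_obox oB) preimage_bigcup setI_bigcupr.
apply: countable_bigcupT_measurable => // q; case: ifP => _; last first.
  by rewrite preimage_set0 setI0; exact: measurable0.
rewrite (_ : _ `&` _ = \bigcap_(i in [set: 'I_M]) (D `&` (fun x : leb_type R n => f x 0 i) @^-1`
    `](ratr (q.1 0 i)), (ratr (q.2 0 i))[) `&` D).
  apply: measurableI => //; apply: (@fin_bigcap_measurable _ (leb_type R n)).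
    exact: finite_finset.
  by move=> i _; apply: mf => //; exact: measurable_itv.
apply/seteqP; split => x /=.
  move=> [Dx H]; split => // i _; split => //=; rewrite in_itv/=.
  by have := H i; rewrite !mxE.
move=> [H Dx]; split => // i; rewrite !mxE.
by have [_ /=] := H i I; rewrite in_itv/=.
Qed.

Section caratheodory.
Context (R : realType) (n N M p : nat) (Omega : set 'rV[R]_n) (oO : open Omega).
Local Notation V := 'rV[R]_n.
Local Notation T := (leb_type R n).
Local Notation lambda := (lebesgue R n).
Local Notation K := (jet_bar R N n p).
Local Notation jet := (jet R N n p).
Let mO : measurable (Omega : set T). Proof. exact: measurable_open. Qed.
Context (F : V -> 'rV[R]_N * jet -> 'rV[R]_M) (caraF : caratheodory_map Omega F).

Definition jet_index : finType := {q : 'I_p & ('I_N * q.+1.-tuple 'I_n)%type}.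

Definition jet_coord (X : jet) (l : jet_index) : R := \val (X (tag l)) (tagged l).

Definition jet_of_coord (c : jet_index -> R) : jet :=
  fun q => sym (fun ai => c (Tagged (fun q : 'I_p => ('I_N * q.+1.-tuple 'I_n)%type) ai)).

Lemma jet_of_coord_cvg (c_ : nat -> jet_index -> R) X :
  (forall l, c_ k l @[k --> \oo] --> jet_coord X l) ->
  jet_of_coord (c_ k) @[k --> \oo] --> X.
Proof.
move=> H; apply: (@cvg_jet R N n p nat \oo _ (fun k => jet_of_coord (c_ k))) => q [a i].
rewrite -{1}(sym_val (X q)) /= /sym_average.
apply: cvgM; first exact: cvg_cst.
apply: cvg_bigsum => s.
exact: (H (Tagged (fun q : 'I_p => ('I_N * q.+1.-tuple 'I_n)%type) (a, permute s i))).
Qed.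

(** The arguments (w, X) are rounded down to a grid, where they take countably many
    values, and for each value F is measurable in x. Continuity in the second
    argument gives convergence as the grid is refined. *)
Lemma caratheodory_comp (w : V -> 'rV[R]_N) (X : V -> jet) i :
  (forall a, measurable_fun (Omega : set T) (fun x : T => w x 0 a)) ->
  (forall l, measurable_fun (Omega : set T) (fun x : T => jet_coord (X x) l)) ->
  measurable_fun (Omega : set T) (fun x : T => F x (w x, X x) 0 i).
Proof.
move=> mw mX; have [mF cF] := caraF.
pose Q : countType := ({ffun 'I_N -> int} * {ffun jet_index -> int})%type.
pose fl m (t : R) : int := Num.floor (t * m.+1%:R).
pose code m x : Q := ([ffun a => fl m (w x 0 a)], [ffun l => fl m (jet_coord (X x) l)]).
pose dec m (q : Q) : 'rV[R]_N * jet :=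
  (\row_a ((q.1 a)%:~R / m.+1%:R), jet_of_coord (fun l => (q.2 l)%:~R / m.+1%:R)).
have mcode m q : measurable ((Omega : set T) `&` [set x : T | code m x = q]).
  rewrite (_ : _ `&` _ =
    (\bigcap_(a in [set: 'I_N]) ((Omega : set T) `&` [set x : T | fl m (w x 0 a) = q.1 a])) `&`
    (\bigcap_(l in [set: jet_index]) ((Omega : set T) `&` [set x : T | fl m (jet_coord (X x) l) = q.2 l]))
    `&` Omega).
    apply: measurableI; last exact: mO.
    apply: measurableI; apply: (@fin_bigcap_measurable _ T); try exact: finite_finset.
      by move=> a _; apply: measurable_floor_level; [exact: mO|exact: mw].
    by move=> l _; apply: measurable_floor_level; [exact: mO|exact: mX].
  apply/seteqP; split => x /=.
    by move=> [Ox <-]; split => //; split => j _ /=; rewrite ffunE.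
  move=> [[H1 H2] Ox]; split => //; rewrite [q]surjective_pairing /code.
  by congr pair; apply/ffunP => j; rewrite ffunE; [have [] := H1 j I|have [] := H2 j I].
apply: (@lebesgue_measurable_ae_cvg R n (Omega : set T)
   (fun m (x : T) => F x (dec m (code m x)) 0 i) _ mO).
  move=> m; apply: (@measurable_fun_open_preimage _ T R) => A oA.
  rewrite (_ : _ `&` _ = \bigcup_(q : Q) (((Omega : set T) `&` [set x : T | code m x = q]) `&`
      ((Omega : set T) `&` (fun x : T => F x (dec m q) 0 i) @^-1` A))).
    apply: countable_bigcupT_measurable => // q; apply: measurableI => //.
    have mFq := measurable_map_comp oO (mF (dec m q))
      (@continuous_coord R M i).
    by apply: mFq => //; exact: open_measurable.
  apply/seteqP; split => x /=; first by move=> [Ox Ax]; exists (code m x).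
  by move=> [q _ [[Ox <-] []]].
apply: ae_mono cF => x cFx Ox.
apply: (continuous_cvg _ (@continuous_coord R M i _)).
apply: (continuous_cvg _ (cFx Ox (w x, X x))).
apply: cvg_to_pair.
  apply: cvg_rV => a; under eq_fun do rewrite mxE ffunE.
  exact: floor_grid_cvg.
apply: jet_of_coord_cvg => l; under eq_fun do rewrite ffunE.
exact: floor_grid_cvg.
Qed.

End caratheodory.

(** * Supports, cut-offs and truncated norms *)

(** By compactness finitely many null open sets cover the set where Psi >= e, so
    Psi <= e almost everywhere. *)
Lemma prob_int_supp0 (R : realType) (K : ptopologicalType) (cK : compact [set: K])
    (theta : probability (borel K) R) (Psi : K -> R) : continuous Psi ->
  (forall z, 0 <= Psi z) -> (forall z, supp theta z -> Psi z = 0) ->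
  \int[theta]_z Psi z = 0.
Proof.
move=> cPsi Psi0 Psis; apply/eqP; rewrite eq_le; apply/andP; split; last first.
  by apply: Rintegral_ge0 => z _; exact: Psi0.
apply/ler_addgt0Pr => e e0; rewrite add0r.
have null z : exists U : set K, [/\ open U, U z &
    theta.-negligible ((U `&` [set w | e <= Psi w]) : set (borel K))].
  have [zs|/existsNP[U /not_implyP[[oU Uz] U0]]] := pselect (supp theta z).
    exists [set w | Psi w < e]; split => //=; last 2 first.
      by rewrite Psis.
    rewrite (_ : _ `&` _ = set0); first exact: negligible_set0.
    by apply/seteqP; split => // w [/= h1]; rewrite leNgt h1.
    by move/continuousP : cPsi => /(_ [set t | t < e]); apply; exact: open_lt.
  exists U; split => //; apply: (@negligibleS _ _ _ _ (U : set (borel K))).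
    exact: subIsetl.
  exists U; split => //; first exact: sub_sigma_algebra.
  by apply/eqP; rewrite eq_le measure_ge0 andbT leNgt; apply/negP.
have [U HU] := choice null.
have := cK; rewrite compact_cover => /(_ _ [set: K] U) [z _|z _|s _ sU].
- by have [] := HU z.
- by exists z => //; have [] := HU z.
have nS : theta.-negligible ([set w | e <= Psi w] : set (borel K)).
  apply: (@negligibleS _ _ _ _ (\bigcup_(z in [set` (s : seq K)])
      (U z `&` [set w | e <= Psi w] : set (borel K)))).
    by move=> w /= ew; have [z zs Uz] := sU w I; exists z.
  elim: (s : seq K) => [|z l IH].
    rewrite (_ : \bigcup_(z in _) _ = set0); first exact: negligible_set0.
    by apply/seteqP; split => // w [z /=]; rewrite in_nil.
  have [_ _ nz] := HU z; apply: negligibleS (negligibleU nz IH) => w [y /=].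
  by rewrite inE => /orP[/eqP ->|yl] Uy; [left|right; exists y].
have cm : continuous (fun z => Num.min (Psi z) e).
  by apply: (continuous_minr cPsi (h := cst e)); exact: cst_continuous.
rewrite (_ : \int[theta]_z Psi z = \int[theta]_z Num.min (Psi z) e).
  rewrite -[leRHS](prob_int_cst theta e); apply: prob_int_le => //.
    exact: cst_continuous.
  by move=> z; rewrite ge_min lexx orbT.
congr fine; apply: ae_eq_integral => //.
- by apply/measurable_EFinP; exact: measurable_continuous_borel.
- by apply/measurable_EFinP; apply: (@measurable_continuous_borel R K _ _ _ cm).
have aS : {ae theta, forall z : borel K, Psi z < e}.
  by apply: negligibleS nS => z /= /negP; rewrite -leNgt.
by apply: filterS aS => z h _; rewrite min_l ?ltW.
Qed.

Section cutoff.
Context (R : realType) (N n p : nat).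
Local Notation jet := (jet R N n p).
Local Notation K := (jet_bar R N n p).
Implicit Types X : jet.

Definition jet_sum X : R := \sum_l `|jet_coord X l|.

Lemma continuous_jet_coord_at (l : jet_index n N p) : continuous (fun X => jet_coord X l).
Proof. exact: continuous_jet_coord. Qed.

Lemma continuous_jet_sum : continuous jet_sum.
Proof.
apply: (@continuous_bigsum R jet _ _ (fun l X => `|jet_coord X l|)) => l.
exact/continuous_normr/continuous_jet_coord_at.
Qed.

Lemma jet_coord_le_sum X l : `|jet_coord X l| <= jet_sum X.
Proof. by rewrite /jet_sum (bigD1 l)//= lerDl; exact: sumr_ge0. Qed.

Lemma jet_normE X : jet_norm X = Num.sqrt (\sum_l jet_coord X l ^+ 2).
Proof.
congr Num.sqrt.
rewrite (sig_big_dep (J := fun q : 'I_p => ('I_N * q.+1.-tuple 'I_n)%type)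
  xpredT (fun _ => xpredT) (fun q ai => \val (X q) ai ^+ 2)).
by apply: eq_bigr => -[q ai].
Qed.

Lemma jet_coord_le_norm X l : `|jet_coord X l| <= jet_norm X.
Proof.
rewrite jet_normE -sqrtr_sqr ler_wsqrtr// (bigD1 l)//= lerDl.
by apply: sumr_ge0 => i _; exact: sqr_ge0.
Qed.

Lemma jet_sum_le_norm X : jet_sum X <= jet_norm X *+ #|jet_index n N p|.
Proof. by rewrite -sumr_const; apply: ler_sum => l _; exact: jet_coord_le_norm. Qed.

Lemma continuous_jet_norm : continuous (@jet_norm R N n p).
Proof.
rewrite (_ : @jet_norm R N n p = fun X => Num.sqrt (\sum_l jet_coord X l ^+ 2)); last first.
  by apply/funext => X; exact: jet_normE.
apply: (continuous_compo (h := Num.sqrt)); last exact: sqrt_continuous.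
apply: (@continuous_bigsum R jet _ _ (fun l X => jet_coord X l ^+ 2)) => l.
apply: (continuous_compo (h := fun t : R => t ^+ 2) (@continuous_jet_coord_at l)).
exact: exprn_continuous.
Qed.

(** Built on the sum of the absolute values of the entries, which bounds each entry
    and is comparable to the norm. *)
Definition cutoff (r : nat) X : R := Num.max 0 (Num.min 1 (r.+1%:R - jet_sum X)).

Lemma continuous_cutoff r : continuous (cutoff r).
Proof.
have c0 : continuous (cst 0 : jet -> R) by exact: cst_continuous.
have c1 : continuous (cst 1 : jet -> R) by exact: cst_continuous.
have cr : continuous (cst r.+1%:R : jet -> R) by exact: cst_continuous.
exact: (continuous_maxr c0 (continuous_minr c1 (continuous_sub cr continuous_jet_sum))).
Qed.

Lemma cutoff_ge0 r X : 0 <= cutoff r X.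
Proof. by rewrite /cutoff le_max lexx. Qed.

Lemma cutoff_le1 r X : cutoff r X <= 1.
Proof. by rewrite /cutoff ge_max ler01 ge_min lexx. Qed.

Lemma cutoff1 r X : jet_sum X <= r%:R -> cutoff r X = 1.
Proof.
by move=> h; rewrite /cutoff min_l ?max_r// lerBrDr -natr1 addrC lerD2r.
Qed.

Lemma cutoff0 r X : r.+1%:R <= jet_sum X -> cutoff r X = 0.
Proof. by move=> h; rewrite /cutoff max_l// ge_min subr_le0 h orbT. Qed.

Lemma continuous_cutoff_extend (r : nat) (phi : jet -> R) : continuous phi ->
  continuous (jet_extend (fun X => cutoff r X * phi X)).
Proof.
move=> cphi; apply: (continuous_jet_extend (r := r.+1%:R)).
  by move=> X; apply: (@continuousM _ _ (cutoff r) phi); [exact: continuous_cutoff|exact: cphi].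
move=> X q ai h; rewrite cutoff0 ?mul0r//.
apply: (@le_trans _ _ `|\val (X q) ai|); first exact: ltW.
exact: (jet_coord_le_sum X (Tagged (fun q : 'I_p => ('I_N * q.+1.-tuple 'I_n)%type) ai)).
Qed.

Lemma jet_extend_incl (phi : jet -> R) X : jet_extend phi (jet_incl X) = phi X.
Proof. by rewrite /jet_extend finite_jet_incl finite_part_incl. Qed.

Definition jet_box (r : R) : set jet := [set X : jet | forall q : 'I_p, @symt_cube R N n q.+1 r (X q)].

Lemma compact_jet_box r : compact (jet_box r).
Proof.
apply: (tychonoff (T := fun q : 'I_p => symt R N n q.+1)
  (A := fun q => @symt_cube R N n q.+1 r)) => q.
exact: compact_symt_cube.
Qed.

Lemma jet_box_sum r X : jet_sum X <= r -> jet_box r X.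
Proof.
move=> h q ai; apply: le_trans h.
exact: (jet_coord_le_sum X (Tagged (fun q : 'I_p => ('I_N * q.+1.-tuple 'I_n)%type) ai)).
Qed.

End cutoff.

Section truncated_size.
Context (R : realType) (M : nat).
Implicit Types w : 'rV[R]_M.

(** Truncation gives a bounded continuous function with the same sequences tending
    to 0. *)
Definition size1 w : R := Num.min 1 (\sum_i `|w 0 i|).

Lemma size1_ge0 w : 0 <= size1 w.
Proof. by rewrite /size1 le_min ler01 sumr_ge0. Qed.

Lemma size1_le1 w : size1 w <= 1.
Proof. by rewrite /size1 ge_min lexx. Qed.

Lemma size10 : size1 0 = 0.
Proof.
by rewrite /size1 big1 ?min_r// => i _; rewrite mxE normr0.
Qed.

Lemma continuous_size1 : continuous size1.
Proof.
have c1 : continuous (cst 1 : 'rV[R]_M -> R) by exact: cst_continuous.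
apply: (continuous_minr c1).
apply: (@continuous_bigsum R 'rV[R]_M _ _ (fun i w => `|w 0 i|)) => i.
exact/continuous_normr/continuous_coord.
Qed.

Lemma size1_cvg0 (w_ : nat -> 'rV[R]_M) :
  size1 (w_ k) @[k --> \oo] --> 0 -> w_ k @[k --> \oo] --> (0 : 'rV[R]_M).
Proof.
move=> H; apply: cvg_rV => i; rewrite mxE; apply/cvgrPdist_lt => e e0.
have e1 : 0 < Num.min 1 e by rewrite lt_min ltr01.
move/cvgrPdist_lt : H => /(_ _ e1); apply: filterS => k.
rewrite !sub0r !normrN (ger0_norm (size1_ge0 _)) /size1.
rewrite lt_min => /andP[]; rewrite !gt_min ltxx /= => s1 se.
apply: (@le_lt_trans _ _ (\sum_i `|w_ k 0 i|)).
  by rewrite (bigD1 i)//= lerDl; exact: sumr_ge0.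
by case/orP: se => // e1'; exact: lt_trans e1'.
Qed.

End truncated_size.

(** * Residuals along a generating sequence *)

Lemma Rintegral_mulindic d (T : measurableType d) (R : realType)
    (mu : {measure set T -> \bar R}) (D S : set T) (f : T -> R) :
  \int[mu]_(x in D) (f x * \1_S x) = \int[mu]_(x in D `&` S) f x.
Proof.
rewrite Rintegral_mkcondr; apply: eq_Rintegral => x _.
by rewrite patchE indicE; case: ifP; rewrite ?mulr1 ?mulr0.
Qed.

Lemma Rintegral_cvg0 d (T : measurableType d) (R : realType)
    (mu : {measure set T -> \bar R}) (D : set T) (f_ : nat -> T -> R) (C : R) :
  measurable D -> (mu D < +oo)%E -> (forall k, measurable_fun D (f_ k)) ->
  {ae mu, forall x, D x -> f_ k x @[k --> \oo] --> (0 : R)} ->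
  (forall k x, D x -> `|f_ k x| <= C) ->
  \int[mu]_(x in D) f_ k x @[k --> \oo] --> (0 : R).
Proof.
move=> mD fD mf f0 fC; rewrite [X in _ --> X](_ : 0 = \int[mu]_(x in D) cst 0 x).
  exact: (bounded_Rintegral_cvg mD fD mf (@measurable_cst _ _ _ _ _ (0 : R)) f0 fC).
by rewrite /Rintegral integral0.
Qed.

Lemma continuous_pairl (A B : topologicalType) (a : A) : continuous (fun b : B => (a, b)).
Proof.
move=> b; apply: (@cvg_to_pair B (nbhs b) (nbhs_filter b) A B (fun=> a) id a b).
  exact: cvg_cst.
exact: cvg_id.
Qed.

Lemma continuous_mulr_cst (R : realType) (Z : topologicalType) (f : Z -> R) (c : R) :
  continuous f -> continuous (fun z => f z * c).
Proof.
move=> cf z; apply: (@continuousM _ _ f (cst c)); first exact: cf.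
exact: cst_continuous.
Qed.

Lemma continuous_extend_cutoff (R : realType) N n p r :
  continuous (jet_extend (@cutoff R N n p r)).
Proof.
rewrite (_ : @cutoff R N n p r = fun X => cutoff r X * cst 1 X).
  by apply: continuous_cutoff_extend; exact: cst_continuous.
by apply/funext => X; rewrite mulr1.
Qed.

Section residual.
Context (R : realType) (n N M p : nat) (Omega : set 'rV[R]_n) (oO : open Omega).
Local Notation V := 'rV[R]_n.
Local Notation T := (leb_type R n).
Local Notation lambda := (lebesgue R n).
Local Notation K := (jet_bar R N n p).
Local Notation jet := (jet R N n p).
Let mO : measurable (Omega : set T). Proof. exact: measurable_open. Qed.

Lemma measurable_size1 (D : set T) (w : V -> 'rV[R]_M) :
  (forall i, measurable_fun D (fun x : T => w x 0 i)) ->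
  measurable_fun D (fun x : T => size1 (w x)).
Proof.
move=> mw; apply: (@measurable_minr _ T R D (cst 1)); first exact: measurable_cst.
apply: (@measurable_sum _ T R D _ _ (fun i (x : T) => `|w x 0 i|)) => i.
exact: (@measurable_fun_norm _ T R).
Qed.

Lemma measurable_jet_sum (D : set T) (X : V -> jet) :
  (forall l, measurable_fun D (fun x : T => jet_coord (X x) l)) ->
  measurable_fun D (fun x : T => jet_sum (X x)).
Proof.
move=> mX.
apply: (@measurable_sum _ T R D _ _ (fun l (x : T) => `|jet_coord (X x) l|)) => l.
exact: (@measurable_fun_norm _ T R).
Qed.

Lemma measurable_cutoff (D : set T) (X : V -> jet) r :
  (forall l, measurable_fun D (fun x : T => jet_coord (X x) l)) ->
  measurable_fun D (fun x : T => cutoff r (X x)).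
Proof.
move=> mX; apply: (@measurable_maxr _ T R D (cst 0)); first exact: measurable_cst.
apply: (@measurable_minr _ T R D (cst 1)); first exact: measurable_cst.
apply: (@measurable_funB _ T R D (cst r.+1%:R)); first exact: measurable_cst.
exact: measurable_jet_sum.
Qed.

Context (F : V -> 'rV[R]_N * jet -> 'rV[R]_M).
Hypothesis cF : forall x, Omega x -> continuous (F x).
Hypothesis mF : forall xi i, measurable_fun (Omega : set T) (fun x : T => F x xi 0 i).
Context (u : V -> 'rV[R]_N) (J : young_map R n K).
Hypothesis mu : forall a, measurable_fun (Omega : set T) (fun x : T => u x 0 a).
Hypothesis F0 : {ae lambda, forall x, Omega x -> forall X, supp_star (J x) X -> F x (u x, X) = 0}.
Context (v_ : nat -> V -> 'rV[R]_N) (X_ : nat -> V -> jet).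
Hypothesis mv : forall k a, measurable_fun (Omega : set T) (fun x : T => v_ k x 0 a).
Hypothesis mX : forall k l, measurable_fun (Omega : set T) (fun x : T => jet_coord (X_ k x) l).
Hypothesis vu : {ae lambda, forall x, Omega x -> forall a, v_ k x 0 a @[k --> \oo] --> u x 0 a}.
Hypothesis XJ : young_cvg Omega (fun k => young_dirac (fun x => jet_incl (X_ k x))) J.

Let caraF : caratheodory_map Omega F.
Proof.
split; last by apply: aeW => x; exact: cF.
by move=> xi; apply: measurable_rV_coord.
Qed.

Let f k (x : V) : 'rV[R]_M := F x (v_ k x, X_ k x).
Let fu k (x : V) : 'rV[R]_M := F x (u x, X_ k x).

Let mf k : measurable_fun (Omega : set T) (fun x : T => size1 (f k x)).
Proof. by apply: measurable_size1 => i; exact: caratheodory_comp. Qed.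

Let mfu k : measurable_fun (Omega : set T) (fun x : T => size1 (fu k x)).
Proof. by apply: measurable_size1 => i; exact: caratheodory_comp. Qed.

Let mOk k : measurable ((Omega : set T) `&` cube k).
Proof. by apply: measurableI => //; exact: measurable_cube. Qed.

Let Ok_fin k : (lambda ((Omega : set T) `&` cube k) < +oo)%E.
Proof. exact: cubeI_lty. Qed.

Let chart := @jet_chart R N n p.
Let cK := @compact_jet_bar R N n p.
Let cchart := @continuous_jet_chart R N n p.
Let chart_inj := @jet_chart_inj R N n p.

Let test r k x (z : K) : R :=
  jet_extend (fun Y => cutoff r Y * size1 (F x (u x, Y))) z * \1_(cube k) x.

Let ctest_jet x : Omega x -> continuous (fun Y : jet => size1 (F x (u x, Y))).
Proof.
move=> Ox; apply: (continuous_compo (h := @size1 R M)); last exact: continuous_size1.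
apply: (continuous_compo (f := fun Y : jet => (u x, Y)) (h := F x)); last exact: cF.
exact: continuous_pairl.
Qed.

Let test_ge0 r x z : 0 <= jet_extend (fun Y => cutoff r Y * size1 (F x (u x, Y))) z.
Proof.
by rewrite /jet_extend; case: ifP => // _; rewrite mulr_ge0 ?cutoff_ge0 ?size1_ge0.
Qed.

Let L1C0_test r k : L1C0 Omega (test r k).
Proof.
apply: (L1C0_dominated mO cK cchart chart_inj (B := cube_cut k (cst 1))).
- move=> x Ox; apply: continuous_mulr_cst.
  exact: (continuous_cutoff_extend (ctest_jet Ox)).
- move=> z; apply: (@measurable_funM _ T R).
    rewrite /jet_extend; case: (finite_jet z); last exact: measurable_cst.
    apply: (@measurable_funM _ T R); first exact: measurable_cst.
    by apply: measurable_size1 => i; exact: (caratheodory_comp oO caraF).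
  by apply: (@measurable_indic _ T R); exact: measurable_cube.
- apply: (cut_integrable mO k (C := 1)); first exact: measurable_cst.
  by move=> x _; rewrite normr1.
- move=> x z Ox; rewrite /test /cube_cut.
  have i0 : 0 <= \1_(cube k) x :> R by rewrite indicE ler0n.
  rewrite (ger0_norm (mulr_ge0 (test_ge0 r x z) i0)) (ler_wpM2r i0)//.
  rewrite /jet_extend; case: ifP => // _.
  by rewrite mulr_ile1 ?cutoff_ge0 ?cutoff_le1 ?size1_ge0 ?size1_le1.
Qed.

Let pairing_test_dirac r k j :
  young_pairing Omega (young_dirac (fun x => jet_incl (X_ j x))) (test r k) =
  \int[lambda]_(x in (Omega : set T) `&` cube k) (cutoff r (X_ j x) * size1 (fu j x)).
Proof.
rewrite /young_pairing -Rintegral_mulindic; apply: eq_Rintegral => x /set_mem Ox.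
have [ct _ _] := L1C0_test r k.
by rewrite young_dirac_int; [rewrite /test jet_extend_incl|exact: ct].
Qed.

Let pairing_test_jet r k : young_pairing Omega J (test r k) = 0.
Proof.
have [_ yJ _] := XJ; have iJ := L1C0_integrable mO cK cchart chart_inj yJ (L1C0_test r k).
transitivity (\int[lambda]_(x in (Omega : set T)) (cst 0 x : R)); last first.
  by rewrite /Rintegral integral0.
congr fine; apply: (@ae_eq_integral _ T R lambda (Omega : set T)).
- exact: mO.
- by case/integrableP : iJ.
- by apply/measurable_EFinP; exact: measurable_cst.
apply: ae_mono F0 => x H Ox; congr EFin; rewrite /test.
have ct := continuous_cutoff_extend (r := r) (ctest_jet Ox).
rewrite RintegralZr//; last exact: continuous_integrable.
suff Fz z : supp (J x) z -> jet_extend (fun Y => cutoff r Y * size1 (F x (u x, Y))) z = 0.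
  by rewrite (prob_int_supp0 cK ct (test_ge0 r x) Fz) mul0r.
move=> zJ; rewrite /jet_extend; case: ifP => // zf.
rewrite (H Ox); first by rewrite size10 mulr0.
by rewrite /supp_star /= finite_jetP.
Qed.

(** The integrand is the value at the jet of a continuous test with compact support.
    The limit of its means is the mean of the test against J, which vanishes
    because F(x, u(x), .) = 0 on the finite part of the support of J(x). *)
Lemma residual_u_cvg0 r k :
  \int[lambda]_(x in (Omega : set T) `&` cube k) (cutoff r (X_ j x) * size1 (fu j x))
    @[j --> \oo] --> (0 : R).
Proof.
have [_ _ /(_ _ (L1C0_test r k))] := XJ.
by rewrite pairing_test_jet; under eq_fun do rewrite pairing_test_dirac.
Qed.

Let F_near_u x r e : Omega x -> 0 < e ->
  (forall a, v_ k x 0 a @[k --> \oo] --> u x 0 a) ->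
  \forall j \near \oo, forall Y, jet_box r Y ->
    `|size1 (F x (v_ j x, Y)) - size1 (F x (u x, Y))| < e.
Proof.
move=> Ox e0 vx; have vux : v_ j x @[j --> \oo] --> u x by exact: cvg_rV.
have /compact_near_coveringP := @compact_jet_box R N n p r.
move=> /(_ nat \oo (fun j Y => `|size1 (F x (v_ j x, Y)) - size1 (F x (u x, Y))| < e) _).
apply => Y _.
have e2 : 0 < e / 2 by rewrite divr_gt0.
have cS : continuous (fun t => size1 (F x t)).
  by apply: (continuous_compo (h := @size1 R M)); [exact: cF|exact: continuous_size1].
have H1 : \forall Z \near Y & j \near \oo,
    `|size1 (F x (u x, Y)) - size1 (F x (v_ j x, Z))| < e / 2.
  have H : (v_ Zj.2 x, Zj.1) @[Zj --> filter_prod (nbhs Y) \oo] --> (u x, Y).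
    apply: cvg_to_pair; last exact: cvg_fst.
    by apply: (cvg_comp _ _ _ vux); exact: cvg_snd.
  have C := cvg_comp _ _ H (cS (u x, Y)).
  by move/cvgrPdist_lt : C => /(_ _ e2).
have H2 : \forall Z \near Y & j \near \oo,
    `|size1 (F x (u x, Y)) - size1 (F x (u x, Z))| < e / 2.
  have H : (u x, Zj.1) @[Zj --> filter_prod (nbhs Y) \oo] --> (u x, Y).
    apply: cvg_to_pair; first exact: cvg_cst.
    exact: cvg_fst.
  have C := cvg_comp _ _ H (cS (u x, Y)).
  by move/cvgrPdist_lt : C => /(_ _ e2).
apply: filterS (filterI H1 H2) => -[Z j] [/= h1 h2].
rewrite -(subrKA (size1 (F x (u x, Y)))) (splitr e).
by apply: le_lt_trans (ler_normD _ _) _; rewrite ltrD// distrC.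
Qed.

(** F(x, .) is uniformly continuous near the product of u(x) and a compact set of
    jets, so under the cut-off the argument u may be replaced by v_k. *)
Lemma residual_cutoff_cvg0 r k :
  \int[lambda]_(x in (Omega : set T) `&` cube k) (cutoff r (X_ j x) * size1 (f j x))
    @[j --> \oo] --> (0 : R).
Proof.
have mcf j : measurable_fun ((Omega : set T) `&` cube k)
    (fun x : T => cutoff r (X_ j x) * size1 (f j x)).
  apply: (measurable_funS mO (@subIsetl _ _ _)).
  exact: (@measurable_funM _ T R (Omega : set T) (fun x : T => cutoff r (X_ j x))
    (fun x : T => size1 (f j x)) (measurable_cutoff r (mX j)) (mf j)).
have mcu j : measurable_fun ((Omega : set T) `&` cube k)
    (fun x : T => cutoff r (X_ j x) * size1 (fu j x)).
  apply: (measurable_funS mO (@subIsetl _ _ _)).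
  exact: (@measurable_funM _ T R (Omega : set T) (fun x : T => cutoff r (X_ j x))
    (fun x : T => size1 (fu j x)) (measurable_cutoff r (mX j)) (mfu j)).
have b1 j (w : 'rV[R]_M) x : `|cutoff r (X_ j x) * size1 w| <= 1.
  rewrite ger0_norm ?mulr_ge0 ?cutoff_ge0 ?size1_ge0//.
  by rewrite mulr_ile1 ?cutoff_ge0 ?cutoff_le1 ?size1_ge0 ?size1_le1.
pose d j (x : T) := cutoff r (X_ j x) * size1 (f j x) - cutoff r (X_ j x) * size1 (fu j x).
have D0 : \int[lambda]_(x in (Omega : set T) `&` cube k) d j x @[j --> \oo] --> (0 : R).
  apply: (@Rintegral_cvg0 _ T R lambda _ d 2 (mOk k) (Ok_fin k)).
  - by move=> j; apply: (@measurable_funB _ T R).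
  - apply: ae_mono vu => x H [Ox _]; apply/cvgrPdist_lt => e e0.
    apply: filterS (@F_near_u x r.+1%:R e Ox e0 (H Ox)) => j Hj.
    rewrite sub0r normrN /d -mulrBr normrM (ger0_norm (cutoff_ge0 _ _)).
    have [h|h] := leP r.+1%:R (jet_sum (X_ j x)); first by rewrite cutoff0// mul0r.
    apply: le_lt_trans (Hj (X_ j x) (jet_box_sum (ltW h))).
    by rewrite ler_piMl// cutoff_le1.
  - move=> j x _; apply: le_trans (ler_normB _ _) _.
    by rewrite -[leRHS]/(2 : R) (_ : 2 = 1 + 1)// lerD.
rewrite (_ : (fun j => _) = (fun j => \int[lambda]_(x in (Omega : set T) `&` cube k) d j x +
   \int[lambda]_(x in (Omega : set T) `&` cube k) (cutoff r (X_ j x) * size1 (fu j x)))).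
  rewrite -[X in _ --> X](addr0 (0 : R)).
  exact: (cvgD D0 (residual_u_cvg0 r k)).
apply/funext => j.
have i1 := lebesgue_bounded_integrable (mOk k) (Ok_fin k) (mcf j) (fun x _ => b1 j _ x).
have i2 := lebesgue_bounded_integrable (mOk k) (Ok_fin k) (mcu j) (fun x _ => b1 j _ x).
by rewrite /d RintegralB// subrK.
Qed.

(** Where the limit measures charge no infinite direction, the cut-offs lose
    only a small part of the mass, uniformly along the sequence. *)
Lemma residual_tight_cvg0 (A : set T) k : measurable A -> A `<=` Omega ->
  (forall x, A x -> \int[J x]_z jet_extend (@cutoff R N n p r) z @[r --> \oo] --> (1 : R)) ->
  \int[lambda]_(x in A `&` cube k) size1 (f j x) @[j --> \oo] --> (0 : R).
Proof.
move=> mA AO J1.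
have mAk : measurable (A `&` cube k) by apply: measurableI => //; exact: measurable_cube.
have Ak_fin : (lambda (A `&` cube k) < +oo)%E by exact: cubeI_lty.
have AOk : A `&` cube k `<=` Omega by move=> x [/AO].
have sub g : measurable_fun (Omega : set T) g -> measurable_fun (A `&` cube k) g.
  exact: measurable_funS.
have cext r := @continuous_extend_cutoff R N n p r.
have ext0 r z : 0 <= jet_extend (@cutoff R N n p r) z.
  by rewrite /jet_extend; case: ifP => // _; exact: cutoff_ge0.
have ext1 r z : jet_extend (@cutoff R N n p r) z <= 1.
  by rewrite /jet_extend; case: ifP => // _; exact: cutoff_le1.
have [_ yJ cJ] := XJ.
have mJr r : measurable_fun (A `&` cube k) (fun x : T => 1 - \int[J x]_z jet_extend (@cutoff R N n p r) z).
  apply: (@measurable_funB _ T R _ (cst 1)); first exact: measurable_cst.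
  by apply: sub; exact: yJ.
have Jr0 x r : 0 <= \int[J x]_z jet_extend (@cutoff R N n p r) z.
  by apply: Rintegral_ge0 => z _; exact: ext0.
have Jr1 x r : \int[J x]_z jet_extend (@cutoff R N n p r) z <= 1.
  rewrite -[leRHS](prob_int_cst (J x)); apply: (prob_int_le cK) => //.
  exact: cst_continuous.
have tail : \int[lambda]_(x in A `&` cube k) (1 - \int[J x]_z jet_extend (@cutoff R N n p r) z)
    @[r --> \oo] --> (0 : R).
  apply: (@Rintegral_cvg0 _ T R lambda (A `&` cube k)
    (fun r x => 1 - \int[J x]_z jet_extend (@cutoff R N n p r) z) 1 mAk Ak_fin mJr).
  - apply: aeW => x [Ax _]; rewrite -(subrr (1 : R)).
    by apply: cvgB; [exact: cvg_cst|exact: J1].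
  - by move=> r x _; rewrite ger0_norm ?subr_ge0// lerBlDr lerDl.
pose Psi r (x : V) (z : K) : R := (1 - jet_extend (@cutoff R N n p r) z) * \1_(A `&` cube k) x.
have iPsi r : L1C0 Omega (Psi r).
  apply: (L1C0_dominated mO cK cchart chart_inj (B := fun x => cst 1 x * \1_(A `&` cube k) x)).
  - move=> x _; apply: continuous_mulr_cst.
    by apply: (continuous_sub (f := cst 1) _ (cext r)); exact: cst_continuous.
  - move=> z; apply: (@measurable_funM _ T R _ (cst _)); first exact: measurable_cst.
    by apply: (@measurable_indic _ T R).
  - apply: (@integrable_cut _ T R lambda _ mO (A `&` cube k) (cst 1) 1) => //.
      by apply: le_lt_trans Ak_fin; apply: lebesgue_le; exact: subIsetr.
    by move=> x _; rewrite normr1.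
  - move=> x z _; rewrite /Psi.
    have i0 : 0 <= \1_(A `&` cube k) x :> R by rewrite indicE ler0n.
    rewrite normrM (ger0_norm i0) (ler_wpM2r i0)// ger0_norm ?subr_ge0//.
    by rewrite lerBlDr lerDl.
have pd r (th : young_map R n K) : young Omega th -> young_pairing Omega th (Psi r) =
    \int[lambda]_(x in A `&` cube k) (1 - \int[th x]_z jet_extend (@cutoff R N n p r) z).
  move=> yth; rewrite -[in RHS](setIidr AOk) -Rintegral_mulindic.
  apply: eq_Rintegral => x _; rewrite /Psi RintegralZr//; last first.
    apply: (continuous_integrable cK).
    by apply: (continuous_sub (f := cst 1) _ (cext r)); exact: cst_continuous.
  have c1 : continuous (cst 1 : K -> R) by exact: cst_continuous.
  by congr (_ * _); rewrite (prob_int_sub cK (th x) c1 (cext r)) prob_int_cst.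
apply/cvgrPdist_le => e e0.
have e3 : 0 < e / 3 by rewrite divr_gt0.
move/cvgrPdist_le : tail => /(_ _ e3)[r _ /(_ r (leqnn _)) /=].
rewrite sub0r normrN => /(le_trans (ler_norm _)) tr.
have H1 : \forall j \near \oo,
    \int[lambda]_(x in A `&` cube k) (1 - cutoff r (X_ j x)) <= e / 3 + e / 3.
  have /cvgrPdist_le/(_ _ e3) := cJ _ (iPsi r); apply: filterS => j.
  have yj : young Omega (young_dirac (fun x => jet_incl (X_ j x)) : young_map R n K).
    by have [yd _ _] := XJ; exact: yd.
  rewrite /= (pd r _ yJ) (pd r _ yj).
  have -> : \int[lambda]_(x in A `&` cube k)
      (1 - \int[young_dirac (fun x => jet_incl (X_ j x)) x]_z jet_extend (@cutoff R N n p r) z) =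
     \int[lambda]_(x in A `&` cube k) (1 - cutoff r (X_ j x)).
    apply: eq_Rintegral => x _; congr (1 - _).
    by rewrite (young_dirac_int (fun x => jet_incl (X_ j x)) x (cext r)) jet_extend_incl.
  by move: tr; rewrite ler_norml => t1 /andP[h1 h2]; lra.
have H2 : \forall j \near \oo,
    \int[lambda]_(x in (Omega : set T) `&` cube k) (cutoff r (X_ j x) * size1 (f j x)) <= e / 3.
  have /cvgrPdist_le/(_ _ e3) := residual_cutoff_cvg0 r k; apply: filterS => j.
  by rewrite sub0r normrN; exact: le_trans (ler_norm _).
apply: filterS2 H1 H2 => j h1 h2.
have c0 x := cutoff_ge0 r (X_ j x); have c1 x := cutoff_le1 r (X_ j x).
have s0 x := size1_ge0 (f j x); have s1 x := size1_le1 (f j x).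
have b1 x : `|cutoff r (X_ j x) * size1 (f j x)| <= 1.
  by rewrite ger0_norm ?mulr_ge0// mulr_ile1.
have mc : measurable_fun (Omega : set T) (fun x : T => cutoff r (X_ j x)).
  exact: measurable_cutoff.
have mcf : measurable_fun (Omega : set T) (fun x : T => cutoff r (X_ j x) * size1 (f j x)).
  exact: (@measurable_funM _ T R (Omega : set T) (fun x : T => cutoff r (X_ j x))
    (fun x : T => size1 (f j x)) mc (mf j)).
have mc1 : measurable_fun (Omega : set T) (fun x : T => 1 - cutoff r (X_ j x)).
  by apply: (@measurable_funB _ T R _ (cst 1) _ _ mc); exact: measurable_cst.
have i1 := lebesgue_bounded_integrable mAk Ak_fin (sub _ _ _ mcf) (fun x _ => b1 x).
have i2 : lambda.-integrable (A `&` cube k) (EFin \o (fun x : T => 1 - cutoff r (X_ j x))).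
  apply: (lebesgue_bounded_integrable (C := 1) mAk Ak_fin (sub _ _ _ mc1)) => x _.
  by rewrite ger0_norm ?subr_ge0// lerBlDr lerDl.
have i3 : lambda.-integrable (A `&` cube k) (EFin \o (fun x : T => size1 (f j x))).
  apply: (lebesgue_bounded_integrable (C := 1) mAk Ak_fin (sub _ _ _ (mf j))) => x _.
  by rewrite ger0_norm.
have i4 := lebesgue_bounded_integrable (mOk k) (Ok_fin k)
  (measurable_funS mO (@subIsetl _ _ _) mcf) (fun x _ => b1 x).
rewrite sub0r normrN ger0_norm; last by apply: Rintegral_ge0 => x _; exact: s0.
(* s <= (1 - c) + c s for c and s in [0, 1] *)
apply: (@le_trans _ _ (\int[lambda]_(x in A `&` cube k)
    ((1 - cutoff r (X_ j x)) + cutoff r (X_ j x) * size1 (f j x)))).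
  apply: (le_Rintegral mAk i3 (integrable_EFinD mAk i2 i1)) => x _.
  by have := c1 x; have := s1 x; move: (cutoff r _) (size1 _) => c s; nra.
rewrite (RintegralD mAk i2 i1).
have h3 : \int[lambda]_(x in A `&` cube k) (cutoff r (X_ j x) * size1 (f j x)) <=
    \int[lambda]_(x in (Omega : set T) `&` cube k) (cutoff r (X_ j x) * size1 (f j x)).
  rewrite (_ : A `&` cube k = ((Omega : set T) `&` cube k) `&` A); last first.
    apply/seteqP; split => x /=; first by move=> [Ax kx]; split => //; split => //; exact: AO.
    by move=> [[_ kx] Ax].
  rewrite -Rintegral_mulindic; apply: (le_Rintegral (mOk k) _ i4).
    have fin : (lambda (((Omega : set T) `&` cube k) `&` A) < +oo)%E.
      by apply: le_lt_trans (Ok_fin k); apply: lebesgue_le; exact: subIsetl.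
    exact: (@integrable_cut _ T R lambda _ (mOk k) A
      (fun x : T => cutoff r (X_ j x) * size1 (f j x)) 1 mA fin
      (measurable_funS mO (@subIsetl _ _ _) mcf) (fun x _ => b1 x)).
  by move=> x _; rewrite ler_piMr ?mulr_ge0// indicE; case: (_ \in _).
by move: h1 h2 h3; lra.
Qed.

(** The k-th index makes the means on the k-th cube smaller than 1 / 2 ^ (k + 1),
    with a cut-off radius k that tends to infinity. *)
Lemma residual_subsequence (A : set T) : measurable A -> A `<=` Omega ->
  (forall x, A x -> \int[J x]_z jet_extend (@cutoff R N n p r) z @[r --> \oo] --> (1 : R)) ->
  exists s : nat -> nat, [/\ increasing_index s,
    {ae lambda, forall x, Omega x ->
       cutoff k (X_ (s k) x) * size1 (F x (v_ (s k) x, X_ (s k) x)) @[k --> \oo] --> (0 : R)} &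
    {ae lambda, forall x, A x ->
       size1 (F x (v_ (s k) x, X_ (s k) x)) @[k --> \oo] --> (0 : R)}].
Proof.
move=> mA AO J1.
have [k j0|s [is_ Hs]] := @increasing_choice (fun k j =>
    \int[lambda]_(x in (Omega : set T) `&` cube k) (cutoff k (X_ j x) * size1 (f j x)) <=
      (2 ^ k.+1)%:R^-1 /\
    \int[lambda]_(x in A `&` cube k) size1 (f j x) <= (2 ^ k.+1)%:R^-1).
  have e0 : 0 < (2 ^ k.+1)%:R^-1 :> R by rewrite invr_gt0 ltr0n expn_gt0.
  have /cvgrPdist_le/(_ _ e0) H1 := residual_cutoff_cvg0 k k.
  have /cvgrPdist_le/(_ _ e0) H2 := residual_tight_cvg0 k mA AO J1.
  have [l0 _ Hl0] := filterI H1 H2.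
  have [h1 h2] := Hl0 (maxn l0 j0) (leq_maxl _ _).
  exists (maxn l0 j0); split; first exact: leq_maxr.
  move: h1 h2; rewrite /= !sub0r !normrN => h1 h2.
  by split; [exact: le_trans (ler_norm _) h1|exact: le_trans (ler_norm _) h2].
exists s; split => //.
- apply: (@lebesgue_ae_cvg0 R n (Omega : set T)
    (fun k x => cutoff k (X_ (s k) x) * size1 (f (s k) x)) mO).
  + by move=> k; exact: (@measurable_funM _ T R (Omega : set T) (fun x : T => cutoff k (X_ (s k) x))
      (fun x : T => size1 (f (s k) x)) (measurable_cutoff k (mX (s k))) (mf (s k))).
  + by move=> k x _; rewrite mulr_ge0 ?cutoff_ge0 ?size1_ge0 ?mulr_ile1 ?cutoff_ge0
      ?cutoff_le1 ?size1_ge0 ?size1_le1.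
  + by move=> k; case: (Hs k).
- apply: (@lebesgue_ae_cvg0 R n A (fun k x => size1 (f (s k) x)) mA).
  + by move=> k; exact: (measurable_funS mO AO (mf (s k))).
  + by move=> k x _; rewrite size1_ge0 size1_le1.
  + by move=> k; case: (Hs k).
Qed.

End residual.

Lemma cutoff_mono (R : realType) N n p (r r' : nat) (X : jet R N n p) :
  (r <= r')%N -> cutoff r X <= cutoff r' X.
Proof.
move=> rr; have : (r.+1%:R : R) <= r'.+1%:R by rewrite ler_nat.
rewrite /cutoff; move: (r.+1%:R) (r'.+1%:R) (jet_sum X) => a b c ab.
by rewrite ge_max le_max lexx /= le_max; apply/orP; right; rewrite le_min !ge_min lexx /= lerD2r ab orbT.
Qed.

(** The cut-offs increase to the indicator of the finite jets, which has full
    measure when no component charges infinity. *)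
Lemma prob_int_cutoff_cvg1 (R : realType) N n p
    (theta : probability (borel (jet_bar R N n p)) R) :
  (forall q : 'I_p, theta ([set z : borel (jet_bar R N n p) |
     (z q : option (symt R N n q.+1)) = None]) = 0%E) ->
  \int[theta]_z jet_extend (@cutoff R N n p r) z @[r --> \oo] --> (1 : R).
Proof.
move=> th0; rewrite [X in _ --> X](_ : 1 = \int[theta]_z cst 1 z); last first.
  by rewrite prob_int_cst.
have mq (q : 'I_p) : measurable ([set z : borel (jet_bar R N n p) |
     (z q : option (symt R N n q.+1)) = None]).
  pose l : chart_index N n p := @Tagged _ q (fun q : 'I_p => option ('I_N * q.+1.-tuple 'I_n)) None.
  rewrite (_ : [set z | _] = @jet_chart R N n p l @^-1` [set 0]).
    rewrite -[X in measurable X]setTI.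
    by apply: (measurable_continuous_borel _ (@continuous_jet_chart R N n p l)).
  apply/seteqP; split => z; rewrite /preimage /= /jet_chart /=; first by move=> ->.
  by case: (z q : option _) => // X /eqP; rewrite invr_eq0 gt_eqF ?sqn_gt0.
apply: (@bounded_Rintegral_cvg _ _ R theta setT (fun r => jet_extend (@cutoff R N n p r)) (cst 1) 1) => //.
- by apply: (@le_lt_trans _ _ 1%E); [exact: probability_le1|exact: ltry].
- by move=> r; apply: measurable_continuous_borel => //; exact: continuous_extend_cutoff.
- have nN : theta.-negligible (\bigcup_(k in [set: nat])
     (if (insub k : option 'I_p) is Some q then [set z : borel (jet_bar R N n p) |
        (z q : option (symt R N n q.+1)) = None] else set0)).
    apply: negligible_bigcup => k; case: insubP => [q _ _|_]; last exact: negligible_set0.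
    by exists [set z : borel (jet_bar R N n p) | (z q : option (symt R N n q.+1)) = None]; split; [exact: mq|exact: th0|].
  apply: negligibleS nN => z /= /not_implyP[_ nz].
  have : ~~ finite_jet (z : jet_bar R N n p).
    apply/negP => zf; apply: nz.
    apply/cvgrPdist_le => e e0; near=> r.
    rewrite /jet_extend zf cutoff1; first by rewrite subrr normr0 ltW.
    near: r; exists (Num.truncn (jet_sum (finite_part z))).+1 => // r /= rt.
    by apply/ltW; apply: (lt_le_trans (truncnS_gt _)); rewrite ler_nat.
  rewrite negb_forall => /existsP[q]; rewrite negbK => /eqP zq.
  by exists q => //; rewrite valK.
- move=> r z _; rewrite /jet_extend; case: ifP => _; last by rewrite normr0.
  by rewrite ger0_norm ?cutoff_ge0 ?cutoff_le1.
Unshelve. all: by end_near.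
Qed.

(** A measurable stand-in for the complement of the set where the limit jet
    charges infinity. *)
Lemma tight_set_exists (R : realType) n N p (Omega : set 'rV[R]_n)
    (J : young_map R n (jet_bar R N n p)) : open Omega -> young Omega J ->
  exists A : set (leb_type R n), [/\ measurable A, A `<=` Omega,
    Omega `\` infinity_set Omega J `<=` A &
    forall x, A x -> \int[J x]_z jet_extend (@cutoff R N n p r) z @[r --> \oo] --> (1 : R)].
Proof.
move=> oO yJ; pose T := leb_type R n.
have mO : measurable (Omega : set T) by exact: measurable_open.
pose mass r (x : T) : R := \int[J x]_z jet_extend (@cutoff R N n p r) z.
have mI r : measurable_fun (Omega : set T) (mass r).
  by apply: yJ; exact: continuous_extend_cutoff.
have I1 r x : mass r x <= 1.
  rewrite -[leRHS](prob_int_cst (J x)); apply: (prob_int_le (@compact_jet_bar R N n p)).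
  - exact: continuous_extend_cutoff.
  - exact: cst_continuous.
  - by move=> z; rewrite /jet_extend; case: ifP => // _; exact: cutoff_le1.
have Im x r r' : (r <= r')%N -> mass r x <= mass r' x.
  move=> rr; apply: (prob_int_le (@compact_jet_bar R N n p)); try exact: continuous_extend_cutoff.
  by move=> z; rewrite /jet_extend; case: ifP => // _; exact: cutoff_mono.
exists (\bigcap_(m in [set: nat]) \bigcup_(r in [set: nat])
   ((Omega : set T) `&` mass r @^-1` `[1 - m.+1%:R^-1, +oo[)); split.
- apply: (@bigcap_measurableType _ T) => m _; apply: bigcup_measurable => r _.
  by apply: mI => //; exact: measurable_itv.
- by move=> x /(_ 0%N I)[r _ []].
- move=> x [Ox nE] m _.
  have /cvgrPdist_le/(_ m.+1%:R^-1) : mass r x @[r --> \oo] --> (1 : R).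
    apply: prob_int_cutoff_cvg1 => q; apply/eqP; rewrite eq_le measure_ge0 andbT leNgt.
    by apply/negP => Hq; apply: nE; exists q.
  rewrite invr_gt0 ltr0n => /(_ isT)[r _ /(_ r (leqnn _)) /=].
  rewrite ger0_norm ?subr_ge0// => h; exists r => //; split => //=.
  by rewrite in_itv/= andbT lerBlDr addrC -lerBlDr.
- move=> x Ax; apply/cvgrPdist_le => e e0.
  have [m em] : exists m : nat, m.+1%:R^-1 <= e.
    have [m _ Hm] := near_infty_natSinv_lt (PosNum e0).
    by exists m; apply/ltW; exact: (Hm m (leqnn m)).
  have [r0 _ [_ /=]] := Ax m I; rewrite in_itv/= andbT => h.
  exists r0 => // r /= rr; rewrite -/(mass r x) ger0_norm ?subr_ge0//.
  rewrite lerBlDr -lerBlDl; apply: le_trans (Im x _ _ rr); apply: le_trans h.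
  by rewrite lerD2l lerN2.
Qed.

(** * The three modes of convergence *)

Lemma enorm_coord (R : realType) M (w : 'rV[R]_M) i : `|w 0 i| <= enorm w.
Proof.
rewrite -sqrtr_sqr /enorm /dot ler_wsqrtr// (bigD1 i)//= -expr2 lerDl.
by apply: sumr_ge0 => j _; rewrite -expr2 sqr_ge0.
Qed.

Lemma continuous_enorm (R : realType) M : continuous (@enorm R M).
Proof.
apply: (continuous_compo (f := fun w : 'rV[R]_M => dot w w) (h := Num.sqrt)).
  apply: (@continuous_bigsum R 'rV[R]_M _ _ (fun i w => w 0 i * w 0 i)) => i w.
  by apply: (@continuousM _ _ (fun w : 'rV[R]_M => w 0 i) (fun w => w 0 i)); exact: continuous_coord.
exact: sqrt_continuous.
Qed.

Lemma enorm0 (R : realType) M : enorm (0 : 'rV[R]_M) = 0.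
Proof. by rewrite /enorm /dot big1 ?sqrtr0// => i _; rewrite mxE mul0r. Qed.

Lemma enorm_le0 (R : realType) M (w : 'rV[R]_M) : enorm w <= 0 -> w = 0.
Proof.
move=> w0; apply/rowP => i; rewrite mxE; apply/eqP.
by rewrite -normr_le0; exact: le_trans (enorm_coord w i) w0.
Qed.

Lemma scale_dominated (R : realType) M (C : R) (a b : nat -> R) (w : nat -> 'rV[R]_M) :
  (\forall k \near \oo, `|a k| <= C * `|b k|) ->
  b k *: w k @[k --> \oo] --> (0 : 'rV[R]_M) -> a k *: w k @[k --> \oo] --> (0 : 'rV[R]_M).
Proof.
move=> ab bw; apply: cvg_rV => i; rewrite mxE.
have bwi : C * `|b k * w k 0 i| @[k --> \oo] --> (0 : R).
  rewrite -[X in _ --> X](mulr0 C); apply: cvgM; first exact: cvg_cst.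
  rewrite -[X in _ --> X](normr0 R); apply: cvg_norm.
  rewrite [X in _ --> X](_ : 0 = (0 : 'rV[R]_M) 0 i); last by rewrite mxE.
  rewrite (_ : (fun k => b k * w k 0 i) = (fun v : 'rV[R]_M => v 0 i) \o (fun k => b k *: w k)).
    exact: (cvg_comp _ _ bw (@continuous_coord R M i 0)).
  by apply/funext => k; rewrite /= mxE.
apply/cvgrPdist_le => e e0; move/cvgrPdist_le : bwi => /(_ _ e0); apply: filterS2 ab => k abk.
rewrite !sub0r !normrN mxE => /(le_trans (ler_norm _)); apply: le_trans.
by rewrite !normrM mulrA ler_wpM2r.
Qed.

Lemma indic01 (R : realType) (U : Type) (A : set U) x : `|\1_A x : R| = \1_A x.
Proof. by rewrite ger0_norm// indicE ler0n. Qed.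

Section mode_comparison.
Context (R : realType) (n N M p : nat) (Omega : set 'rV[R]_n).
Local Notation V := 'rV[R]_n.
Local Notation T := (leb_type R n).
Local Notation lambda := (lebesgue R n).
Local Notation jet := (jet R N n p).
Local Notation d := #|jet_index n N p|.

Lemma jet_ball_cutoff1 (r : R) (k : nat) (X : jet) :
  r * d%:R <= k%:R -> jet_ball r X -> cutoff k X = 1.
Proof.
move=> rk Xr; apply: cutoff1; apply: le_trans (jet_sum_le_norm X) _.
rewrite -[leLHS]mulr_natr; apply: le_trans rk; apply: ler_wpM2r; first exact: ler0n.
exact: ltW.
Qed.

Lemma near_nat_ge (t : R) : \forall k \near \oo, t <= k%:R.
Proof.
exists (Num.truncn t).+1 => // k /= tk.
by apply/ltW; apply: (lt_le_trans (truncnS_gt _)); rewrite ler_nat.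
Qed.

(** On a fixed ball the cut-off of radius k is 1 as soon as k is large. *)
Lemma cutoff_cvg0_ball (X : nat -> jet) (w : nat -> 'rV[R]_M) (r : R) :
  cutoff k (X k) * size1 (w k) @[k --> \oo] --> (0 : R) ->
  \1_(jet_ball r) (X k) *: w k @[k --> \oo] --> (0 : 'rV[R]_M).
Proof.
move=> H; apply: size1_cvg0; apply/cvgrPdist_le => e e0.
move/cvgrPdist_le : H => /(_ _ e0); apply: filterS2 (near_nat_ge (r * d%:R)) => k rk.
rewrite !sub0r !normrN; apply: le_trans; rewrite (ger0_norm (size1_ge0 _)).
rewrite indicE; case: (boolP (_ \in _)) => [/set_mem Xr|_].
  by rewrite scale1r (jet_ball_cutoff1 rk Xr) mul1r (ger0_norm (size1_ge0 _)).
by rewrite scale0r size10.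
Qed.

(** The support lies in a closed cube of jets, which is compact as a product of
    compact cubes. *)
Lemma compact_supp_cutoff k : compact (closure [set X : jet | cutoff k X != 0]).
Proof.
apply: (subclosed_compact _ (@compact_jet_box R N n p k.+1%:R)); first exact: closed_closure.
move=> X cX; apply: jet_box_sum.
have cl : closed [set X : jet | jet_sum X <= k.+1%:R].
  by apply: (@closed_comp _ _ (@jet_sum R N n p) [set t | t <= k.+1%:R]) => [Y _|];
    [exact: continuous_jet_sum|exact: closed_le].
suff : closure [set X : jet | jet_sum X <= k.+1%:R] X by rewrite -((closure_id _).1 cl).
apply: closure_subset cX => Y /= Y0; rewrite leNgt; apply/negP => h.
by move/eqP: Y0; apply; exact: cutoff0 (ltW h).
Qed.

Lemma compact_bound (S : set jet) (g : jet -> R) : compact S -> continuous g ->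
  exists2 C, 0 < C & forall X, S X -> `|g X| < C.
Proof.
move=> cS cg; have := continuous_compact (continuous_subspaceT cg) cS.
move=> /compact_bounded[C [_ HC]]; exists (`|C| + 2); first by rewrite ltr_wpDl.
move=> X SX; apply: (@le_lt_trans _ _ (`|C| + 1)); last by rewrite ltrD2l ltr1n.
apply: (HC (`|C| + 1)); last by exists X.
by rewrite (le_lt_trans (ler_norm _))// ltrDl.
Qed.

(** A cut-off is a test function that equals 1 on the ball. *)
Lemma mode_test_ball (v : nat -> V -> 'rV[R]_N) (f : nat -> V -> 'rV[R]_M) :
  mode_test p Omega v f -> mode_ball p Omega v f.
Proof.
move=> H r r0; have [k _ /(_ k (leqnn k)) rk] := near_nat_ge (r * d%:R).
have := H _ (@continuous_cutoff R N n p k) (@compact_supp_cutoff k).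
apply: ae_mono => x {}H Ox; apply: (scale_dominated (C := 1)) (H Ox); near=> j.
rewrite mul1r indicE; case: (boolP (_ \in _)) => [/set_mem Xr|_].
  by rewrite (jet_ball_cutoff1 rk Xr).
by rewrite normr0.
Unshelve. all: by end_near. Qed.

(** A test function is bounded and supported in a ball. *)
Lemma mode_ball_test (v : nat -> V -> 'rV[R]_N) (f : nat -> V -> 'rV[R]_M) :
  mode_ball p Omega v f -> mode_test p Omega v f.
Proof.
move=> H Phi cPhi kPhi.
have [C C0 HC] := compact_bound kPhi cPhi.
have [r r0 Hr] := compact_bound kPhi (@continuous_jet_norm R N n p).
apply: ae_mono (H r r0) => x {}H Ox; apply: (scale_dominated (C := C)) (H Ox); near=> j.
set X := jet_of p (v j) x.
have [->|/eqP P0] := eqVneq (Phi X) 0; first by rewrite normr0 mulr_ge0// ltW.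
have SX : closure [set X : jet | Phi X != 0] X by apply: subset_closure; exact/eqP.
rewrite indicE mem_set ?normr1 ?mulr1; first exact/ltW/HC.
by apply: le_lt_trans (ler_norm _) _; exact: Hr.
Unshelve. all: by end_near. Qed.

Hypothesis oO : open Omega.
Let mO : measurable (Omega : set T). Proof. exact: measurable_open. Qed.

(** Convergence in measure controls the measure of these sets. *)
Definition bad_set (eps : R) (v : V -> 'rV[R]_N) (f : V -> 'rV[R]_M) : set T :=
  [set x | eps < enorm (f x)] `&` [set x | jet_norm (jet_of p v x) < eps^-1].

Lemma measurable_bad_set (A : set T) eps (v : V -> 'rV[R]_N) (f : V -> 'rV[R]_M) :
  measurable A -> A `<=` Omega -> measurable_map Omega f ->
  (forall l : jet_index n N p,
     measurable_fun (Omega : set T) (fun x : T => jet_coord (jet_of p v x) l)) ->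
  measurable (A `&` bad_set eps v f).
Proof.
move=> mA AO mf mX.
have me := measurable_map_comp oO mf (@continuous_enorm R M).
have mj : measurable_fun (Omega : set T) (fun x : T => jet_norm (jet_of p v x)).
  rewrite (_ : (fun x : T => _) = fun x : T =>
     Num.sqrt (\sum_l jet_coord (jet_of p v x) l ^+ 2)); last first.
    by apply/funext => x; exact: jet_normE.
  apply: (@measurableT_comp _ _ _ T R R Num.sqrt).
    by apply: continuous_measurable_fun; exact: sqrt_continuous.
  apply: (@measurable_sum _ T R (Omega : set T) _ _
    (fun l (x : T) => jet_coord (jet_of p v x) l ^+ 2)) => l.
  exact: (@measurable_funM _ T R).
rewrite (_ : A `&` _ = (A `&` ((Omega : set T) `&` (fun x : T => enorm (f x)) @^-1` `]eps, +oo[)) `&`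
   ((Omega : set T) `&` (fun x : T => jet_norm (jet_of p v x)) @^-1` `]-oo, eps^-1[)).
  apply: measurableI; last by apply: mj => //; exact: measurable_itv.
  by apply: measurableI => //; apply: me => //; exact: measurable_itv.
apply/seteqP; split => x; rewrite /bad_set /preimage /= !in_itv/= ?andbT.
  by move=> [Ax [h1 h2]]; do !split => //; exact: AO.
by move=> [[Ax [_ h1]] [_ h2]].
Qed.

Context (v : nat -> V -> 'rV[R]_N) (f : nat -> V -> 'rV[R]_M).
Hypothesis mf : forall k, measurable_map Omega (f k).
Hypothesis mX : forall k (l : jet_index n N p),
  measurable_fun (Omega : set T) (fun x : T => jet_coord (jet_of p (v k) x) l).

Lemma fine_measure_cvg0 (A : set T) (B : nat -> set T) :
  measurable A -> (lambda A < +oo)%E -> (forall k, measurable (A `&` B k)) ->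
  (lambda (A `&` B k) @[k --> \oo] --> 0%E) <->
  (\int[lambda]_(x in A) (\1_(A `&` B k) x : R) @[k --> \oo] --> (0 : R)).
Proof.
move=> mA fA mB.
have fB k : (lambda (A `&` B k) < +oo)%E.
  by apply: le_lt_trans fA; apply: lebesgue_le; exact: subIsetl.
have E : (fun k => lambda (A `&` B k)) =
    (fun k => (\int[lambda]_(x in A) (\1_(A `&` B k) x : R))%:E).
  apply/funext => k; rewrite (@Rintegral_indic _ T R lambda A _ mA (mB k)).
  rewrite setIAC setIid fineK// ge0_fin_numE//.
rewrite E; split => [/fine_cvgP[_]|H]; first exact.
by apply/fine_cvgP; split => //; near=> k.
Unshelve. all: by end_near. Qed.

(** At almost every point of A the indicator of the bad set is eventually 0, so its
    integral over A tends to 0. *)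
Lemma mode_ball_measure : mode_ball p Omega v f -> mode_measure p Omega v f.
Proof.
move=> H eps A e0 mA AO fA.
have mB k := measurable_bad_set eps mA AO (mf k) (mX k).
rewrite (_ : (fun k => _) = fun k => lambda (A `&` bad_set eps (v k) (f k))); last first.
  by apply/funext => k; rewrite setIA.
apply/(fine_measure_cvg0 mA fA mB).
apply: (@Rintegral_cvg0 _ T R lambda A (fun k => \1_(A `&` bad_set eps (v k) (f k))) 1 mA fA).
- by move=> k; apply: (@measurable_indic _ T R); exact: mB.
- have ei : 0 < eps^-1 by rewrite invr_gt0.
  apply: ae_mono (H _ ei) => x {}H Ax.
  have := cvg_comp _ _ (H (AO _ Ax)) (@continuous_enorm R M 0).
  rewrite enorm0 => /cvgrPdist_lt/(_ _ e0) {}H.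
  apply/cvgrPdist_lt => r r0; apply: filterS H => k /=.
  rewrite !sub0r !normrN indic01 => Hk; rewrite [X in X < _]indicE.
  case: (boolP (_ \in _)) => // /set_mem[_ [/= h1 h2]].
  move: Hk; rewrite indicE mem_set// scale1r => /(le_lt_trans (ler_norm _)).
  by rewrite ltNge (ltW h1).
- by move=> k x _; rewrite indic01 indicE; case: (_ \in _).
Qed.

(** The k-th index makes the bad set for 1 / (k + 1) smaller than 1 / 2 ^ (k + 1) on
    the k-th cube, so almost every point lies in finitely many of these bad sets. *)
Lemma mode_measure_ball : mode_measure p Omega v f ->
  exists2 s : nat -> nat, increasing_index s & mode_ball p Omega (v \o s) (f \o s).
Proof.
move=> H.
have mOk k : measurable ((Omega : set T) `&` cube k).
  by apply: measurableI => //; exact: measurable_cube.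
pose e k : R := k.+1%:R^-1.
have e0 k : 0 < e k by rewrite invr_gt0 ltr0n.
have mB k j := measurable_bad_set (e k) (mOk k) (@subIsetl _ _ _) (mf j) (mX j).
have mBO k j := measurable_bad_set (e k) mO (@subset_refl _ _) (mf j) (mX j).
have [k j0|s [is_ Hs]] := @increasing_choice (fun k j =>
    \int[lambda]_(x in (Omega : set T) `&` cube k)
      (\1_(((Omega : set T) `&` cube k) `&` bad_set (e k) (v j) (f j)) x : R) <= (2 ^ k.+1)%:R^-1).
  have := H (e k) ((Omega : set T) `&` cube k) (e0 k) (mOk k) (@subIsetl _ _ _) (@cubeI_lty R n _ k).
  rewrite (_ : (fun j => _) = fun j => lambda (((Omega : set T) `&` cube k) `&`
     bad_set (e k) (v j) (f j))); last by apply/funext => j; rewrite setIA.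
  move/(fine_measure_cvg0 (mOk k) (@cubeI_lty R n _ k) (mB k)) => /cvgrPdist_le.
  have p0 : 0 < (2 ^ k.+1)%:R^-1 :> R by rewrite invr_gt0 ltr0n expn_gt0.
  move=> /(_ _ p0)[l0 _ Hl0].
  exists (maxn l0 j0); split; first exact: leq_maxr.
  have := Hl0 (maxn l0 j0) (leq_maxl _ _); rewrite /= sub0r normrN.
  exact: le_trans (ler_norm _).
exists s => // r r0.
pose g k (x : T) : R := \1_((Omega : set T) `&` bad_set (e k) (v (s k)) (f (s k))) x.
have g0 : {ae lambda, forall x, (Omega : set T) x -> g k x @[k --> \oo] --> (0 : R)}.
  apply: (@lebesgue_ae_cvg0 R n (Omega : set T) g mO).
  - by move=> k; apply: (@measurable_indic _ T R); exact: mBO.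
  - by move=> k x _; rewrite /g indicE; case: (_ \in _); rewrite ?lexx ?ler01.
  - move=> k; apply: le_trans (Hs k); rewrite le_eqVlt; apply/orP; left; apply/eqP.
    apply: eq_Rintegral => x /set_mem[Ox kx]; rewrite /g !indicE; congr (_%:R).
    congr nat_of_bool; apply/idP/idP => /set_mem h; apply/mem_set.
      by case: h => _ h; split.
    by case: h => _ h; split.
apply: ae_mono g0 => x gx Ox; apply: cvg_rV => i; rewrite mxE.
apply/cvgrPdist_le => eta eta0.
have /cvgrPdist_lt/(_ 1 ltr01) := gx Ox.
apply: filterS2 (filterI (near_nat_ge r) (near_nat_ge eta^-1)) => k [rk ek].
rewrite !sub0r !normrN mxE indicE /g indic01 indicE.
case: (boolP (_ \in _)) => [|/negP nB _]; first by rewrite ltxx.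
case: (boolP (_ \in _)) => [/set_mem Xr|_]; last by rewrite mul0r normr0 ltW.
rewrite mul1r; apply: le_trans (enorm_coord _ i) _; apply: (@le_trans _ _ (e k)).
  rewrite leNgt; apply/negP => h; apply: nB; apply/mem_set; split => //; split => //=.
  rewrite /e invrK; apply: lt_le_trans Xr _; apply: le_trans rk _.
  by rewrite ler_nat.
rewrite /e -[leRHS]invrK lef_pV2 ?posrE ?invr_gt0//.
by apply: le_trans ek _; rewrite ler_nat.
Qed.

End mode_comparison.

(** * The approximating sequence *)

Lemma measurable_jet_of_cell_sum (R : realType) (n N p : nat) (Omega : set 'rV[R]_n)
    (l : seq (cell_code n N p)) (i : jet_index n N p) : open Omega ->
  measurable_fun (Omega : set (leb_type R n))
    (fun x : leb_type R n => jet_coord (jet_of p (cell_sum Omega l) x) i).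
Proof.
move=> oO; apply: measurable_continuous_lebesgue; first exact: measurable_open.
apply: (continuous_compo (f := jet_of p (cell_sum Omega l)) (h := fun X => jet_coord X i)).
  exact: continuous_jet_of_cell_sum.
exact: continuous_jet_coord_at.
Qed.

Lemma cvg_increasing (s : nat -> nat) : increasing_index s -> s k @[k --> \oo] --> \oo.
Proof.
move=> is_ A [m _ mA]; exists m => // k /= mk; apply: mA => /=.
exact: leq_trans mk (increasing_index_ge k is_).
Qed.

Lemma D_solution_supp (R : realType) (n N M p : nat) (E : 'I_N -> 'rV[R]_N)
    (Ef : 'I_N -> 'I_n -> 'rV[R]_n) (Omega : set 'rV[R]_n)
    (F : 'rV[R]_n -> 'rV[R]_N * jet R N n p -> 'rV[R]_M) (u : 'rV[R]_n -> 'rV[R]_N) h J :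
  D_solution E Ef Omega F u -> infinitesimal h -> diffuse_jet E Ef Omega u h J ->
  {ae lebesgue R n, forall x, Omega x -> forall X, supp_star (J x) X -> F x (u x, X) = 0}.
Proof.
move=> [_ sol] ih dj; apply: ae_mono (sol h J ih dj) => x H Ox X XJ.
suff : ((enorm (F x (u x, X)))%:E <= 0)%E by rewrite lee_fin; exact: enorm_le0.
rewrite -(H Ox); apply: ereal_sup_ubound.
by right; exists X.
Qed.

(** The sequence of cell sums that generates J is thinned out so that its residuals
    tend to 0 under growing cut-offs of the jets on Omega, and without any cut-off
    where J does not charge infinity. *)
Lemma generating_sequence (R : realType) (n N M p : nat) (E : 'I_N -> 'rV[R]_N)
    (Ef : 'I_N -> 'I_n -> 'rV[R]_n) (Omega : set 'rV[R]_n)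
    (F : 'rV[R]_n -> 'rV[R]_N * jet R N n p -> 'rV[R]_M) (u : 'rV[R]_n -> 'rV[R]_N) h J :
  (0 < p)%N -> (0 < N)%N -> open Omega -> caratheodory_map Omega F ->
  D_solution E Ef Omega F u -> infinitesimal h -> diffuse_jet E Ef Omega u h J ->
  exists s : nat -> nat, let v := fun k => cell_sum Omega (decode_cells n N p (s k)) in
    let f := fun k x => F x (v k x, jet_of p (v k) x) in
    [/\ increasing_index s, approximates Omega F u J v f, mode_ball p Omega v f &
        cvg_ae_on (Omega `\` infinity_set Omega J) f (fun=> 0)].
Proof.
move=> p0 N0 oO caraF sol ih dj.
have [mF cF] := caraF; have [mu _] := sol.
have mO : measurable (Omega : set (leb_type R n)) by exact: measurable_open.
have F0 := D_solution_supp sol ih dj.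
have [j_ [ij yj uj]] := diffuse_jet_sequence oO p0 N0 mu dj.
have [_ yJ _] := yj.
have [A [mA AO EA J1]] := tight_set_exists oO yJ.
(* On the null set where F is not continuous in its second variable it is
   replaced by zero, so that continuity holds at every point. *)
pose F' x := if `[< continuous (F x) >] then F x else fun=> 0.
have F'F : {ae lebesgue R n, forall x, Omega x -> F' x = F x}.
  by apply: ae_mono cF => x H Ox; rewrite /F'; case: asboolP => // nc; case: nc; exact: H.
have cF' x : Omega x -> continuous (F' x).
  by move=> _; rewrite /F'; case: asboolP => // _; exact: cst_continuous.
have mF' xi i : measurable_fun (Omega : set (leb_type R n)) (fun x : leb_type R n => F' x xi 0 i).
  apply: (@lebesgue_measurable_ae_cvg R n (Omega : set (leb_type R n))
    (fun _ (x : leb_type R n) => F x xi 0 i) _ mO).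
    by move=> _; exact: (measurable_map_comp oO (mF xi) (@continuous_coord R M i)).
  by apply: ae_mono F'F => x H Ox; rewrite H//; exact: cvg_cst.
have F'0 : {ae lebesgue R n, forall x, Omega x -> forall X, supp_star (J x) X -> F' x (u x, X) = 0}.
  by apply: ae_mono2 F0 F'F => x H1 H2 Ox X XJ; rewrite H2//; exact: H1.
have mua a : measurable_fun (Omega : set (leb_type R n)) (fun x : leb_type R n => u x 0 a).
  exact: (measurable_map_comp oO mu (@continuous_coord R N a)).
have [s [is_ sO sA]] := residual_subsequence oO cF' mF' mua F'0
  (fun k a => measurable_cell_sum oO (decode_cells n N p (j_ k)) a)
  (fun k l => measurable_jet_of_cell_sum (decode_cells n N p (j_ k)) l oO) uj yj mA AO J1.
exists (j_ \o s) => v f; split.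
- by move=> a b ab; exact/ij/is_.
- split.
  + move=> k; apply: (measurable_rV_coord mO) => i.
    exact: (caratheodory_comp oO caraF i
      (fun a => measurable_cell_sum oO (decode_cells n N p (j_ (s k))) a)
      (fun l => measurable_jet_of_cell_sum (decode_cells n N p (j_ (s k))) l oO)).
  + apply: ae_mono uj => x H Ox; apply: cvg_rV => a.
    exact: (cvg_comp _ _ (cvg_increasing is_) (H Ox a)).
  + have [yd _ cd] := yj; split; [by move=> k; exact: (yd (s k))|exact: yJ|move=> Phi iPhi].
    exact: (cvg_comp _ _ (cvg_increasing is_) (cd Phi iPhi)).
  + by [].
- move=> r r0; apply: ae_mono2 sO F'F => x H1 H2 Ox; rewrite /f -(H2 Ox).
  exact: cutoff_cvg0_ball (H1 Ox).
- apply: ae_mono2 sA F'F => x H1 H2 Ex; have Ox : Omega x by case: Ex.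
  rewrite /f -(H2 Ox); apply: size1_cvg0; exact/H1/EA.
Qed.

Theorem corollary12 (R : realType) (p n N M : nat)
    (p_gt0 : (0 < p)%N) (n_gt0 : (0 < n)%N) (N_gt0 : (0 < N)%N) (M_gt0 : (0 < M)%N)
    (E : 'I_N -> 'rV[R]_N) (Ef : 'I_N -> 'I_n -> 'rV[R]_n)
    (frameE : orthonormal_frame E) (frameEf : forall a, orthonormal_frame (Ef a))
    (Omega : set 'rV[R]_n) (openOmega : open Omega)
    (F : 'rV[R]_n -> 'rV[R]_N * jet R N n p -> 'rV[R]_M)
    (caraF : caratheodory_map Omega F)
    (u : 'rV[R]_n -> 'rV[R]_N) (solu : D_solution E Ef Omega F u) :
  exists U : (tri p -> nat) -> 'rV[R]_n -> 'rV[R]_N,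
    (forall m, smooth_vanishing Omega (U m)) /\
    forall (h : tri p -> nat -> R) (J : young_map R n (jet_bar R N n p)),
      infinitesimal h -> diffuse_jet E Ef Omega u h J ->
      (exists (idx : nat -> tri p -> nat) (f : nat -> 'rV[R]_n -> 'rV[R]_M),
         let v := fun k => U (idx k) in
         [/\ single_subsequence idx,
             approximates Omega F u J v f,
             mode_test p Omega v f &
             cvg_ae_on (Omega `\` infinity_set Omega J) f (fun=> 0)]) /\
      (forall (idx : nat -> tri p -> nat) (f : nat -> 'rV[R]_n -> 'rV[R]_M),
         let v := fun k => U (idx k) in
         single_subsequence idx -> approximates Omega F u J v f ->
         [/\ equiv_along_subseq (mode_test p Omega) (mode_ball p Omega) v f,
             equiv_along_subseq (mode_test p Omega) (mode_measure p Omega) v f &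
             equiv_along_subseq (mode_ball p Omega) (mode_measure p Omega) v f]).
Proof.
pose c0 : tri p := @tri_pos p (Ordinal p_gt0) ord0.
(* one sequence of functions serves all jets, indexed by the first entry of m *)
exists (fun m => cell_sum Omega (decode_cells n N p (m c0))); split.
  by move=> m; exact: cell_sum_smooth_vanishing.
move=> h J ih dj; split.
  have [s [is_ ap mb ci]] := generating_sequence p_gt0 N_gt0 openOmega caraF solu ih dj.
  exists (fun k _ => s k), (fun k x => F x (cell_sum Omega (decode_cells n N p (s k)) x,
    jet_of p (cell_sum Omega (decode_cells n N p (s k))) x)) => v; split => //.
  exact: mode_ball_test.
move=> idx f v sidx [mf vu yv Ff].
have mX k (l : jet_index n N p) : measurable_fun (Omega : set (leb_type R n))
    (fun x : leb_type R n => jet_coord (jet_of p (v k) x) l).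
  exact: measurable_jet_of_cell_sum.
have id_incr : increasing_index id by [].
have ball_measure (s : nat -> nat) : mode_ball p Omega (v \o s) (f \o s) ->
    mode_measure p Omega (v \o s) (f \o s).
  by apply: (mode_ball_measure openOmega) => k; [exact: mf|exact: mX].
have measure_ball := mode_measure_ball openOmega mf mX.
split; split.
- by move=> H; exists id => //; exact: mode_test_ball.
- by move=> H; exists id => //; exact: mode_ball_test.
- by move=> H; exists id => //; apply: ball_measure; exact: mode_test_ball.
- by move=> /measure_ball[s is_ H]; exists s => //; exact: mode_ball_test.
- by move=> H; exists id => //; exact: ball_measure.
- exact: measure_ball.
Qed.
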